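(* Let $B\subset W$ be a good lattice, $l=l(B)$, and $A$ a self-dual lattice with $B\subset A\subset B^*$. (i) The subspace $\mathcal{E}^B_0$ is non-zero. The subspaces $\mathcal{E}^{B,-}_0$ and $\mathcal{E}^{B,\pm}_n$, $n\ge1$, are non-zero if and only if $l>0$. The subspaces $\mathcal{E}^{B,\pm}_{n,1}$, $n\ge0$, are non-zero if and only if $l<r$. (ii) When non-zero, the subspaces $\mathcal{E}^{B,\pm}_n$ and $\mathcal{E}^{B,\pm}_{n,1}$, $n\ge0$, are invariant and irreducible under the restriction of the metaplectic (Weil) representation $S^A_\psi$ to $K_B$. The representations of $K_B$ so obtained are pairwise inequivalent. The restriction of the metaplectic representation to $K_B$ is multiplicity free and is the direct sum of these representations. (iii) One has $$\dim\mathcal{E}^{B,+}_0=1+\tfrac12(q^l-1),\qquad \dim\mathcal{E}^{B,-}_0=\tfrac12(q^l-1),$$ $$\dim\mathcal{E}^{B,\pm}_n=\tfrac12q^{2rn-l}(q^{2l}-1)\ (n\ge1),\qquad \dim\mathcal{E}^{B,\pm}_{n,1}=\tfrac12q^{2rn+l}(q^{2(r-l)}-1)\ (n\ge0).$$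
   Context: $k$ is a non-archimedean local field of characteristic $0$ with ring of integers $\mathcal{O}$, uniformizer $\varpi$, residue field $\mathbb{F}_q$ of characteristic $p\neq2$; $\psi$ is a non-trivial unitary character of $(k,+)$ with conductor $\lambda_\psi$ (trivial on $\varpi^{\lambda_\psi}\mathcal{O}$, not on $\varpi^{\lambda_\psi-1}\mathcal{O}$); $\overline\psi$ is the character of $\mathbb{F}_q$ with $\overline\psi(x\bmod\varpi)=\psi(\varpi^{\lambda_\psi-1}x)$. $(W,\beta)$ is a symplectic $k$-space of dimension $2r>0$. A lattice is a compact open $\mathcal{O}$-submodule; $B^*=\{v\in W:\beta(v,b)\in\varpi^{\lambda_\psi}\mathcal{O}\ \forall b\in B\}$; $B$ is good if $\varpi B^*\subset B\subset B^*$, self-dual if $B=B^*$. $K_B$ is the stabilizer of $B$ in $Sp(W)$ (a maximal compact subgroup). $\mathrm{b}^*=B^*/B$ is an $\mathbb{F}_q$-space with symplectic form $\beta_{\mathrm{b}^*}(\bar v,\bar w)=\varpi^{1-\lambda_\psi}\beta(v,w)\bmod\varpi$, of dimension $2l$, $l=l(B)$; $p_{Sp(\mathrm{b}^* )}:K_B\to Sp(\mathrm{b}^* )$ is the induced morphism. $\mathrm{x}=A/B$ is a Lagrangian of $\mathrm{b}^*$. Put $j(g)=l-\dim(\mathrm{x}\cap g\mathrm{x})$ for $g\in Sp(\mathrm b^* )$, $\omega(a)=q^{-1/2}\sum_{t\in\mathbb{F}_q}\overline\psi(\frac12at^2)$ for $a\in\mathbb F_q^\times$ (depends only on $a$ mod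 squares), and let $\theta:Sp(\mathrm{b}^* )\to\mathbb{F}_q^\times/(\mathbb{F}_q^\times)^2$ be the function with $\theta(p_1gp_2)=\theta(p_1)\theta(g)\theta(p_2)$ for $p_1,p_2$ in the stabilizer $P$ of $\mathrm{x}$, $\theta(p)=\det(p_{|\mathrm{x}})$ for $p\in P$, and $\theta(\tau_S)=1$ for $S\subset\{1,\dots,l\}$, where, for a symplectic basis $(\epsilon_i,\phi_i)$ of $\mathrm b^*$ with the $\epsilon_i$ spanning $\mathrm{x}$, $\tau_S \epsilon_i=\phi_i,\ \tau_S\phi_i=-\epsilon_i$ for $i\in S$ and $\tau_S$ fixes $\epsilon_i,\phi_i$ for $i\notin S$. Put $m(g)=\omega(\theta(g))^{-1}\omega(1)^{1-j(g)}$. $\mathcal{H}^A_\psi$ is the Hilbert space of functions $\varphi:W\to\mathbb{C}$ with $\varphi(a+w)=\psi(\frac12\beta(w,a))\varphi(w)$ ($a\in A$) and $\int_{W/A}|\varphi|^2<\infty$. For $g\in Sp(W)$, $$M_A(g)\varphi(w)=[A:A\cap gA]^{-1}\sum_{a\in A/(A\cap gA)}\psi(\tfrac12\beta(a,w))\varphi(g^{-1}(a+w)).$$ $K_B$ is identified with a subgroup of the metaplectic group $Mp(W)$ by a section for which the restriction to $K_B$ of the Weil representation (lattice model $S_\psi^A$ on $\mathcal{H}^A_\psi$) is $S^A_\psi(g)=m(p_{Sp(\mathrm{b}^* )}(g))\,q^{\frac12j(p_{Sp(\mathrm{b}^* )}(g))}M_A(g)$, $g\in K_B$. Subspaces of $\mathcal{H}^A_\psi$: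 $\mathcal{E}^B_0=\{f:\mathrm{Supp} f\subset B^*\}$; $\mathcal{E}^B_n=\{f:\mathrm{Supp} f\subset\varpi^{-n}(B^*\setminus B)\}$ for $n\ge1$; $\mathcal{E}^B_{n,1}=\{f:\mathrm{Supp} f\subset\varpi^{-(n+1)}B\setminus\varpi^{-n}B^*\}$ for $n\ge0$. $\mathcal{E}^+$ (resp. $\mathcal{E}^-$) denotes the subspace of even (resp. odd) functions of $\mathcal{E}$. *)

(* Defs.v *)
From HB Require Import structures.
From mathcomp Require Import all_boot all_order all_algebra.
From mathcomp Require Import sesquilinear finmap complex.
From mathcomp Require Import all_classical all_reals all_analysis.

Set Implicit Arguments.
Unset Strict Implicit.
Unset Printing Implicit Defensive.

Import Order.TTheory GRing.Theory Num.Theory.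
Import numFieldNormedType.Exports.

Local Open Scope classical_set_scope.
Local Open Scope ring_scope.

(* [v 0] is irrelevant: 0 is given valuation +oo here. *)
Definition val_ge (F : fieldType) (v : F -> int) (n : int) (x : F) : Prop :=
  x = 0 \/ n <= v x.

(* A field complete for a normalized discrete valuation, with finite residue
   field. The residue field is a finite field [residue] together with a
   surjection from the valuation ring whose kernel is the maximal ideal;
   [reduction] is irrelevant outside the valuation ring. *)
Record localField := LocalField {
  lf_field :> fieldType;
  valuation : lf_field -> int;
  unif : lf_field;
  residue : finFieldType;
  reduction : lf_field -> residue;
  valM : forall x y,
    x != 0 -> y != 0 -> valuation (x * y) = valuation x + valuation y;
  valD : forall n x y,
    val_ge valuation n x -> val_ge valuation n y -> val_ge valuation n (x + y);
  unif_neq0 : unif != 0;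
  val_unif : valuation unif = 1;
  val_complete : forall u : nat -> lf_field,
    (forall n : int, exists N, forall i j : nat, (N <= i)%N -> (N <= j)%N ->
       val_ge valuation n (u i - u j)) ->
    exists x, forall n : int, exists N, forall i : nat, (N <= i)%N ->
       val_ge valuation n (u i - x);
  red1 : reduction 1 = 1;
  redD : forall x y,
    val_ge valuation 0 x -> val_ge valuation 0 y ->
    reduction (x + y) = reduction x + reduction y;
  redM : forall x y,
    val_ge valuation 0 x -> val_ge valuation 0 y ->
    reduction (x * y) = reduction x * reduction y;
  red_surj : forall t, exists2 x, val_ge valuation 0 x & reduction x = t;
  red_ker : forall x, val_ge valuation 0 x ->
    (reduction x = 0 <-> val_ge valuation 1 x)
}.

Arguments unif {l}.
Arguments reduction {l}.
Arguments valuation {l}.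

Definition intring (K : localField) : set K := val_ge valuation 0.

Definition powideal (K : localField) (n : int) : set K :=
  [set unif ^ n * x | x in @intring K].

(* [W] with its canonical topology of finite-dimensional [K]-space, i.e. the
   product topology in the coordinates of a basis (it does not depend on the
   basis, so the one provided by [vbasis] is used). *)
Definition canonical_top (K : localField) (W : vectType K) : Type := W.

Section CanonicalTopology.
Variables (K : localField) (W : vectType K).

Definition canonical_open : set_system (canonical_top W) :=
  [set U : set W | forall u, U u -> exists n : int, forall w : W,
     (forall i, powideal n (coord (vbasis {:W}) i w)) -> U (u + w)].

Lemma powideal_le (m n : int) (x : K) :
  m <= n -> powideal n x -> powideal m x.
Proof.
have unifX k : valuation (unif ^+ k : K) = k%:Z /\ (unif : K) ^+ k != 0.
  split; last by rewrite expf_neq0 // unif_neq0.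
  elim: k => [|k IHk].
    apply: (addIr (valuation (1 : K))).
    by rewrite -valM ?oner_neq0 // mulr1 add0r.
  by rewrite exprS valM ?expf_neq0 ?unif_neq0 // IHk val_unif.
move=> le_mn [y Oy <-].
have [k nE] : exists k : nat, n = m + k%:Z.
  exists `|n - m|%N.
  by rewrite gez0_abs ?subr_ge0 // [RHS]addrC subrK.
exists (unif ^+ k * y); last first.
  by rewrite mulrA nE expfzDr ?unif_neq0 // -exprnP.
rewrite /intring /val_ge in Oy *; have [->|y0] := eqVneq y 0.
  by left; rewrite mulr0.
case: Oy => [y0'|Oy]; first by rewrite y0' eqxx in y0.
by right; case: (unifX k) => vk k0; rewrite valM // vk addr_ge0.
Qed.

Lemma canonical_openT : canonical_open setT.
Proof. by move=> u _; exists 0. Qed.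

Lemma canonical_openI : setI_closed canonical_open.
Proof.
move=> U V oU oV u [/oU[m mU] /oV[n nV]].
exists (Num.max m n) => w wmn; split; [apply: mU | apply: nV] => i.
  by apply: powideal_le (wmn i); rewrite le_max lexx.
by apply: powideal_le (wmn i); rewrite le_max lexx orbT.
Qed.

Lemma canonical_open_bigU (I : Type) (f : I -> set (canonical_top W)) :
  (forall i, canonical_open (f i)) -> canonical_open (\bigcup_i f i).
Proof.
move=> fo u [i _ /fo[n nf]]; exists n => w wn; exists i => //; exact: nf.
Qed.

HB.instance Definition _ := Choice.on (canonical_top W).
HB.instance Definition _ := isOpenTopological.Build (canonical_top W)
  canonical_openT canonical_openI canonical_open_bigU.

End CanonicalTopology.

Section Characters.
Variables (R : realType) (K : localField).
Implicit Types (psi : K -> R[i]) (lam : int).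

Definition unitary_character psi : Prop :=
  [/\ forall x y, psi (x + y) = psi x * psi y,
      forall x, `|psi x| = 1 &
      continuous (psi : canonical_top K^o -> (R[i] : numFieldType))].

Definition conductor psi lam : Prop :=
  (forall x, powideal lam x -> psi x = 1) /\
  ~ (forall x, powideal (lam - 1) x -> psi x = 1).

Definition lift_red (t : residue K) : K :=
  xget 0 [set x | intring x /\ reduction x = t].

Definition psibar psi lam (t : residue K) : R[i] :=
  psi (unif ^ (lam - 1) * lift_red t).

Definition omega psi lam (a : residue K) : R[i] :=
  (sqrtC #|residue K|%:R)^-1 *
    \sum_(t : residue K) psibar psi lam (2^-1 * a * t ^+ 2).

End Characters.

Definition isometry_group (F : fieldType) (V : vectType F) (b : V -> V -> F) :
  set 'End(V) := [set g | forall u v, b (g u) (g v) = b u v].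

Section Lattices.
Variables (K : localField) (lam : int) (W : vectType K) (beta : W -> W -> K).
Implicit Types L M A B : set W.

Definition is_lattice L : Prop :=
  [/\ L 0,
      forall u v, L u -> L v -> L (u + v),
      forall c u, intring c -> L u -> L (c *: u),
      compact (L : set (canonical_top W)) &
      open (L : set (canonical_top W))].

Definition dual_lattice L : set W :=
  [set v | forall b, L b -> powideal lam (beta v b)].

Definition dilation (c : K) L : set W := [set c *: v | v in L].

Definition good_lattice B : Prop :=
  [/\ is_lattice B,
      dilation unif (dual_lattice B) `<=` B &
      B `<=` dual_lattice B].

Definition selfdual_lattice A : Prop := is_lattice A /\ A = dual_lattice A.

Definition stabilizer B : set 'End(W) :=
  isometry_group beta `&` [set g | [set g v | v in B] = B].

(* Depends only on the class of [w] modulo [M]. *)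
Definition coset_rep M (w : W) : W := xget 0 [set u | M (u - w)].

(* Representatives of [L / M]. *)
Definition coset_reps L M : set W := [set coset_rep M w | w in L].

Definition lattice_index L M : nat := #|` fset_set (coset_reps L M)|.

End Lattices.

(* The quotient [L / M] of an [O]-module [L] by a submodule [M] containing
   [unif L], as a space over the residue field: [qproj], irrelevant outside
   [L], is the projection. *)
Record quotientSpace (K : localField) (W : vectType K) (L M : set W) :=
  QuotientSpace {
  qspace :> vectType (residue K);
  qproj : W -> qspace;
  qprojD : forall u v, L u -> L v -> qproj (u + v) = qproj u + qproj v;
  qprojZ : forall c u, intring c -> L u ->
    qproj (c *: u) = reduction c *: qproj u;
  qproj_surj : forall y, exists2 u, L u & qproj u = y;
  qproj_ker : forall u, L u -> (qproj u = 0 <-> M u)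
}.

Section ResidualSpace.
Variables (K : localField) (lam : int) (W : vectType K) (beta : W -> W -> K).
Variables (L M : set W) (Q : quotientSpace L M).

Definition qlift (y : Q) : W := xget 0 [set u | L u /\ qproj Q u = y].

Definition qform (y z : Q) : residue K :=
  reduction (unif ^ (1 - lam) * beta (qlift y) (qlift z)).

Definition qmorph (g : 'End(W)) : 'End(Q) :=
  linfun (fun y : Q => qproj Q (g (qlift y))).

End ResidualSpace.

Section FiniteSymplectic.
Variables (F : finFieldType) (V : vectType F) (b : V -> V -> F) (l : nat).
Implicit Types (x : {vspace V}) (eps phi : l.-tuple V) (theta : 'End(V) -> F).

Definition symplectic_basis eps phi : Prop :=
  [/\ basis_of {:V} (eps ++ phi),
      forall i j, b (tnth eps i) (tnth eps j) = 0,
      forall i j, b (tnth phi i) (tnth phi j) = 0 &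
      forall i j, b (tnth eps i) (tnth phi j) = (i == j)%:R].

Definition parabolic x : set 'End(V) :=
  isometry_group b `&` [set p | (p @: x)%VS = x].

Definition is_tau eps phi (S : {set 'I_l}) (tau : 'End(V)) : Prop :=
  forall i,
    tau (tnth eps i) = (if i \in S then tnth phi i else tnth eps i) /\
    tau (tnth phi i) = (if i \in S then - tnth eps i else tnth phi i).

Definition restr_det eps (p : 'End(V)) : F :=
  \det (\matrix_(i < l, j < l) coord eps j (p (tnth eps i))).

Definition eq_mod_squares (a c : F) : Prop :=
  exists2 d : F, d != 0 & a = d ^+ 2 * c.

(* Classes of [F^* / (F^* )^2] are given by representatives in [F^*]. *)
Definition is_theta x eps phi theta : Prop :=
  [/\ forall g, isometry_group b g -> theta g != 0,
      forall p1 g p2, parabolic x p1 -> isometry_group b g ->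
        parabolic x p2 ->
        eq_mod_squares (theta (p1 \o g \o p2)%VF)
                       (theta p1 * theta g * theta p2),
      forall p, parabolic x p -> eq_mod_squares (theta p) (restr_det eps p) &
      forall S tau, is_tau eps phi S tau -> eq_mod_squares (theta tau) 1].

Definition jdefect x (g : 'End(V)) : nat := (l - \dim (x :&: g @: x))%N.

End FiniteSymplectic.

Section LatticeModel.
Variables (R : realType) (K : localField) (psi : K -> R[i]).
Variables (W : vectType K) (beta : W -> W -> K) (A : set W).
Implicit Types (f h : W -> R[i]) (E F : set (W -> R[i])).

(* [W / A] is discrete: its Haar measure is the counting measure. *)
Definition hnorm2 f : \bar R :=
  (\esum_(w in coset_reps setT A) ((complex.Re `|f w|) ^+ 2)%:E)%E.

Definition rsum (D : set W) (F : W -> R) : R :=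
  fine (\esum_(w in D) (Num.max (F w) 0)%:E)%E -
  fine (\esum_(w in D) (Num.max (- F w) 0)%:E)%E.

Definition hdot f h : R[i] :=
  let F w := f w * (h w)^*%C in
  Complex (rsum (coset_reps setT A) (fun w => complex.Re (F w)))
          (rsum (coset_reps setT A) (fun w => complex.Im (F w))).

Definition hilbert_space : set (W -> R[i]) :=
  [set f | (forall a w, A a -> f (a + w) = psi (2^-1 * beta w a) * f w) /\
           (hnorm2 f < +oo)%E].

Definition linear_subspace E : Prop :=
  E (fun=> 0) /\
  forall c f h, E f -> E h -> E (fun w => c * f w + h w).

Definition hclosed E : Prop := forall f, hilbert_space f ->
  (forall e : R, 0 < e ->
     exists2 h, E h & (hnorm2 (fun w => (f w - h w)%R) < e%:E)%E) ->
  E f.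

Definition closed_subspace E : Prop :=
  [/\ linear_subspace E, E `<=` hilbert_space & hclosed E].

Definition nonzero_space E : Prop := exists2 f, E f & f <> (fun=> 0).

Definition has_dim E (x : rat) : Prop :=
  exists d : nat, x = d%:R /\
  exists b : 'I_d -> W -> R[i],
    (forall i, E (b i)) /\
    forall f, E f ->
      exists! c : 'rV[R[i]]_d, f = (fun w => \sum_(i < d) c 0 i * b i w).

Definition hilbert_sum (I : Type) (E : I -> set (W -> R[i])) : Prop :=
  [/\ forall i, closed_subspace (E i),
      forall i j, i <> j -> forall f h, E i f -> E j h -> hdot f h = 0 &
      forall f, hilbert_space f -> forall e : R, 0 < e ->
        exists (s : seq I) (h : I -> W -> R[i]), (forall i, E i (h i)) /\
          (hnorm2 (fun w => (f w - \sum_(i <- s) h i w)%R) < e%:E)%E].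

Section Representations.
Variables (G : set 'End(W)) (S : 'End(W) -> (W -> R[i]) -> (W -> R[i])).

Definition invariant_under E : Prop := forall g f, G g -> E f -> E (S g f).

Definition irreducible_rep E : Prop :=
  nonzero_space E /\
  forall F, closed_subspace F -> F `<=` E -> invariant_under F ->
    ~ nonzero_space F \/ F = E.

Definition equivalent_reps E F : Prop :=
  exists T : (W -> R[i]) -> (W -> R[i]),
    [/\ set_bij E F T,
        forall c f h, E f -> E h ->
          T (fun w => c * f w + h w) = (fun w => c * T f w + T h w) &
        forall g f, G g -> E f -> T (S g f) = S g (T f)].

Definition multiplicity_free : Prop := forall E F,
  closed_subspace E -> invariant_under E -> irreducible_rep E ->
  closed_subspace F -> invariant_under F -> irreducible_rep F ->
  equivalent_reps E F -> E = F.

End Representations.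

Definition Mop (g : 'End(W)) f : W -> R[i] :=
  let A' := A `&` [set g a | a in A] in
  fun w => (lattice_index A A')%:R^-1 *
    \sum_(a \in coset_reps A A')
       (psi (2^-1 * beta a w) * f ((g^-1)%VF (a + w))).

Variables (lam : int) (B : set W).

Definition weil_op (bstar : quotientSpace (dual_lattice lam beta B) B) (l : nat)
    (x : {vspace bstar}) (theta : 'End(bstar) -> residue K)
    (g : 'End(W)) f : W -> R[i] :=
  let gbar := qmorph bstar g in
  let j := jdefect l x gbar in
  let m := (omega psi lam (theta gbar))^-1 * omega psi lam 1 ^ (1 - j%:Z) in
  fun w => m * sqrtC #|residue K|%:R ^+ j * Mop g f w.

Definition supported_in (D : set W) : set (W -> R[i]) :=
  [set f | hilbert_space f /\ [set w | f w <> 0] `<=` D].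

Definition Esub (n : nat) : set (W -> R[i]) :=
  if n is 0 then supported_in (dual_lattice lam beta B)
  else supported_in (dilation (unif ^- n) (dual_lattice lam beta B `\` B)).

Definition Esub1 (n : nat) : set (W -> R[i]) :=
  supported_in (dilation (unif ^- n.+1) B `\`
                dilation (unif ^- n) (dual_lattice lam beta B)).

(* Even functions for [odd = false], odd functions for [odd = true]. *)
Definition parity_part (odd : bool) E : set (W -> R[i]) :=
  [set f | E f /\ forall w, f (- w) = (-1) ^+ odd * f w].

Inductive piece : Type := Piece of nat & bool | Piece1 of nat & bool.

Definition Epiece (i : piece) : set (W -> R[i]) :=
  match i with
  | Piece n s => parity_part s (Esub n)
  | Piece1 n s => parity_part s (Esub1 n)
  end.

End LatticeModel.

(* Main.v *)
(* The transvections [v |-> v + c b(u, v) u] with [u] in [A] and [c] in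
   [unif^(m - lam) O], for [m >= 1], stabilize [A] and [B], and act diagonally
   on [unif^-m A]: [M(t) f (v) = psi (c b(u, v)^2 / 2) f (v)].  As [A] is
   self-dual, these characters determine [v] modulo [A] up to sign.  With the
   action of [-1], a stable subspace of functions supported in some [unif^-m A]
   is thus spanned by the functions of given parity supported in single orbits
   [+-w + A], and it contains the one attached to [w] as soon as it contains a
   function of that parity not vanishing at [w].  The eigencharacters also
   forbid equivalences between different pieces.

   For irreducibility it remains to go from one orbit to another inside a layer
   [unif^-n (B* \ B)] or [unif^-(n+1) B \ unif^-n B*].  The stabilizer of [B]
   is transitive on the layer; if [w] is not in [B*], the value of [M(g) f] at
   [g w] is a single nonzero term for [f] supported in [+-w + A].  In the layer
   [B*], even functions are reached through the orbit [A], and odd ones with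
   isometries that stabilize [A] as well.

   Of the Weil constants, only their nonvanishing matters.  An irreducible
   closed subspace embeds in each layer it meets, hence has a vector restricting
   to a single orbit there, and by the eigencharacters this vector vanishes
   elsewhere. *)

From HB Require Import structures.
From mathcomp Require Import all_boot all_order all_algebra.
From mathcomp Require Import finmap complex.
From mathcomp Require Import all_classical all_reals all_analysis.
From mathcomp Require Import ring zify.
Require Import Defs.

Set Implicit Arguments.
Unset Strict Implicit.
Unset Printing Implicit Defensive.

Import Order.TTheory GRing.Theory Num.Theory.

Local Open Scope classical_set_scope.
Local Open Scope ring_scope.

(** * Subgroups, congruence up to sign, and finite quotients *)

Section Subgroups.
Variable V : zmodType.
Implicit Types (D L M N : set V) (u v w : V).

Definition subgroup M : Prop := M 0 /\ forall u v, M u -> M v -> M (u - v).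

Lemma subgroup0 M : subgroup M -> M 0. Proof. by case. Qed.

Lemma subgroupB M u v : subgroup M -> M u -> M v -> M (u - v).
Proof. by case=> _; apply. Qed.

Lemma subgroupN M u : subgroup M -> M u -> M (- u).
Proof. by move=> gM Mu; rewrite -sub0r; apply: subgroupB (subgroup0 gM) _. Qed.

Lemma subgroupNE M u : subgroup M -> M (- u) <-> M u.
Proof. by move=> gM; split=> /(subgroupN gM); rewrite ?opprK. Qed.

Lemma subgroupD M u v : subgroup M -> M u -> M v -> M (u + v).
Proof.
by move=> gM Mu Mv; rewrite -[v]opprK; apply: subgroupB => //; exact: subgroupN.
Qed.

Lemma subgroupBC M u v : subgroup M -> M (u - v) -> M (v - u).
Proof. by move=> gM /(subgroupN gM); rewrite opprB. Qed.

Lemma subgroupDr M u v : subgroup M -> M u -> M (u + v) <-> M v.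
Proof.
move=> gM Mu; split=> [Muv|]; last exact: subgroupD.
by rewrite -[v](addKr u) addrC; exact: subgroupB.
Qed.

Lemma subgroup_trans M u v w :
  subgroup M -> M (u - v) -> M (v - w) -> M (u - w).
Proof. by move=> gM uv vw; rewrite -[u](subrK v) -addrA; exact: subgroupD. Qed.

Lemma subgroup_congr M u v : subgroup M -> M (u - v) -> M u <-> M v.
Proof. by move=> gM uv; rewrite -{1}[u](subrK v); exact: subgroupDr. Qed.

Definition sign_eqmod M u v : Prop := M (u - v) \/ M (u + v).

Lemma sign_eqmod_sym M u v : subgroup M -> sign_eqmod M u v -> sign_eqmod M v u.
Proof.
by move=> gM [uv|uv]; [left; exact: subgroupBC|right; rewrite addrC].
Qed.

Lemma sign_eqmod_trans M u v w : subgroup M ->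
  sign_eqmod M u v -> sign_eqmod M v w -> sign_eqmod M u w.
Proof.
move=> gM [uv|uv] [vw|vw].
- by left; exact: subgroup_trans uv vw.
- by right; have := subgroupD gM uv vw; rewrite addrA subrK.
- by right; have := subgroupB gM uv vw; rewrite opprB addrACA subrr addr0.
- by left; have := subgroupB gM uv vw; rewrite opprD addrA addrK.
Qed.

Lemma sign_eqmodP M D u v : (forall x y, M (x - y) -> D y -> D x) ->
  (forall x, D x -> D (- x)) -> sign_eqmod M u v -> D v -> D u.
Proof.
move=> satD DN [uv|uv] Dv; first exact: satD uv Dv.
by apply: satD (DN _ Dv); rewrite opprK.
Qed.

Definition transversal (I : finType) D M (s : I -> V) : Prop :=
  [/\ forall i, D (s i),
      forall i j, M (s i - s j) -> i = j &
      forall w, D w -> exists i, M (w - s i)].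

Definition has_index D M (n : nat) : Prop :=
  exists (I : finType) (s : I -> V), transversal D M s /\ #|I| = n.

Definition half_transversal (I : finType) D M (s : I -> V) : Prop :=
  [/\ forall i, D (s i),
      forall i j, sign_eqmod M (s i) (s j) -> i = j &
      forall w, D w -> exists i, sign_eqmod M w (s i)].

Definition has_half_index D M (n : nat) : Prop :=
  exists (I : finType) (s : I -> V), half_transversal D M s /\ #|I| = n.

Lemma transversal_leq (I J : finType) D M (s : I -> V) (t : J -> V) :
  subgroup M -> transversal D M s -> transversal D M t -> (#|I| <= #|J|)%N.
Proof.
move=> gM [Ds injs _] [_ _ surjt].
have [f fE] : {f : I -> J & forall i, M (s i - t (f i))}.
  by apply: (choice (P := fun i j => M (s i - t j))) => i; apply: surjt.
rewrite -(card_codom (f := f)) ?max_card // => i j ij; apply: injs.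
apply: (subgroup_trans gM (fE i)); rewrite ij; exact: subgroupBC.
Qed.

Lemma has_index_uniq D M m n :
  subgroup M -> has_index D M m -> has_index D M n -> m = n.
Proof.
move=> gM [I [s [sP <-]]] [J [t [tP <-]]]; apply/eqP; rewrite eqn_leq.
by rewrite (transversal_leq gM sP tP) (transversal_leq gM tP sP).
Qed.

Lemma has_index_image (T : finType) (p : V -> T) D M :
  (forall u v, D u -> D v -> p u = p v <-> M (u - v)) ->
  has_index D M #|[pred t | `[< exists2 u, D u & p u = t >]]|.
Proof.
move=> pM; set P := [pred t | _]; rewrite -card_sig.
have [s sP] : {s : {t | P t} -> V & forall t, D (s t) /\ p (s t) = val t}.
  apply: (choice (P := fun (t : {t | P t}) u => D u /\ p u = val t)) => -[t Pt].
  by have /asboolP[u] := Pt; exists u.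
exists {t | P t}, s; split=> //; split=> [t|t t'|w Dw]; first by case: (sP t).
  have [Dt pt] := sP t; have [Dt' pt'] := sP t'.
  by move=> /(pM _ _ Dt Dt'); rewrite pt pt' => /val_inj.
have Pw : P (p w) by apply/asboolP; exists w.
pose t : {t | P t} := exist (fun t => P t) (p w) Pw; have [Dt pt] := sP t.
by exists t; apply/(pM _ _ Dw Dt); rewrite pt.
Qed.

Lemma has_index_quotient (T : finType) (p : V -> T) D M :
  (forall t, exists2 u, D u & p u = t) ->
  (forall u v, D u -> D v -> p u = p v <-> M (u - v)) -> has_index D M #|T|.
Proof.
move=> p_surj /has_index_image; set P := [pred t | _] => MP.
by rewrite -(eq_card (A := P)) // => t; apply/asboolP.
Qed.

Lemma has_index_cover (I : finType) (s : I -> V) D M : subgroup M ->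
  (forall w, D w -> exists i, M (w - s i)) -> exists n, has_index D M n.
Proof.
move=> gM cov; eexists.
pose p w := [set i | `[< M (w - s i) >]]%SET.
apply: (has_index_image (p := p)) => u v Du Dv.
split=> [uv|Muv].
  have [i ui] := cov u Du; apply: (subgroup_trans gM ui);
    apply: subgroupBC => //.
  by move/setP/(_ i): uv; rewrite !inE asboolT // => /esym/asboolP.
apply/setP => i; rewrite !inE; apply/asboolP/asboolP.
  exact: subgroup_trans (subgroupBC gM Muv).
exact: subgroup_trans Muv.
Qed.

Lemma has_index_subset D D' M n : subgroup M -> D' `<=` D -> has_index D M n ->
  exists m, has_index D' M m.
Proof.
move=> gM sD [I [s [[_ _ surjs] _]]].
by apply: (has_index_cover (s := s)) => // w /sD /surjs.
Qed.

Lemma has_index_gt0 D M n w : D w -> has_index D M n -> (0 < n)%N.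
Proof.
by move=> Dw [I [s [[_ _ surjs] <-]]]; have [i _] := surjs w Dw;
  apply/card_gt0P; exists i.
Qed.

Lemma has_index1 M : subgroup M -> has_index M M 1.
Proof.
move=> gM; exists unit, (fun=> 0); split; last exact: card_unit.
split=> [_|[] []//|w Mw]; first exact: subgroup0.
by exists tt; rewrite subr0.
Qed.

Lemma has_index_setD D D' M a b :
  subgroup M -> D' `<=` D -> (forall u v, M (u - v) -> D' v -> D' u) ->
  has_index D M a -> has_index D' M b ->
  (b <= a)%N /\ has_index (D `\` D') M (a - b).
Proof.
move=> gM sD satD' [I [s [[Ds injs surjs] <-]]] D'b.
pose P i := `[< D' (s i) >].
have b_eq : b = #|[pred i | P i]|.
  apply: (has_index_uniq gM D'b); rewrite -card_sig.
  exists {i | P i}, (s \o val); split=> //; split=> [[i Pi]|i j /=|w Dw] /=.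
  - exact/asboolP.
  - by move=> /injs; apply: val_inj.
  - have [i Mi] := surjs w (sD _ Dw).
    have Pi : P i by apply/asboolP; apply: satD' Dw; exact: subgroupBC.
    by exists (exist _ i Pi).
have aE : #|I| = (b + #|[pred i | ~~ P i]|)%N by rewrite b_eq cardC.
split; first by rewrite aE leq_addr.
rewrite aE addKn -card_sig.
exists {i | ~~ P i}, (s \o val); split=> //;
  split=> [[i Pi]|i j /=|w [Dw nDw]] /=.
- by split=> //; apply/asboolPn.
- by move=> /injs; apply: val_inj.
- have [i Mi] := surjs w Dw.
  have Pi : ~~ P i by apply/asboolPn => Di; apply: nDw; apply: satD' Di.
  by exists (exist _ i Pi).
Qed.

Section Tower.
Variables L M N : set V.
Hypotheses (gL : subgroup L) (gM : subgroup M) (gN : subgroup N).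
Hypotheses (sNM : N `<=` M) (sML : M `<=` L).

Lemma has_indexM a b : has_index L M a -> has_index M N b ->
  has_index L N (a * b).
Proof.
move=> [I [s [[Ls injs surjs] <-]]] [J [t [[Mt injt surjt] <-]]].
exists (I * J)%type, (fun ij => s ij.1 + t ij.2); split; last exact: card_prod.
split=> [[i j]|[i j] [i' j'] /= Nij|w Lw] /=.
- by apply: subgroupD => //; apply: sML.
- have E : s i + t j - (s i' + t j') = (t j - t j') + (s i - s i').
    by rewrite opprD addrACA addrC.
  have ii : i = i'.
    have Mtt := subgroupB gM (Mt j) (Mt j').
    apply: injs; apply/(subgroupDr (s i - s i') gM Mtt).
    by rewrite -E; exact: sNM.
  by move: E Nij; rewrite ii subrr addr0 => -> /injt ->.
- have [i Mi] := surjs w Lw; have [j Nj] := surjt _ Mi; exists (i, j) => /=.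
  by rewrite opprD addrA.
Qed.

Lemma has_index_upper b c : has_index M N b -> has_index L N c ->
  exists2 a, has_index L M a & (a * b = c)%N.
Proof.
move=> MNb LNc; have [I [s [[_ _ surjs] _]]] := LNc.
have [|a LMa] := @has_index_cover I s L M gM.
  by move=> w /surjs[i /sNM]; exists i.
by exists a => //; apply: has_index_uniq gN _ LNc; exact: has_indexM.
Qed.

Lemma has_index_lower a c : has_index L M a -> has_index L N c ->
  exists2 b, has_index M N b & (a * b = c)%N.
Proof.
move=> LMa LNc; have [b MNb] := has_index_subset gN sML LNc.
by exists b => //; apply: has_index_uniq gN _ LNc; exact: has_indexM.
Qed.

End Tower.

Lemma fixfree_involution_half (I : finType) (f : I -> I) :
  involutive f -> (forall i, f i != i) ->
  exists2 P : pred I, forall i, P (f i) = ~~ P i & (#|P| * 2)%N = #|I|.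
Proof.
move=> fK f_fix; pose P i := (enum_rank i < enum_rank (f i))%N.
have PN i : P (f i) = ~~ P i.
  rewrite /P fK -leqNgt [RHS]leq_eqVlt.
  case: eqP => // /val_inj/enum_rank_inj/eqP.
  by rewrite (negbTE (f_fix i)).
exists P => //; rewrite muln2 -addnn -[in RHS](cardC P); congr (_ + _)%N.
rewrite -(fintype.card_image (inv_inj fK) P); apply: eq_card => i.
by rewrite -[i in LHS]fK (fintype.mem_image (inv_inj fK)) [LHS]PN.
Qed.

Lemma has_half_index_disjoint D M n :
  subgroup M -> (forall u, M (u + u) -> M u) ->
  (forall u, D u -> D (- u)) -> (forall u, D u -> ~ M u) ->
  has_index D M n -> exists2 m, has_half_index D M m & (m * 2)%N = n.
Proof.
move=> gM M_half DN DM [I [s [[Ds injs surjs] <-]]].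
have [f fN] : {f : I -> I & forall i, M (s i + s (f i))}.
  apply: (choice (P := fun i j => M (s i + s j))) => i.
  have [j /(subgroupN gM)] := surjs _ (DN _ (Ds i)).
  by rewrite opprD !opprK; exists j.
have sN_inj i j k : M (s k + s i) -> M (s k + s j) -> i = j.
  move=> ki kj; apply: injs; have := subgroupB gM ki kj.
  by rewrite opprD addrACA subrr add0r.
have fK : involutive f.
  by move=> i; apply: (sN_inj _ _ (f i)) => //; rewrite addrC.
have f_fix i : f i != i.
  by apply/eqP => fi; apply: (DM _ (Ds i)); apply: M_half; rewrite -{2}fi.
have [P PN cardP] := fixfree_involution_half fK f_fix.
exists #|P| => //; exists {i | P i}, (s \o val); split;
  last by rewrite card_sig.
split=> [[i Pi]|[i Pi] [j Pj] /= ij|w Dw]; first exact: Ds.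
  apply: val_inj => /=; case: ij => [/injs//|ij].
  have ji : j = f i by exact: sN_inj ij (fN i).
  by move: Pj; rewrite ji PN Pi.
have [i Mi] := surjs w Dw.
have [Pi|nPi] := boolP (P i); first by exists (exist _ i Pi); left.
have Pfi : P (f i) by rewrite PN.
exists (exist _ (f i) Pfi); right => /=.
by rewrite -[w](subrK (s i)) -addrA; exact: subgroupD.
Qed.

Lemma has_half_index_adjoin D M n : subgroup M -> M `<=` D ->
  has_half_index (D `\` M) M n -> has_half_index D M n.+1.
Proof.
move=> gM sMD [I [s [[Ds injs surjs] <-]]].
have s_notin0 i : ~ sign_eqmod M 0 (s i).
  have [_ nMi] := Ds i; case; rewrite ?sub0r ?add0r // => /(subgroupNE _ gM)//.
exists (option I), (fun o => if o is Some i then s i else 0).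
split; last by rewrite card_option.
split=> [[i|]|[i|] [j|] //= ij|w Dw].
- by case: (Ds i).
- by apply: sMD; exact: subgroup0.
- by rewrite (injs _ _ ij).
- by case: (s_notin0 i); exact: sign_eqmod_sym.
- by case: (s_notin0 j).
- have [Mw|nMw] := pselect (M w); first by exists None; left; rewrite subr0.
  by have [i wi] := surjs w (conj Dw nMw); exists (Some i).
Qed.

End Subgroups.

(** * The valuation ring and its ideals *)

Section LocalFieldTheory.
Variable K : localField.
Implicit Types (x y c : K) (m n : int) (t : residue K).

Lemma val1 : valuation (1 : K) = 0.
Proof.
by apply: (addIr (valuation (1 : K))); rewrite -valM ?oner_neq0 // mulr1 add0r.
Qed.

Lemma valN1 : valuation (-1 : K) = 0.
Proof.
have : valuation (-1 : K) *+ 2 = 0.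
  by rewrite mulr2n -valM ?oppr_eq0 ?oner_neq0 // mulrNN mulr1 val1.
by move/eqP; rewrite mulrn_eq0 /= => /eqP.
Qed.

Lemma valV x : x != 0 -> valuation x^-1 = - valuation x.
Proof.
move=> x0; apply: (addIr (valuation x)).
by rewrite -valM ?invr_eq0 // mulVf // val1 addNr.
Qed.

Lemma unifz_neq0 n : (unif : K) ^ n != 0.
Proof. by rewrite expfz_neq0 // unif_neq0. Qed.

Lemma unifX_neq0 (k : nat) : (unif : K) ^+ k != 0.
Proof. by rewrite expf_neq0 // unif_neq0. Qed.

Lemma unifXV_neq0 (k : nat) : (unif : K) ^- k != 0.
Proof. by rewrite invr_eq0 unifX_neq0. Qed.

Lemma val_unifz n : valuation ((unif : K) ^ n) = n.
Proof.
have valX (k : nat) : valuation ((unif : K) ^+ k) = k.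
  elim: k => [|k IHk]; first exact: val1.
  by rewrite exprS valM ?unifX_neq0 ?unif_neq0 // IHk val_unif.
case: n => k; first by rewrite -exprnP valX.
by rewrite NegzE -exprnN valV ?unifX_neq0 // valX.
Qed.

Lemma powidealP n x : powideal n x <-> val_ge valuation n x.
Proof.
split=> [[y Oy <-]|nx].
  case: Oy => [->|Oy]; first by left; rewrite mulr0.
  have [->|y0] := eqVneq y 0; first by left; rewrite mulr0.
  by right; rewrite valM ?unifz_neq0 // val_unifz lerDl.
exists (unif ^ (- n) * x); last first.
  by rewrite mulrA -expfzDr ?unif_neq0 // subrr expr0z mul1r.
case: nx => [->|nx]; first by left; rewrite mulr0.
have [->|x0] := eqVneq x 0; first by left; rewrite mulr0.
by right; rewrite valM ?unifz_neq0 // val_unifz addrC subr_ge0.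
Qed.

Lemma intringE x : intring x <-> powideal 0 x.
Proof. by rewrite powidealP. Qed.

Lemma powideal0 n : powideal n (0 : K).
Proof. by apply/powidealP; left. Qed.

Lemma powidealM m n x y :
  powideal m x -> powideal n y -> powideal (m + n) (x * y).
Proof.
move=> [a Oa <-] [b Ob <-]; exists (a * b).
  case: Oa => [->|Oa]; first by left; rewrite mul0r.
  case: Ob => [->|Ob]; first by left; rewrite mulr0.
  have [->|a0] := eqVneq a 0; first by left; rewrite mul0r.
  have [->|b0] := eqVneq b 0; first by left; rewrite mulr0.
  by right; rewrite valM // addr_ge0.
by rewrite expfzDr ?unif_neq0 // mulrACA.
Qed.

Lemma powidealZ n x c : powideal 0 c -> powideal n x -> powideal n (c * x).
Proof. by move=> c0 nx; rewrite -[n]add0r; exact: powidealM. Qed.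

Lemma powidealN1 : powideal 0 (-1 : K).
Proof. by apply/powidealP; right; rewrite valN1. Qed.

Lemma powideal_subgroup n : subgroup (@powideal K n).
Proof.
split=> [|x y nx ny]; first exact: powideal0.
apply/powidealP/valD; apply/powidealP => //.
by rewrite -mulN1r; exact: powidealZ powidealN1 _.
Qed.

Lemma powidealD n x y : powideal n x -> powideal n y -> powideal n (x + y).
Proof. exact: (subgroupD (powideal_subgroup n)). Qed.

Lemma powidealN n x : powideal n x -> powideal n (- x).
Proof. exact: (subgroupN (powideal_subgroup n)). Qed.

Lemma powidealB n x y : powideal n x -> powideal n y -> powideal n (x - y).
Proof. exact: (subgroupB (powideal_subgroup n)). Qed.

Lemma powidealDr n x y : powideal n x -> powideal n (x + y) <-> powideal n y.
Proof. exact: (subgroupDr _ (powideal_subgroup n)). Qed.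

Lemma powideal_nat (k : nat) : powideal 0 (k%:R : K).
Proof.
elim: k => [|k IHk]; first exact: powideal0.
rewrite -addn1 natrD; apply: powidealD => //.
by apply/powidealP; right; rewrite val1.
Qed.

Lemma powideal1 : powideal 0 (1 : K).
Proof. exact: (powideal_nat 1). Qed.

Lemma powideal_unifz n : powideal n ((unif : K) ^ n).
Proof. by apply/powidealP; right; rewrite val_unifz. Qed.

Lemma powideal_unifX (k : nat) : powideal 0 ((unif : K) ^+ k).
Proof. by rewrite exprnP; apply: powideal_le (powideal_unifz k). Qed.

Lemma powideal_exists x : exists n, powideal n x.
Proof. by exists (valuation x); apply/powidealP; right. Qed.

Lemma powideal_unif_mul m n x :
  powideal n ((unif : K) ^ m * x) <-> powideal (n - m) x.
Proof.
split=> nx.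
  have := powidealM (powideal_unifz (- m)) nx.
  by rewrite mulrA -expfzDr ?unif_neq0 // addNr expr0z mul1r addrC.
by have := powidealM (powideal_unifz m) nx; rewrite addrC subrK.
Qed.

Lemma notin_powideal n x : ~ powideal n x -> x != 0 /\ valuation x < n.
Proof.
move=> nx; split; first by apply/eqP => x0; apply: nx; rewrite x0;
  exact: powideal0.
by rewrite ltNge; apply/negP => le_n; apply: nx; apply/powidealP; right.
Qed.

Lemma notin_powideal_neq0 n x : ~ powideal n x -> x != 0.
Proof. by case/notin_powideal. Qed.

Lemma powidealV n x : ~ powideal (n + 1) x -> powideal (- n) x^-1.
Proof.
move=> /notin_powideal[x0 lt_x]; apply/powidealP; right.
by rewrite valV // lerN2 -ltzD1.
Qed.

Lemma powideal_div m n x y :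
  powideal (m + n) y -> ~ powideal (n + 1) x -> powideal m (y / x).
Proof.
move=> my /powidealV nx; have := powidealM my nx.
by rewrite addrK.
Qed.

Lemma red0 : reduction (0 : K) = 0.
Proof.
apply: (addIr (reduction 0)); rewrite add0r -redD ?addr0 //;
  exact/powidealP/powideal0.
Qed.

Lemma redN x : powideal 0 x -> reduction (- x) = - reduction x.
Proof.
move=> x0; apply: (addIr (reduction x)); rewrite addNr -redD ?addNr ?red0 //.
  exact/powidealP/powidealN.
exact/powidealP.
Qed.

Lemma redB x y : powideal 0 x -> powideal 0 y ->
  reduction (x - y) = reduction x - reduction y.
Proof.
move=> x0 y0; rewrite redD ?redN //; apply/powidealP => //; exact: powidealN.
Qed.

Lemma red_eq x y : powideal 0 x -> powideal 0 y ->
  reduction x = reduction y <-> powideal 1 (x - y).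
Proof.
move=> x0 y0; have xy0 := powidealB x0 y0.
rewrite powidealP -red_ker; last exact/powidealP.
rewrite redB //; split=> [->|]; first exact: subrr.
by move/eqP; rewrite subr_eq0 => /eqP.
Qed.

Lemma red_nat (k : nat) : reduction (k%:R : K) = k%:R.
Proof.
elim: k => [|k IHk]; first exact: red0.
rewrite -addn1 !natrD redD ?IHk ?red1 //; apply/powidealP;
  [exact: powideal_nat | exact: powideal1].
Qed.

Lemma lift_redP t :
  powideal 0 (lift_red t : K) /\ reduction (lift_red t : K) = t.
Proof.
rewrite /lift_red; case: xgetP => [x _ [/intringE]//|no_lift].
by have [x Ox xt] := red_surj t; case: (no_lift x).
Qed.

Lemma card_residue_gt1 : (1 < #|residue K|)%N.
Proof. exact: card_finNzRing_gt1. Qed.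

Section ResidueCharacteristicNot2.
Hypothesis charF : 2%N \notin [pchar (residue K)].

Lemma two_residue_neq0 : 2 != 0 :> residue K.
Proof. by move: charF; rewrite inE /= . Qed.

Lemma notin_powideal2 : ~ powideal 1 (2 : K).
Proof.
move=> /powidealP two1; have /red_ker[_ /(_ two1)] : val_ge valuation 0 (2 : K).
  exact/powidealP/powideal_nat.
by rewrite red_nat => /eqP; rewrite (negbTE two_residue_neq0).
Qed.

Lemma two_neq0 : 2 != 0 :> K.
Proof. exact: notin_powideal_neq0 notin_powideal2. Qed.

Lemma powideal2V : powideal 0 (2^-1 : K).
Proof. by have := @powidealV 0 2 notin_powideal2; rewrite oppr0. Qed.

Lemma powideal_half n x : powideal n x -> powideal n (2^-1 * x).
Proof. exact: powidealZ powideal2V. Qed.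

Lemma powideal_double n x : powideal n (2 * x) -> powideal n x.
Proof. by move/powideal_half; rewrite mulKf // two_neq0. Qed.

End ResidueCharacteristicNot2.

Section Character.
Variables (R : realType) (psi : K -> R[i]) (lam : int).
Hypothesis psi_char : unitary_character psi.
Hypothesis psi_cond : conductor psi lam.

Lemma psiD x y : psi (x + y) = psi x * psi y.
Proof. by case: psi_char. Qed.

Lemma psi_norm x : `|psi x| = 1.
Proof. by case: psi_char. Qed.

Lemma psi_neq0 x : psi x != 0.
Proof. by rewrite -normr_eq0 psi_norm oner_neq0. Qed.

Lemma psi_powideal x : powideal lam x -> psi x = 1.
Proof. by case: psi_cond => + _; apply. Qed.

Lemma psi0 : psi 0 = 1.
Proof. exact/psi_powideal/powideal0. Qed.

Lemma psiN x : psi (- x) = (psi x)^-1.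
Proof.
by apply: (mulIf (psi_neq0 x)); rewrite -psiD addNr psi0 mulVf ?psi_neq0.
Qed.

Lemma psiB x y : psi (x - y) = psi x / psi y.
Proof. by rewrite psiD psiN. Qed.

Lemma psi_eqmod x y : powideal lam (x - y) -> psi x = psi y.
Proof. by move=> xy; rewrite -[x](subrK y) psiD psi_powideal // mul1r. Qed.

Lemma psi_orthogonal m x :
  (forall c, powideal m c -> psi (c * x) = 1) -> powideal (lam - m) x.
Proof.
move=> psi1x; apply: contrapT => nx; case: psi_cond => _; apply => y ly.
rewrite -[y](divfK (notin_powideal_neq0 nx)); apply: psi1x.
apply: (@powideal_div m (lam - m - 1)); last by rewrite subrK.
by rewrite addrA addrCA subrr addr0.
Qed.

Lemma psibarE t x : powideal 0 x -> reduction x = t ->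
  psibar psi lam t = psi (unif ^ (lam - 1) * x).
Proof.
have [Ot tE] := lift_redP t => Ox xt; apply: psi_eqmod.
rewrite -mulrBr; apply/powideal_unif_mul.
by rewrite opprB addrC subrK; apply/red_eq => //; rewrite tE.
Qed.

Lemma psibarD t u :
  psibar psi lam (t + u) = psibar psi lam t * psibar psi lam u.
Proof.
have [Ot tE] := lift_redP t; have [Ou uE] := lift_redP u.
rewrite (psibarE (x := lift_red t + lift_red u)) ?mulrDr ?psiD //.
  exact: powidealD.
by rewrite redD ?tE ?uE //; apply/powidealP.
Qed.

Lemma psibar0 : psibar psi lam 0 = 1.
Proof.
rewrite (psibarE (x := 0)) ?mulr0 ?psi0 ?red0 //; exact: powideal0.
Qed.

Lemma psibar_nontrivial : exists t, psibar psi lam t != 1.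
Proof.
apply: contrapT => psibar1; case: psi_cond => _; apply => x [y /intringE Oy <-].
rewrite -(psibarE Oy erefl); apply/eqP; apply: contrapT => /negP ny.
by apply: psibar1; exists (reduction y).
Qed.

Lemma sum_psibar a : a != 0 -> \sum_t psibar psi lam (a * t) = 0.
Proof.
move=> a0; have [u u1] := psibar_nontrivial.
have shift : \sum_t psibar psi lam (a * t) =
    psibar psi lam u * \sum_t psibar psi lam (a * t).
  rewrite mulr_sumr (reindex_inj (addIr (u / a))) /=; apply: eq_bigr => t _.
  by rewrite mulrDr mulrCA divff // mulr1 addrC psibarD.
apply/eqP; move/eqP: shift; rewrite -subr_eq0 -{1}[\sum_t _]mul1r
  -mulrBl mulf_eq0.
by rewrite subr_eq0 eq_sym (negbTE u1).
Qed.

(* Substitute [t = s + d] and sum over [s] first. *)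
Lemma gauss_sum_norm (charF : 2%N \notin [pchar (residue K)]) a : a != 0 ->
  (\sum_t psibar psi lam (2^-1 * a * t ^+ 2)) *
    (\sum_s psibar psi lam (- (2^-1 * a * s ^+ 2))) = #|residue K|%:R.
Proof.
move=> a0; have two0 := two_residue_neq0 charF.
pose h t := 2^-1 * a * t ^+ 2; rewrite mulr_suml.
transitivity (\sum_d \sum_s psibar psi lam (h d + a * d * s)).
  rewrite exchange_big /=; under eq_bigr do rewrite mulr_sumr.
  rewrite exchange_big /=; apply: eq_bigr => s _.
  rewrite (reindex_inj (addIr s)) /=; apply: eq_bigr => d _.
  by rewrite -psibarD; congr (psibar _ _ _); rewrite /h; field.
rewrite (bigD1 0) //= [X in _ + X]big1 ?addr0 => [|d d0].
  rewrite (eq_bigr (fun=> 1)) => [|s _]; first by rewrite sumr_const.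
  by rewrite /h expr0n mulr0 mulr0 mul0r addr0 psibar0.
under eq_bigr do rewrite psibarD.
by rewrite -mulr_sumr sum_psibar ?mulr0 // mulf_neq0.
Qed.

Lemma omega_neq0 (charF : 2%N \notin [pchar (residue K)]) a :
  a != 0 -> omega psi lam a != 0.
Proof.
move=> a0; have q0 : (#|residue K|%:R : R[i]) != 0.
  by rewrite pnatr_eq0 -lt0n; exact/ltnW/card_residue_gt1.
rewrite /omega mulf_neq0 ?invr_eq0 ?sqrtC_eq0 //.
by apply/eqP => G0; move: q0; rewrite -(gauss_sum_norm charF a0) G0 mul0r eqxx.
Qed.

End Character.

End LocalFieldTheory.

(** * Lattices *)

Section LatticeTheory.
Variables (K : localField) (W : vectType K).
Implicit Types (L M N : set W) (c : K) (u v w : W) (k : nat).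

HB.instance Definition _ := isPointed.Build (canonical_top W) (0 : W).

Definition omodule L : Prop :=
  [/\ L 0, forall u v, L u -> L v -> L (u + v) &
      forall c u, powideal 0 c -> L u -> L (c *: u)].

Lemma omoduleZ L c u : omodule L -> powideal 0 c -> L u -> L (c *: u).
Proof. by case=> _ _; apply. Qed.

Lemma omodule_subgroup L : omodule L -> subgroup L.
Proof.
move=> [L0 LD LZ]; split=> // u v Lu Lv; apply: LD => //.
by rewrite -scaleN1r; exact: LZ (powidealN1 K) _.
Qed.

Lemma lattice_omodule L : is_lattice L -> omodule L.
Proof. by case=> L0 LD LZ _ _; split=> // c u /intringE; exact: LZ. Qed.

Lemma dilationE c L w : c != 0 -> dilation c L w <-> L (c^-1 *: w).
Proof.
move=> c0; split=> [[v Lv <-]|Lw]; first by rewrite scalerA mulVf // scale1r.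
by exists (c^-1 *: w) => //; rewrite scalerA divff // scale1r.
Qed.

Lemma dilation_omodule c L : c != 0 -> omodule L -> omodule (dilation c L).
Proof.
move=> c0 [L0 LD LZ]; split=> [|u v|a u a0].
- by apply/dilationE; rewrite ?scaler0.
- by rewrite !dilationE // scalerDr; exact: LD.
- by rewrite !dilationE // scalerA mulrC -scalerA; exact: LZ.
Qed.

Lemma dilation_sub c L M : L `<=` M -> dilation c L `<=` dilation c M.
Proof. by move=> sLM _ [v /sLM Mv <-]; exists v. Qed.

Lemma dilation_setD c L M : c != 0 ->
  dilation c (L `\` M) = dilation c L `\` dilation c M.
Proof.
by move=> c0; apply/seteqP; split=> w; rewrite /setD /= !dilationE.
Qed.

Lemma dilationM c c' L : dilation c (dilation c' L) = dilation (c * c') L.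
Proof.
apply/seteqP; split=> [_ [_ [v Lv <-] <-]|_ [v Lv <-]].
  by exists v => //; rewrite scalerA.
by exists (c' *: v); [exists v|rewrite scalerA].
Qed.

Lemma dilation1 L : dilation 1 L = L.
Proof.
apply/seteqP; split=> [_ [v Lv <-]|v Lv]; first by rewrite scale1r.
by exists v => //; rewrite scale1r.
Qed.

Lemma dilation_unif_sub L : omodule L -> dilation unif L `<=` L.
Proof.
move=> omodL _ [v Lv <-]; apply: (omoduleZ omodL) Lv.
exact: (powideal_unifX K 1).
Qed.

Lemma has_index_dilation c L M n :
  c != 0 -> has_index L M n -> has_index (dilation c L) (dilation c M) n.
Proof.
move=> c0 [I [s [[Ls injs surjs] <-]]]; exists I, (fun i => c *: s i);
  split=> //.
split=> [i|i j|w]; first by exists (s i).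
  rewrite dilationE // -scalerBr scalerA mulVf // scale1r; exact: injs.
rewrite dilationE // => /surjs[i Mi]; exists i; apply/dilationE => //.
by rewrite scalerBr scalerA mulVf // scale1r.
Qed.

Definition expansion k L : set W := dilation (unif ^- k) L.

Lemma expansionE k L w : expansion k L w <-> L (unif ^+ k *: w).
Proof. by rewrite /expansion dilationE ?unifXV_neq0 // invrK. Qed.

Lemma expansion0 L : expansion 0 L = L.
Proof. by rewrite /expansion expr0 invr1 dilation1. Qed.

Lemma expansionS k L : expansion k.+1 (dilation unif L) = expansion k L.
Proof.
by rewrite /expansion dilationM exprS invfM mulrAC mulVf ?unif_neq0 // mul1r.
Qed.

Lemma expansion_omodule k L : omodule L -> omodule (expansion k L).
Proof. exact/dilation_omodule/unifXV_neq0. Qed.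

Lemma expansion_sub k L M : L `<=` M -> expansion k L `<=` expansion k M.
Proof. exact: dilation_sub. Qed.

Lemma expansion_leq j k L : omodule L -> (j <= k)%N ->
  expansion j L `<=` expansion k L.
Proof.
move=> omodL /subnK <- w /expansionE Lw; apply/expansionE.
by rewrite exprD -scalerA; apply: (omoduleZ omodL) Lw; exact: powideal_unifX.
Qed.

Lemma sub_expansion k L : omodule L -> L `<=` expansion k L.
Proof. by move=> omodL; rewrite -{1}[L]expansion0; exact: expansion_leq. Qed.

Lemma has_index_expansion k L M n :
  has_index L M n -> has_index (expansion k L) (expansion k M) n.
Proof. exact/has_index_dilation/unifXV_neq0. Qed.

Definition std_lattice : set W :=
  [set w | forall i, powideal 0 (coord (vbasis {:W}) i w)].

Lemma std_omodule : omodule std_lattice.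
Proof.
split=> [i|u v Lu Lv i|c u c0 Lu i]; first by rewrite linear0; exact: powideal0.
  by rewrite linearD; apply: powidealD; [exact: Lu|exact: Lv].
by rewrite linearZ /=; apply: powidealZ => //; exact: Lu.
Qed.

Lemma dilation_stdE (n : int) w : dilation (unif ^ n) std_lattice w <->
  forall i, powideal n (coord (vbasis {:W}) i w).
Proof.
rewrite dilationE ?unifz_neq0 // invr_expz.
have coordE i : powideal 0 (coord (vbasis {:W}) i (unif ^ (- n) *: w)) <->
    powideal n (coord (vbasis {:W}) i w).
  by rewrite linearZ /= powideal_unif_mul opprK add0r.
by split=> w_int i; apply/coordE; apply: w_int.
Qed.

Lemma has_index_std :
  has_index std_lattice (dilation unif std_lattice) (#|residue K| ^ \dim {:W}).
Proof.
have free_vb : free (vbasis {:W}) by exact: basis_free (vbasisP _).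
rewrite -[X in (_ ^ X)%N]card_ord -card_ffun.
pose p w := [ffun i => reduction (coord (vbasis {:W}) i w)].
apply: (has_index_quotient (p := p)) => [t|u v Lu Lv].
  exists (\sum_i lift_red (t i) *: (vbasis {:W})`_i); last apply/ffunP.
    by move=> i; rewrite coord_sum_free //; case: (lift_redP (t i)).
  by move=> i; rewrite ffunE coord_sum_free //; case: (lift_redP (t i)).
rewrite -[unif]expr1z dilation_stdE; split=> [/ffunP puv i|uv].
  by rewrite linearB; apply/red_eq; [exact: Lu|exact: Lv|];
    have := puv i; rewrite !ffunE.
apply/ffunP => i; rewrite !ffunE; apply/red_eq; [exact: Lu|exact: Lv|].
by rewrite -linearB; exact: uv.
Qed.

Lemma canonical_openE (U : set W) :
  open (U : set (canonical_top W)) = canonical_open U.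
Proof. by []. Qed.

Lemma open_omoduleP M : omodule M ->
  open (M : set (canonical_top W)) <->
  exists n : int, dilation (unif ^ n) std_lattice `<=` M.
Proof.
rewrite canonical_openE => -[M0 MD _]; split=> [oM|[n nM] u Mu].
  have [n nM] := oM 0 M0; exists n => w /dilation_stdE wn.
  by rewrite -[w]add0r; exact: nM.
by exists n => w wn; apply: MD => //; apply: nM; apply/dilation_stdE.
Qed.

Lemma lattice_open L : is_lattice L -> open (L : set (canonical_top W)).
Proof. by case. Qed.

Lemma lattice_has_index L M :
  is_lattice L -> omodule M -> open (M : set (canonical_top W)) ->
  exists n, has_index L M n.
Proof.
move=> [_ _ _ + _] omodM openM; rewrite compact_cover => coverL.
have gM := omodule_subgroup omodM.
have [|w Lw|D _ coverD] := coverL W L (fun u => [set w | M (w - u)]).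
- move=> u Lu; rewrite canonical_openE => w Mw.
  have /(open_omoduleP omodM)[n nM] := openM.
  exists n => v vn /=; rewrite addrAC; apply: (subgroupD gM) => //.
  by apply: nM; apply/dilation_stdE.
- by exists w => //=; rewrite subrr; exact: subgroup0.
apply: (@has_index_cover _ D (fun i => val i)) => //.
by move=> w /coverD[u /= Du Mu]; exists [` Du]%fset.
Qed.

Lemma has_index_lattice_unif L : is_lattice L ->
  has_index L (dilation unif L) (#|residue K| ^ \dim {:W}).
Proof.
move=> latL; have omodL := lattice_omodule latL; have u0 := unif_neq0 K.
have /(open_omoduleP omodL)[n sNL] := lattice_open latL.
set N := dilation (unif ^ n) std_lattice in sNL.
have omodN : omodule N by exact: dilation_omodule (unifz_neq0 _ _) std_omodule.
have openN : open (N : set (canonical_top W)) by apply/open_omoduleP => //;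
  exists n.
have [a LNa] := lattice_has_index latL omodN openN.
have NuN : has_index N (dilation unif N) (#|residue K| ^ \dim {:W}).
  rewrite /N dilationM mulrC -dilationM.
  by apply: has_index_dilation (unifz_neq0 _ _) has_index_std.
have gL := omodule_subgroup omodL; have gN := omodule_subgroup omodN.
have guL := omodule_subgroup (dilation_omodule u0 omodL).
have guN := omodule_subgroup (dilation_omodule u0 omodN).
have LuN := has_indexM gL gN (dilation_unif_sub omodN) sNL LNa NuN.
have [b LuL] := has_index_upper gL guL guN (dilation_sub sNL)
  (dilation_unif_sub omodL) (has_index_dilation u0 LNa) LuN.
move/eqP; rewrite mulnC eqn_pmul2l ?(has_index_gt0 (subgroup0 gL) LNa) //.
by move/eqP => <-.
Qed.

Lemma has_index_expansion_lattice L k : is_lattice L ->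
  has_index (expansion k L) L (#|residue K| ^ (\dim {:W} * k)).
Proof.
move=> latL; have omodL := lattice_omodule latL.
have gE j : subgroup (expansion j L).
  exact/omodule_subgroup/expansion_omodule.
have gL := omodule_subgroup omodL.
elim: k => [|k IHk]; first by rewrite muln0 expn0 expansion0; exact: has_index1.
rewrite mulnS expnD; apply: (has_indexM (M := expansion k L)) => //.
- exact: sub_expansion.
- exact: expansion_leq.
- rewrite -[expansion k L]expansionS.
  exact/has_index_expansion/has_index_lattice_unif.
Qed.

Lemma coord_common_powideal w :
  exists n : int, forall i, powideal n (coord (vbasis {:W}) i w).
Proof.
suff [n nP] : exists n : int, forall i, i \in enum 'I_(\dim {:W}) ->
    powideal n (coord (vbasis {:W}) i w).
  by exists n => i; apply: nP; rewrite mem_enum.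
elim: (enum _) => [|i s [m mP]]; first by exists 0.
have [k kP] := powideal_exists (coord (vbasis {:W}) i w).
exists (Num.min m k) => j; rewrite inE => /orP[/eqP->|/mP jm].
  by apply: powideal_le kP; rewrite ge_min lexx orbT.
by apply: powideal_le jm; rewrite ge_min lexx.
Qed.

Lemma lattice_absorbing L w : is_lattice L -> exists k, expansion k L w.
Proof.
move=> latL.
have /(open_omoduleP (lattice_omodule latL))[n nL] := lattice_open latL.
have [m mP] := coord_common_powideal w.
exists `|n - m|%N; apply/expansionE/nL/dilation_stdE => i; rewrite linearZ /=.
apply/(powideal_unif_mul `|n - m|%N); apply: powideal_le (mP i); lia.
Qed.

End LatticeTheory.

Section CosetRepresentatives.
Variables (K : localField) (W : vectType K).
Implicit Types (L M : set W) (u v w : W).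

Lemma coset_repP M w : subgroup M -> M (coset_rep M w - w).
Proof.
move=> gM; rewrite /coset_rep; case: xgetP => [u _ //|no_rep].
by case: (no_rep w); rewrite /= subrr; exact: subgroup0.
Qed.

Lemma coset_rep_eq M u v : subgroup M -> M (u - v) ->
  coset_rep M u = coset_rep M v.
Proof.
move=> gM uv; rewrite /coset_rep; congr (xget _ _); apply/seteqP;
  split=> w /= wu.
  exact: subgroup_trans wu uv.
exact: subgroup_trans wu (subgroupBC gM uv).
Qed.

Lemma coset_reps_id L M w : subgroup M -> coset_reps L M w -> coset_rep M w = w.
Proof. by move=> gM [v _ <-]; apply: coset_rep_eq => //; exact: coset_repP. Qed.

Lemma coset_reps_inj L M u v : subgroup M ->
  coset_reps L M u -> coset_reps L M v -> M (u - v) -> u = v.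
Proof.
move=> gM Lu Lv uv.
by rewrite -(coset_reps_id gM Lu) -(coset_reps_id gM Lv); exact: coset_rep_eq.
Qed.

Lemma coset_reps_finite L D M n : subgroup M -> has_index D M n ->
  finite_set (coset_reps L M `&` D).
Proof.
move=> gM [I [s [[_ _ surjs] _]]].
apply: (sub_finite_set (B := [set coset_rep M (s i) | i in [set: I]])).
  move=> w [Lw /surjs[i Mi]]; exists i => //.
  by rewrite -[RHS](coset_reps_id gM Lw); exact/esym/coset_rep_eq.
exact/finite_image/finite_finset.
Qed.

Lemma coset_reps_sub L M : subgroup L -> subgroup M -> M `<=` L ->
  coset_reps L M `<=` L.
Proof.
move=> gL gM sML _ [w Lw <-].
by apply/(subgroup_congr gL (sML _ (coset_repP w gM))).
Qed.

Lemma coset_reps_bij L M (e e' : W -> W) : subgroup L -> subgroup M ->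
  M `<=` L ->
  (forall a, L a -> L (e a)) -> (forall a, L a -> L (e' a)) -> cancel e' e ->
  (forall a b, M (e a - e b) <-> M (a - b)) ->
  set_bij (coset_reps L M) (coset_reps L M) (fun a => coset_rep M (e a)).
Proof.
move=> gL gM sML eL e'L eK eM; have repsL := coset_reps_sub gL gM sML.
split=> [a /repsL La|a b|a csa]; first by exists (e a) => //; exact: eL.
  rewrite !inE => csa csb ab; apply: (coset_reps_inj gM csa csb); apply/eM.
  apply: (subgroup_trans gM (subgroupBC gM (coset_repP (e a) gM))).
  by rewrite ab; exact: coset_repP.
exists (coset_rep M (e' a)); first by exists (e' a) => //; exact/e'L/repsL.
rewrite -[RHS](coset_reps_id gM csa); apply: coset_rep_eq => //.
by rewrite -[X in _ - X]eK; apply/eM; exact: coset_repP.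
Qed.

Lemma sum_coset_reps_reindex (R : nmodType) L M (e e' : W -> W) (F : W -> R) :
  subgroup L -> subgroup M -> M `<=` L ->
  (forall a, L a -> L (e a)) -> (forall a, L a -> L (e' a)) -> cancel e' e ->
  (forall a b, M (e a - e b) <-> M (a - b)) ->
  (forall a b, L a -> L b -> M (a - b) -> F a = F b) ->
  \sum_(a \in coset_reps L M) F a = \sum_(a \in coset_reps L M) F (e a).
Proof.
move=> gL gM sML eL e'L eK eM FM; have repsL := coset_reps_sub gL gM sML.
rewrite (reindex_fsbig _ _ _ _ (coset_reps_bij gL gM sML eL e'L eK eM)).
apply: eq_fsbigr => a; rewrite inE => /repsL La; have Lea := eL a La.
apply: FM => //; last exact: coset_repP.
by apply: repsL; exists (e a).
Qed.

End CosetRepresentatives.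

(** * Symplectic forms and their isometries *)

Lemma linfunE (F : fieldType) (U V : vectType F) (f : U -> V) :
  linear f -> linfun f =1 f.
Proof.
move=> f_lin u.
pose fL : {linear U -> V} :=
  HB.pack_for {linear U -> V} f (GRing.isLinear.Build F U V _ f f_lin).
exact: (lfunE fL).
Qed.

Record symplectic_form (F : fieldType) (V : vectType F) (b : V -> V -> F) :
    Prop := SymplecticForm {
  formDl : forall u v w, b (u + v) w = b u w + b v w;
  formZl : forall c u v, b (c *: u) v = c * b u v;
  formC : forall u v, b u v = - b v u;
  form_self : forall u, b u u = 0;
  form_nondeg : forall u, (forall v, b u v = 0) -> u = 0
}.

Lemma skew_symplectic_form (F : fieldType) (V : vectType F) (b : V -> V -> F) :
  2 != 0 :> F -> (forall u v w, b (u + v) w = b u w + b v w) ->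
  (forall c u v, b (c *: u) v = c * b u v) -> (forall u v, b u v = - b v u) ->
  (forall u, (forall v, b u v = 0) -> u = 0) -> symplectic_form b.
Proof.
move=> two0 bDl bZl bC nondeg; split=> // u.
apply/eqP; rewrite -(mulrI_eq0 _ (mulfI two0)) mulr_natl mulr2n.
by rewrite {1}bC addNr.
Qed.

Section SymplecticFormTheory.
Variables (F : fieldType) (V : vectType F) (b : V -> V -> F).
Hypothesis bP : symplectic_form b.
Implicit Types (u v w a : V) (c : F) (g : 'End(V)).

Lemma formDr u v w : b u (v + w) = b u v + b u w.
Proof. by rewrite (formC bP) (formDl bP) opprD -!(formC bP). Qed.

Lemma formZr c u v : b u (c *: v) = c * b u v.
Proof. by rewrite (formC bP) (formZl bP) -mulrN -(formC bP). Qed.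

Lemma formNl u v : b (- u) v = - b u v.
Proof. by rewrite -scaleN1r (formZl bP) mulN1r. Qed.

Lemma formNr u v : b u (- v) = - b u v.
Proof. by rewrite -scaleN1r formZr mulN1r. Qed.

Lemma form0l u : b 0 u = 0.
Proof. by rewrite -(scale0r 0) (formZl bP) mul0r. Qed.

Lemma form0r u : b u 0 = 0.
Proof. by rewrite (formC bP) form0l oppr0. Qed.

Lemma isometry_lker g : isometry_group b g -> lker g == 0%VS.
Proof.
move=> gP; apply/eqP/vspaceP => u; rewrite memv_ker memv0.
apply/eqP/eqP => [gu|->]; last by rewrite linear0.
by apply: (form_nondeg bP) => v; rewrite -gP gu form0l.
Qed.

Lemma isometryK g : isometry_group b g -> cancel g (g^-1)%VF.
Proof. by move/isometry_lker => g0; exact: lker0_lfunK. Qed.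

Lemma isometryVK g : isometry_group b g -> cancel (g^-1)%VF g.
Proof. by move/isometry_lker => g0; exact: lker0_lfunVK. Qed.

Lemma isometryV g : isometry_group b g -> isometry_group b (g^-1)%VF.
Proof. by move=> gP u v; rewrite -gP !(isometryVK gP). Qed.

Lemma opp_isometry : isometry_group b (- \1)%VF.
Proof. by move=> u v; rewrite !lfunE /= !lfunE /= formNl formNr opprK. Qed.

Definition transvection c u : 'End(V) := linfun (fun v => v + (c * b u v) *: u).

Lemma transvectionE c u v : transvection c u v = v + (c * b u v) *: u.
Proof.
rewrite /transvection linfunE // => a x y.
rewrite formDr formZr scalerDr scalerA addrACA -scalerDl.
by congr (_ + _ *: _); rewrite mulrDr mulrCA.
Qed.

Lemma transvection_isometry c u : isometry_group b (transvection c u).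
Proof.
move=> v w; rewrite !transvectionE !(formDl bP, formDr, formZl bP, formZr).
by rewrite (form_self bP) (formC bP v u); ring.
Qed.

Lemma transvectionV c u v :
  ((transvection c u)^-1)%VF v = v - (c * b u v) *: u.
Proof.
have tP := transvection_isometry c u; apply: (can_inj (isometryK tP)).
rewrite (isometryVK tP) transvectionE formDr formNr formZr (form_self bP).
by rewrite mulr0 subr0 subrK.
Qed.

(* The isometry sending [w] to [w'] and inducing the identity on [a^\perp / a].
   Only [b w a] and [b w' a] are inverted: it preserves the lattices on which
   these two are large enough. *)
Definition transport w w' a : 'End(V) :=
  linfun (fun v => v + (b v a / b w a) *: (w' - w) +
    ((b v (w' - w) - b v a / b w a * b w w') / b w' a) *: a).

Lemma transportE w w' a v : transport w w' a v =
  v + (b v a / b w a) *: (w' - w) +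
  ((b v (w' - w) - b v a / b w a * b w w') / b w' a) *: a.
Proof.
rewrite /transport linfunE // => d x y.
move: (w' - w) => u; rewrite !(formDl bP _ _ a, formDl bP _ _ u, formZl bP).
set wa := (b w a)^-1; set wa' := (b w' a)^-1.
rewrite !scalerDr !scalerA.
have -> : (d * b x a + b y a) * wa = d * (b x a * wa) + b y a * wa by ring.
have -> : (d * b x u + b y u - (d * (b x a * wa) + b y a * wa) * b w w') * wa' =
  d * ((b x u - b x a * wa * b w w') * wa') +
  (b y u - b y a * wa * b w w') * wa' by ring.
by rewrite !scalerDl (addrACA (d *: x) y) [LHS]addrACA.
Qed.

Lemma transport_isometry w w' a :
  b w a != 0 -> b w' a != 0 -> isometry_group b (transport w w' a).
Proof.
move=> wa wa' v1 v2; rewrite !transportE.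
rewrite !(formDl bP, formDr, formZl bP, formZr, formNl, formNr, form_self bP).
rewrite (formC bP w' w) (formC bP a w) (formC bP a w') (formC bP w v2).
rewrite (formC bP w' v2) (formC bP a v2).
by field; rewrite wa wa'.
Qed.

Lemma transport_id w w' a : b w a != 0 -> transport w w' a w = w'.
Proof.
move=> wa; rewrite transportE divff // scale1r mul1r formDr formNr.
by rewrite (form_self bP) subr0 subrr mul0r scale0r addr0 addrC subrK.
Qed.

End SymplecticFormTheory.

Section DualLattices.
Variables (K : localField) (W : vectType K) (lam : int) (beta : W -> W -> K).
Hypothesis bP : symplectic_form beta.
Local Notation dual := (dual_lattice lam beta).
Implicit Types (L : set W) (u v w a : W) (c : K) (g : 'End(W)).

Lemma dual_omodule L : omodule (dual L).
Proof.
split=> [a _|u v Lu Lv a La|c u c0 Lu a La].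
- by rewrite (form0l bP); exact: powideal0.
- by rewrite (formDl bP); apply: powidealD; [exact: Lu|exact: Lv].
- by rewrite (formZl bP); apply: powidealZ => //; exact: Lu.
Qed.

Lemma notin_dual L v :
  ~ dual L v -> exists2 a, L a & ~ powideal lam (beta v a).
Proof.
move=> ndLv; apply: contrapT => no_a; apply: ndLv => a La.
by apply: contrapT => na; apply: no_a; exists a.
Qed.

Lemma dual_pairing L u v : L u -> dual L v -> powideal lam (beta u v).
Proof. by move=> Lu Lv; rewrite (formC bP); apply: powidealN; exact: Lv. Qed.

Lemma dual_unif_pairing L u v : dilation unif (dual L) `<=` L ->
  dual L u -> dual L v -> powideal (lam - 1) (beta u v).
Proof.
move=> uL dLu dLv; have Lv : L (unif *: v) by apply: uL; exists v.
by have := dLu _ Lv; rewrite (formZr bP) -[unif]expr1z => /powideal_unif_mul.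
Qed.

Lemma stabilizerP L g : stabilizer beta L g <->
  isometry_group beta g /\ forall v, L (g v) <-> L v.
Proof.
split=> [[gP /= gL]|[gP gL]]; split=> //.
  move=> v; split=> [|Lv]; last by rewrite -gL; exists v.
  by rewrite -{1}gL => -[u Lu /(can_inj (isometryK bP gP)) <-].
apply/seteqP; split=> [_ [v Lv <-]|v Lv]; first exact/gL.
by exists ((g^-1)%VF v); rewrite ?(isometryVK bP gP) //; apply/gL;
  rewrite (isometryVK bP gP).
Qed.

Lemma stabilizerV L g : stabilizer beta L g -> stabilizer beta L (g^-1)%VF.
Proof.
move=> /stabilizerP[gP gL]; apply/stabilizerP; split; first exact: isometryV.
by move=> v; rewrite -gL (isometryVK bP gP).
Qed.

Lemma stabilizer_dual L g : stabilizer beta L g -> stabilizer beta (dual L) g.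
Proof.
move=> /stabilizerP[gP gL]; apply/stabilizerP; split=> // v; split=> dLv b Lb.
  by rewrite -gP; apply: dLv; apply/gL.
by rewrite -[b](isometryVK bP gP) gP; apply/dLv/gL; rewrite (isometryVK bP gP).
Qed.

Lemma reflexive_stabilizer L g : dual (dual L) `<=` L ->
  isometry_group beta g ->
  (forall v, L v -> L (g v)) -> (forall v, dual L v -> dual L (g v)) ->
  stabilizer beta L g.
Proof.
move=> ddL gP gL gdL; apply/stabilizerP; split=> // v; split; last exact: gL.
move=> Lgv; apply: ddL => b dLb; rewrite -gP.
exact: dual_pairing Lgv (gdL _ dLb).
Qed.

Lemma opp_stabilizer L : subgroup L -> stabilizer beta L (- \1)%VF.
Proof.
move=> gL; apply/stabilizerP; split=> [|v]; first exact: opp_isometry.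
by rewrite !lfunE /= !lfunE /=; exact: subgroupNE.
Qed.

Lemma notin_powideal_common L (n : int) w w' :
  (forall u v, L u -> L v -> L (u + v)) ->
  (exists2 a, L a & ~ powideal n (beta w a)) ->
  (exists2 a, L a & ~ powideal n (beta w' a)) ->
  exists2 a, L a & ~ powideal n (beta w a) /\ ~ powideal n (beta w' a).
Proof.
move=> LD [a La wa] [a' La' wa'].
have [w'a|w'a] := pselect (powideal n (beta w' a)); last by exists a.
have [wa2|wa2] := pselect (powideal n (beta w a')); last by exists a'.
exists (a + a'); first exact: LD.
rewrite !(formDr bP); split=> waa'.
  by apply: wa; apply/(powidealDr _ wa2); rewrite addrC.
by apply: wa'; apply/(powidealDr _ w'a).
Qed.

Lemma transport_isometry_notin (m n : int) w w' a :
  ~ powideal m (beta w a) -> ~ powideal n (beta w' a) ->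
  isometry_group beta (transport beta w w' a).
Proof.
by move=> wa wa'; apply: transport_isometry => //; apply: notin_powideal_neq0;
  [exact: wa|exact: wa'].
Qed.

Lemma transport_sub L (m n1 n2 : int) w w' a : omodule L ->
  powideal m (beta w w') ->
  ~ powideal (m + 1) (beta w a) -> ~ powideal (m + 1) (beta w' a) -> n2 <= n1 ->
  (forall v, L v -> powideal (n1 + m) (beta v a)) ->
  (forall v, L v -> powideal (n2 + m) (beta v (w' - w))) ->
  (forall c, powideal n1 c -> L (c *: (w' - w))) ->
  (forall c, powideal n2 c -> L (c *: a)) ->
  forall v, L v -> L (transport beta w w' a v).
Proof.
move=> omodL ww' wa wa' n12 La Lu Lcu Lca v Lv; have [_ LD _] := omodL.
have coef1 : powideal n1 (beta v a / beta w a)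
  by exact: powideal_div (La v Lv) wa.
rewrite (transportE bP); apply: (LD); first by apply: LD => //; exact: Lcu.
apply/Lca/(powideal_div _ wa')/powidealB; first exact: Lu.
by apply: powidealM ww'; exact: powideal_le coef1.
Qed.

End DualLattices.

(** * The residual symplectic space *)

Section QuotientSpaceTheory.
Variables (K : localField) (W : vectType K) (L M : set W)
  (Q : quotientSpace L M).
Implicit Types (u v : W) (y z : Q) (g : 'End(W)).

Lemma qliftP y : L (qlift y) /\ qproj Q (qlift y) = y.
Proof.
rewrite /qlift; case: xgetP => [u _ []//|no_lift].
by have [u Lu uy] := qproj_surj y; case: (no_lift u).
Qed.

Hypothesis omodL : omodule L.

Let subL : subgroup L := omodule_subgroup omodL.

Lemma qprojB u v : L u -> L v -> qproj Q (u - v) = qproj Q u - qproj Q v.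
Proof.
move=> Lu Lv; rewrite qprojD //; last exact: (subgroupN subL).
rewrite -[- v]scaleN1r qprojZ //; last exact/intringE/powidealN1.
by rewrite redN ?red1 ?scaleN1r //; exact: powideal1.
Qed.

Lemma qproj_eq u v : L u -> L v -> qproj Q u = qproj Q v <-> M (u - v).
Proof.
move=> Lu Lv; rewrite -(qproj_ker Q (subgroupB subL Lu Lv)) qprojB //.
by split=> [->|/eqP]; rewrite ?subrr // subr_eq0 => /eqP.
Qed.

Lemma has_index_qpreim (U : {vspace Q}) :
  has_index [set u | L u /\ qproj Q u \in U] M (#|residue K| ^ \dim U).
Proof.
have freeU : free (vbasis U) by exact: basis_free (vbasisP U).
rewrite -[X in (_ ^ X)%N]card_ord -card_ffun.
pose p w := [ffun i => coord (vbasis U) i (qproj Q w)].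
apply: (has_index_quotient (p := p)) => [t|u v [Lu Uu] [Lv Uv]].
  have [Lu uE] := qliftP (\sum_i t i *: (vbasis U)`_i).
  exists (qlift (\sum_i t i *: (vbasis U)`_i)).
    split=> //; rewrite uE; apply: memv_suml => i _; apply: memvZ.
    by apply: vbasis_mem; rewrite mem_nth ?size_tuple.
  by apply/ffunP => i; rewrite ffunE uE coord_sum_free.
rewrite -(qproj_eq Lu Lv); split=> [/ffunP puv|uv]; last by apply/ffunP => i;
  rewrite !ffunE uv.
rewrite (coord_vbasis Uu) (coord_vbasis Uv); apply: eq_bigr => i _.
by have := puv i; rewrite !ffunE => ->.
Qed.

Lemma qmorphE g u : (forall v, M v -> M (g v)) -> (forall v, L v -> L (g v)) ->
  L u -> qmorph Q g (qproj Q u) = qproj Q (g u).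
Proof.
move=> gM gL Lu; have lift_g y v : L v -> qproj Q v = y ->
  qproj Q (g (qlift y)) = qproj Q (g v).
  move=> Lv vy; have [Ly yE] := qliftP y; apply/qproj_eq;
    [exact: gL|exact: gL|].
  by rewrite -linearB; apply: gM; apply/qproj_eq => //; rewrite yE.
rewrite /qmorph linfunE; first exact: lift_g.
move=> t y z; have [Ly yE] := qliftP y; have [Lz zE] := qliftP z.
have [Oc ct] := lift_redP t; have Lcy := omoduleZ omodL Oc Ly.
rewrite (lift_g _ (lift_red t *: qlift y + qlift z)).
- rewrite linearD linearZ /= qprojD ?qprojZ ?ct //; try exact: gL.
  + exact/intringE.
  + by apply: (omoduleZ omodL) => //; exact: gL.
- exact: (subgroupD subL).
- by rewrite qprojD ?qprojZ ?ct ?yE ?zE //; exact/intringE.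
Qed.

End QuotientSpaceTheory.

Lemma symplectic_basis_nondeg (F : finFieldType) (V : vectType F)
    (b : V -> V -> F) (l : nat) (eps phi : l.-tuple V) :
  (forall u v w, b (u + v) w = b u w + b v w) ->
  (forall c u v, b (c *: u) v = c * b u v) -> (forall u v, b u v = - b v u) ->
  symplectic_basis b eps phi -> forall u, (forall v, b u v = 0) -> u = 0.
Proof.
move=> bDl bZl bC [basis_ep ee pp ep] u u0.
have b_suml (I : finType) (c : I -> F) (y : I -> V) z :
    b (\sum_i c i *: y i) z = \sum_i c i * b (y i) z.
  elim/big_rec2: _ => [|i x t _ <-]; last by rewrite bDl bZl.
  by have := bZl 0 0 z; rewrite scale0r mul0r.
have : u \in (<<eps>> + <<phi>>)%VS by rewrite -span_cat
  (span_basis basis_ep) memvf.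
case/memv_addP => y /coord_span yE [z /coord_span zE uE].
have y0 j : coord eps j y = 0.
  have := u0 (tnth phi j); rewrite uE yE zE bDl !b_suml.
  rewrite [X in _ + X]big1 ?addr0 => [|i _]; last by rewrite -tnth_nth pp mulr0.
  rewrite (bigD1 j) //= -tnth_nth ep eqxx mulr1 big1 ?addr0 -?yE // => i ij.
  by rewrite -tnth_nth ep (negbTE ij) mulr0.
have z0 j : coord phi j z = 0.
  have := u0 (tnth eps j); rewrite uE yE zE bDl !b_suml.
  rewrite [X in X + _]big1 ?add0r => [|i _]; last by rewrite -tnth_nth ee mulr0.
  rewrite (bigD1 j) //= -tnth_nth bC ep eqxx big1 ?addr0 -?zE => [|i ij].
    by rewrite mulrN1 => /eqP; rewrite oppr_eq0 => /eqP.
  by rewrite -tnth_nth bC ep eq_sym (negbTE ij) oppr0 mulr0.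
rewrite uE yE zE !big1 ?addr0 // => i _; [rewrite z0|rewrite y0];
  exact: scale0r.
Qed.

Section ResidualForm.
Variables (K : localField) (W : vectType K) (lam : int) (beta : W -> W -> K).
Variable B : set W.
Local Notation Bs := (dual_lattice lam beta B).
Hypothesis bP : symplectic_form beta.
Hypotheses (sBBs : B `<=` Bs) (unifBs : dilation unif Bs `<=` B).
Variable Q : quotientSpace Bs B.
Local Notation b := (qform lam beta (Q := Q)).
Implicit Types (u v : W) (y z : Q) (g : 'End(W)).

Let omodBs : omodule Bs := dual_omodule lam bP B.
Let subBs : subgroup Bs := omodule_subgroup omodBs.

Lemma qform_integral u v :
  Bs u -> Bs v -> powideal 0 (unif ^ (1 - lam) * beta u v).
Proof.
move=> Bsu Bsv; apply/powideal_unif_mul; rewrite sub0r opprB.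
exact: dual_unif_pairing unifBs Bsu Bsv.
Qed.

Lemma qformE u v : Bs u -> Bs v ->
  b (qproj Q u) (qproj Q v) = reduction (unif ^ (1 - lam) * beta u v).
Proof.
move=> Bsu Bsv; rewrite /qform.
have [Bsu' uu'] := qliftP (qproj Q u); have [Bsv' vv'] := qliftP (qproj Q v).
set u' := qlift _ in Bsu' uu' *; set v' := qlift _ in Bsv' vv' *.
have /(qproj_eq Q omodBs Bsu' Bsu) Bu := uu';
  have /(qproj_eq Q omodBs Bsv' Bsv) Bv := vv'.
apply/red_eq; try exact: qform_integral.
rewrite -mulrBr; apply/powideal_unif_mul; rewrite opprB addrC subrK.
have -> : beta u' v' - beta u v = beta u' (v' - v) - beta v (u' - u).
  by rewrite !(formDr bP, formNr bP) (formC bP v u') (formC bP v u); ring.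
by apply: powidealB; [exact: Bsu' Bv|exact: Bsv Bu].
Qed.

Lemma qformDl y1 y2 z : b (y1 + y2) z = b y1 z + b y2 z.
Proof.
have [u1 Bs1 <-] := qproj_surj y1; have [u2 Bs2 <-] := qproj_surj y2.
have [v Bsv <-] := qproj_surj z.
rewrite -qprojD // !qformE //; last exact: (subgroupD subBs).
by rewrite (formDl bP) mulrDr redD //; apply/powidealP; exact: qform_integral.
Qed.

Lemma qformZl t y z : b (t *: y) z = t * b y z.
Proof.
have [u Bsu <-] := qproj_surj y; have [v Bsv <-] := qproj_surj z.
have [Oc ct] := lift_redP t; rewrite -{1}ct -qprojZ //; last exact/intringE.
rewrite !qformE //; last exact: (omoduleZ omodBs).
rewrite (formZl bP) mulrCA redM ?ct //; apply/powidealP => //.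
exact: qform_integral.
Qed.

Lemma qformC y z : b y z = - b z y.
Proof.
have [u Bsu <-] := qproj_surj y; have [v Bsv <-] := qproj_surj z.
rewrite !qformE // -redN; last exact: qform_integral.
by rewrite -mulrN -(formC bP).
Qed.

Lemma qmorph_isometry g :
  stabilizer beta B g -> isometry_group b (qmorph Q g).
Proof.
move=> gK y z; have /(stabilizerP bP)[gP gB] := gK.
have /(stabilizerP bP)[_ gBs] := stabilizer_dual lam bP gK.
have [u Bsu <-] := qproj_surj y; have [v Bsv <-] := qproj_surj z.
rewrite !(qmorphE Q omodBs) //; try by move=> w; rewrite ?gB ?gBs.
by rewrite !qformE ?gP //; apply/gBs.
Qed.

Lemma good_lattice_reflexive l (eps phi : l.-tuple Q) :
  symplectic_basis b eps phi -> dual_lattice lam beta Bs `<=` B.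
Proof.
move=> eps_phi v ddv; have Bsv : Bs v by move=> a /sBBs; exact: ddv.
apply/(qproj_ker Q Bsv).
apply: (symplectic_basis_nondeg qformDl qformZl qformC eps_phi) => z.
have [u Bsu <-] := qproj_surj z; rewrite qformE // -(red0 K).
apply/red_eq; [exact: qform_integral|exact: powideal0|].
by rewrite subr0; apply/powideal_unif_mul; rewrite opprB addrC subrK;
  exact: ddv.
Qed.

Section Lagrangian.
Variables (l : nat) (A : set W) (x : {vspace Q}).
Hypotheses (dimQ : \dim {:Q} = (2 * l)%N) (dimx : \dim x = l).
Hypotheses (omodA : omodule A) (sBA : B `<=` A) (sABs : A `<=` Bs).
Hypothesis xE : [set y | y \in x] = [set qproj Q a | a in A].

Let subA : subgroup A := omodule_subgroup omodA.

Lemma residual_preimage : [set u | Bs u /\ qproj Q u \in x] = A.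
Proof.
have xP y : y \in x <-> exists2 a, A a & qproj Q a = y.
  by have /(congr1 (@^~ y)) /= -> := xE.
apply/seteqP; split=> [u [Bsu /xP[a Aa au]]|u Au]; last first.
  by split; [exact: sABs|apply/xP; exists u].
apply/(subgroup_congr subA (_ : A (u - a))) => //; apply: sBA.
by apply/(qproj_eq Q omodBs Bsu (sABs Aa)).
Qed.

Lemma Lagrangian_index : has_index A B (#|residue K| ^ l).
Proof. by rewrite -residual_preimage -dimx; exact: has_index_qpreim. Qed.

Lemma dual_Lagrangian_index (subB : subgroup B) :
  has_index Bs A (#|residue K| ^ l).
Proof.
have fullE : [set u | Bs u /\ qproj Q u \in fullv] = Bs.
  by apply/seteqP; split=> [u []//|u Bsu]; split=> //; exact: memvf.
have := has_index_qpreim omodBs (fullv : {vspace Q}); rewrite fullE dimQ => BsB.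
have [n BsA] := has_index_upper subBs subA subB sBA sABs Lagrangian_index BsB.
rewrite mul2n -addnn expnD => /eqP; rewrite eqn_pmul2r; first by move/eqP <-.
by rewrite expn_gt0 (ltnW (card_residue_gt1 K)).
Qed.

End Lagrangian.

End ResidualForm.

(** * A good lattice [B], a self-dual lattice [A] and the dual [Bs] of [B] *)

Section GoodLattice.
Variables (K : localField) (W : vectType K) (lam : int) (beta : W -> W -> K).
Variables (B A : set W).
Local Notation dual := (dual_lattice lam beta).
Local Notation Bs := (dual B).
Local Notation KB := (stabilizer beta B).
Hypothesis charF : 2%N \notin [pchar (residue K)].
Hypothesis bP : symplectic_form beta.
Hypothesis goodB : good_lattice lam beta B.
Hypothesis selfdualA : selfdual_lattice lam beta A.
Hypotheses (sBA : B `<=` A) (sABs : A `<=` Bs).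
Hypothesis reflexiveB : dual Bs `<=` B.
Implicit Types (u v w a : W) (g : 'End(W)) (c : K) (k n : nat).

Let two0 : 2 != 0 :> K := two_neq0 charF.

Let latA : is_lattice A. Proof. by case: selfdualA. Qed.
Let latB : is_lattice B. Proof. by case: goodB. Qed.
Let omodA : omodule A. Proof. exact: lattice_omodule. Qed.
Let omodB : omodule B. Proof. exact: lattice_omodule. Qed.
Let omodBs : omodule Bs. Proof. exact: dual_omodule. Qed.
Let subA : subgroup A. Proof. exact: omodule_subgroup. Qed.
Let subB : subgroup B. Proof. exact: omodule_subgroup. Qed.
Let subBs : subgroup Bs. Proof. exact: omodule_subgroup. Qed.
Let dualA : dual A = A. Proof. by case: selfdualA. Qed.
Let unifBs : dilation unif Bs `<=` B. Proof. by case: goodB. Qed.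
Let sBBs : B `<=` Bs. Proof. by case: goodB. Qed.

Lemma form_A u v : A u -> A v -> powideal lam (beta u v).
Proof. by move=> Au Av; rewrite -dualA in Av; exact: dual_pairing Av. Qed.

Lemma form_BBs u v : B u -> Bs v -> powideal lam (beta u v).
Proof. exact: dual_pairing. Qed.

Lemma form_Bs u v : Bs u -> Bs v -> powideal (lam - 1) (beta u v).
Proof. exact: dual_unif_pairing. Qed.

Lemma notinA v : ~ A v -> exists2 a, A a & ~ powideal lam (beta v a).
Proof. by rewrite -{1}dualA; exact: notin_dual. Qed.

Lemma notinB v : ~ B v -> exists2 a, Bs a & ~ powideal lam (beta v a).
Proof. by move=> nBv; apply: notin_dual => /reflexiveB. Qed.

Lemma unif_Bs v : Bs v -> B (unif *: v).
Proof. by move=> Bsv; apply: unifBs; exists v. Qed.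

Lemma powideal1_Bs c v : powideal 1 c -> Bs v -> B (c *: v).
Proof.
move=> [d /intringE d0 <-] Bsv; rewrite expr1z mulrC -scalerA.
by apply: (omoduleZ omodB) => //; exact: unif_Bs.
Qed.

Lemma omodule_half L u : omodule L -> L (u + u) -> L u.
Proof.
move=> omodL; rewrite -mulr2n -scaler_nat =>
  /(omoduleZ omodL (powideal2V charF)).
by rewrite scalerA mulVf // scale1r.
Qed.

Lemma stabilizer_B g v : KB g -> B (g v) <-> B v.
Proof. by case/stabilizerP. Qed.

Lemma stabilizer_Bs g v : KB g -> Bs (g v) <-> Bs v.
Proof. by move=> /(stabilizer_dual lam bP)/stabilizerP[]. Qed.

Lemma stabilizer_isometry (L : set W) g : stabilizer beta L g ->
  isometry_group beta g.
Proof. by case. Qed.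

Lemma selfdual_stabilizer g : isometry_group beta g ->
  (forall v, A v -> A (g v)) -> stabilizer beta A g.
Proof.
by move=> gP gA; apply: (reflexive_stabilizer bP (lam := lam)); rewrite ?dualA.
Qed.

Lemma expansion_pairing k w :
  expansion k A w <-> forall a, A a -> powideal (lam - k%:Z) (beta w a).
Proof.
rewrite expansionE -{1}dualA; split=> Aw a Aa.
  by have := Aw _ Aa; rewrite (formZl bP) exprnP => /powideal_unif_mul.
by rewrite (formZl bP) exprnP; apply/powideal_unif_mul; exact: Aw.
Qed.

Lemma expansion_sign_eqmod k v w :
  sign_eqmod A v w -> expansion k A w -> expansion k A v.
Proof.
have subE : subgroup (expansion k A).
  exact/omodule_subgroup/expansion_omodule.
apply: sign_eqmodP => [x y /(sub_expansion k omodA) xy|x];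
  last exact: subgroupN.
by move/(subgroup_congr subE xy).
Qed.

(** * Transitivity of the stabilizer of [B] *)

Lemma transport_stabilizer_Bs w w' a : Bs w -> Bs w' -> Bs a ->
  ~ powideal lam (beta w a) -> ~ powideal lam (beta w' a) ->
  KB (transport beta w w' a).
Proof.
move=> Bsw Bsw' Bsa wa wa'; have Bsu := subgroupB subBs Bsw' Bsw.
apply: (reflexive_stabilizer bP (lam := lam)) => //.
- exact: transport_isometry_notin wa wa'.
- apply: (transport_sub bP (m := lam - 1) (n1 := 1) (n2 := 1));
    rewrite ?subrK //.
  + exact: form_Bs.
  + by move=> v Bv; rewrite addrC subrK; exact: form_BBs.
  + by move=> v Bv; rewrite addrC subrK; exact: form_BBs.
  + by move=> c c1; exact: powideal1_Bs.
  + by move=> c c1; exact: powideal1_Bs.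
- apply: (transport_sub bP (m := lam - 1) (n1 := 0) (n2 := 0));
    rewrite ?subrK //.
  + exact: form_Bs.
  + by move=> v Bsv; rewrite add0r; exact: form_Bs.
  + by move=> v Bsv; rewrite add0r; exact: form_Bs.
  + by move=> c c0; exact: (omoduleZ omodBs).
  + by move=> c c0; exact: (omoduleZ omodBs).
Qed.

Lemma transport_stabilizer_A w w' a : Bs w -> Bs w' -> A a ->
  ~ powideal lam (beta w a) -> ~ powideal lam (beta w' a) ->
  stabilizer beta A (transport beta w w' a).
Proof.
move=> Bsw Bsw' Aa wa wa'; have Bsu := subgroupB subBs Bsw' Bsw.
apply: selfdual_stabilizer.
  exact: transport_isometry_notin wa wa'.
apply: (transport_sub bP (m := lam - 1) (n1 := 1) (n2 := 0)); rewrite ?subrK //.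
- exact: form_Bs.
- by move=> v Av; rewrite addrC subrK; exact: form_A.
- by move=> v Av; rewrite add0r; exact/form_Bs/Bsu/sABs.
- by move=> c c1; apply/sBA/powideal1_Bs.
- by move=> c c0; exact: (omoduleZ omodA).
Qed.

Lemma transport_stabilizer_B w w' a : B w -> B w' -> B a ->
  ~ powideal (lam + 1) (beta w a) -> ~ powideal (lam + 1) (beta w' a) ->
  KB (transport beta w w' a).
Proof.
move=> Bw Bw' Ba wa wa'; have Bu := subgroupB subB Bw' Bw.
apply: (reflexive_stabilizer bP (lam := lam)) => //.
- exact: transport_isometry_notin wa wa'.
- apply: (transport_sub bP (m := lam) (n1 := 0) (n2 := 0)) => //.
  + by apply: form_BBs => //; exact: sBBs.
  + by move=> v Bv; rewrite add0r; apply: form_BBs => //; exact: sBBs.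
  + by move=> v Bv; rewrite add0r; apply: form_BBs => //; exact: sBBs.
  + by move=> c c0; exact: (omoduleZ omodB).
  + by move=> c c0; exact: (omoduleZ omodB).
- apply: (transport_sub bP (m := lam) (n1 := 0) (n2 := 0)) => //.
  + by apply: form_BBs => //; exact: sBBs.
  + by move=> v Bsv; rewrite add0r; exact: Bsv.
  + by move=> v Bsv; rewrite add0r; exact: Bsv.
  + by move=> c c0; apply: sBBs; exact: (omoduleZ omodB).
  + by move=> c c0; apply: sBBs; exact: (omoduleZ omodB).
Qed.

Lemma transitive_Bs w w' : Bs w -> ~ B w -> Bs w' -> ~ B w' ->
  exists2 g, KB g & g w = w'.
Proof.
move=> Bsw nBw Bsw' nBw'; have [_ BsD _] := omodBs.
have [a Bsa [wa wa']] := notin_powideal_common bP BsD (notinB nBw)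
  (notinB nBw').
exists (transport beta w w' a); first exact: transport_stabilizer_Bs.
exact/transport_id/notin_powideal_neq0/wa.
Qed.

Lemma transitive_Bs_stabilizing_A w w' : Bs w -> ~ A w -> Bs w' -> ~ A w' ->
  exists2 g, KB g & stabilizer beta A g /\ g w = w'.
Proof.
move=> Bsw nAw Bsw' nAw'; have [_ AD _] := omodA.
have [a Aa [wa wa']] := notin_powideal_common bP AD (notinA nAw) (notinA nAw').
exists (transport beta w w' a).
  by apply: transport_stabilizer_Bs => //; exact: sABs.
split; first exact: transport_stabilizer_A.
exact/transport_id/notin_powideal_neq0/wa.
Qed.

Lemma transitive_B w w' : B w -> ~ Bs (unif^-1 *: w) -> B w' ->
  ~ Bs (unif^-1 *: w') -> exists2 g, KB g & g w = w'.
Proof.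
have notinBs v : ~ Bs (unif^-1 *: v) ->
    exists2 a, B a & ~ powideal (lam + 1) (beta v a).
  move=> /notin_dual[a Ba va]; exists a => // va1; apply: va.
  by rewrite (formZl bP) -exprN1; apply/powideal_unif_mul; rewrite opprK.
move=> Bw nBw Bw' nBw'; have [_ BD _] := omodB.
have [a Ba [wa wa']] := notin_powideal_common bP BD (notinBs _ nBw)
  (notinBs _ nBw').
exists (transport beta w w' a); first exact: transport_stabilizer_B.
exact/transport_id/notin_powideal_neq0/wa.
Qed.

(** * The layers of the filtration by the multiples of [B] and [Bs] *)

Definition filt k : set W :=
  if odd k then expansion k./2.+1 B else expansion k./2 Bs.

Definition layer k : set W := if k is k'.+1 then filt k `\` filt k' else filt 0.

Lemma filt_omodule k : omodule (filt k).
Proof. by rewrite /filt; case: ifP => _; exact: expansion_omodule. Qed.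

Let sub_filt k : subgroup (filt k) := omodule_subgroup (filt_omodule k).

Lemma filt0 : filt 0 = Bs.
Proof. exact: expansion0. Qed.

Lemma layer0 : layer 0 = Bs.
Proof. exact: filt0. Qed.

Lemma filt_even n : filt n.*2 = expansion n Bs.
Proof. by rewrite /filt odd_double doubleK. Qed.

Lemma filt_odd n : filt n.*2.+1 = expansion n.+1 B.
Proof. by rewrite /filt /= odd_double uphalf_double. Qed.

Lemma filt_succ k : filt k `<=` filt k.+1.
Proof.
rewrite -(odd_double_half k); case: (odd k); rewrite ?add1n ?add0n -?doubleS.
  by rewrite filt_odd filt_even; exact: expansion_sub.
rewrite filt_even filt_odd -[expansion _ Bs]expansionS.
exact: expansion_sub.
Qed.

Lemma filt_leq k n : (k <= n)%N -> filt k `<=` filt n.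
Proof.
move=> /subnK <-; elim: (n - k)%N => [//|i IHi] w /IHi.
by rewrite addSn; exact: filt_succ.
Qed.

Lemma filtA k : A `<=` filt k.
Proof.
by apply: subset_trans sABs _; rewrite -filt0; exact: filt_leq.
Qed.

Lemma filt_expansion k : filt k `<=` expansion k.+1 A.
Proof.
apply: (@subset_trans _ (expansion k./2.+1 A)); last first.
  by apply: expansion_leq => //; rewrite ltnS -divn2 leq_div.
rewrite /filt; case: ifP => _; first exact: expansion_sub.
rewrite -[expansion _ Bs]expansionS; apply: expansion_sub.
exact: subset_trans unifBs sBA.
Qed.

Lemma filt_exists w : exists k, filt k w.
Proof.
have [k Ak] := lattice_absorbing w latA; exists k.*2.
by rewrite filt_even; exact: expansion_sub Ak.
Qed.

Lemma layer_filt k : layer k `<=` filt k.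
Proof. by case: k => [//|k] w []. Qed.

Lemma layer_exists w : exists k, layer k w.
Proof.
have ex_filt : exists k, `[< filt k w >].
  by have [k fk] := filt_exists w; exists k; apply/asboolP.
exists (ex_minn ex_filt); case: ex_minnP => -[|k] /asboolP fk min //.
by split=> // fk'; have := min k (asboolT fk'); rewrite ltnn.
Qed.

Lemma layer_leq j k w : layer j w -> filt k w -> (j <= k)%N.
Proof.
case: j => [//|j] [_ nj] fk; rewrite leqNgt; apply/negP; rewrite ltnS => kj.
exact/nj/(filt_leq kj).
Qed.

Lemma layer_inj j k w : layer j w -> layer k w -> j = k.
Proof.
move=> jw kw; apply/eqP; rewrite eqn_leq.
by rewrite (layer_leq jw (layer_filt kw)) (layer_leq kw (layer_filt jw)).
Qed.

Lemma layerS_notin_Bs k w : layer k.+1 w -> ~ Bs w.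
Proof. by rewrite -filt0 => /layer_leq h /h. Qed.

Lemma layer_expansion k : layer k `<=` expansion k.+1 A.
Proof. exact: subset_trans (@layer_filt k) (@filt_expansion k). Qed.

Lemma filt_translate k u v : A (u - v) -> filt k v -> filt k u.
Proof.
by move=> uv fv; apply/(subgroup_congr (sub_filt k) (@filtA k _ uv)).
Qed.

Lemma layer_translate k u v : A (u - v) -> layer k v -> layer k u.
Proof.
move=> uv; case: k => [|k] /=; first exact: filt_translate.
case=> fv nv; split; first exact: filt_translate fv.
by move=> fu; apply: nv; apply: filt_translate fu; exact: subgroupBC.
Qed.

Lemma layerDA k a w : A a -> layer k (a + w) <-> layer k w.
Proof.
move=> Aa; split; apply: layer_translate; last by rewrite addrK.
by rewrite opprD addrCA subrr addr0; exact: (subgroupN subA).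
Qed.

Lemma layerN k u : layer k (- u) <-> layer k u.
Proof.
by case: k => [|k] /=; rewrite ?/layer /setD /= !(subgroupNE _ (sub_filt _)).
Qed.

Lemma layer_sign_eqmod k u v : sign_eqmod A u v -> layer k v -> layer k u.
Proof.
by apply: sign_eqmodP => [x y|x]; [exact: layer_translate|rewrite layerN].
Qed.

Lemma stabilizer_filt g k v : KB g -> filt k (g v) <-> filt k v.
Proof.
move=> gK; rewrite /filt; case: (odd k); rewrite !expansionE -linearZ.
  exact: stabilizer_B.
exact: stabilizer_Bs.
Qed.

Lemma stabilizer_layer g k v : KB g -> layer k (g v) <-> layer k v.
Proof.
move=> gK; case: k => [|k] /=; first exact: stabilizer_filt.
by rewrite /setD /= !(stabilizer_filt _ _ gK).
Qed.

Lemma transitive_layer k w w' : layer k.+1 w -> layer k.+1 w' ->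
  exists2 g, KB g & g w = w'.
Proof.
have unifXS n v : unif ^+ n *: v = unif^-1 *: (unif ^+ n.+1 *: v).
  by rewrite scalerA exprS mulKf ?unif_neq0.
rewrite -(odd_double_half k) /layer; case: (odd k);
  rewrite ?add1n ?add0n -?doubleS.
  rewrite filt_even filt_odd /setD /= !expansionE => -[Bsw nBw] [Bsw' nBw'].
  have [g gK gw] := transitive_Bs Bsw nBw Bsw' nBw'; exists g => //.
  by move: gw; rewrite linearZ => /(scalerI (unifX_neq0 K _)).
rewrite filt_odd filt_even /setD /= !expansionE ![unif ^+ k./2 *: _]unifXS.
move=> [Bw nBw] [Bw' nBw'].
have [g gK gw] := transitive_B Bw nBw Bw' nBw'; exists g => //.
by move: gw; rewrite linearZ => /(scalerI (unifX_neq0 K _)).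
Qed.

(** * Separation of classes modulo [A] by transvections *)

Variables (R : realType) (psi : K -> R[i]).
Hypotheses (psi_char : unitary_character psi) (psi_cond : conductor psi lam).
Implicit Types (f h : W -> R[i]) (s : bool).

(* If [beta u q] is large, then [beta u p] is small; else consider [u0 + u]. *)
Lemma pairing_product_vanishing k p q u0 :
  (forall u, A u -> powideal (2 * lam - k%:Z) (beta u p * beta u q)) ->
  A u0 -> ~ powideal (lam - k%:Z + 1) (beta u0 q) -> A p.
Proof.
move=> pq Au0 qu0.
have up_small u : A u -> ~ powideal (lam - k%:Z + 1) (beta u q) ->
    powideal lam (beta u p).
  move=> Au qu; rewrite -[beta u p](mulfK (notin_powideal_neq0 qu)).
  apply: (powideal_div _ qu).
  by rewrite (_ : lam + _ = 2 * lam - k%:Z); [exact: pq|lia].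
rewrite -dualA => u Au; rewrite (formC bP); apply: powidealN.
have [uq|uq] := pselect (powideal (lam - k%:Z + 1) (beta u q));
  last exact: up_small.
apply/(powidealDr _ (up_small _ Au0 qu0)); rewrite -(formDl bP).
apply: up_small; first exact: (subgroupD subA).
by rewrite (formDl bP) [X in powideal _ X]addrC (powidealDr _ uq).
Qed.

(* The transvections [v |-> v + c b(u, v) u] with [diag_param k c u] act
   diagonally on the functions supported in [expansion k.+1 A]. *)
Definition diag_param k c u : Prop := A u /\ powideal (k.+1%:Z - lam) c.

Definition transvection_char c u v : R[i] := psi (2^-1 * (c * beta u v ^+ 2)).

Lemma transvection_char_eq c u v w :
  transvection_char c u v = transvection_char c u w ->
  psi (c * (2^-1 * (beta u (v - w) * beta u (v + w)))) = 1.
Proof.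
rewrite /transvection_char => vw.
have -> : c * (2^-1 * (beta u (v - w) * beta u (v + w))) =
    2^-1 * (c * beta u v ^+ 2) - 2^-1 * (c * beta u w ^+ 2).
  by rewrite !(formDr bP) (formNr bP); ring.
by rewrite (psiB psi_char psi_cond) vw divff // psi_neq0.
Qed.

(* Otherwise [beta u (v - w) * beta u (v + w)] lies in [unif ^ (2 lam - k)] for
   all [u] in [A], while one of the factors is sometimes of minimal
   valuation. *)
Lemma separating_transvection_r k v w :
  ~ expansion k A w -> ~ sign_eqmod A v w ->
  exists c u, diag_param k c u /\
    transvection_char c u v != transvection_char c u w.
Proof.
move=> nAw nvw; apply: contrapT => nsep.
have pq u : A u ->
    powideal (2 * lam - k.+1%:Z) (beta u (v - w) * beta u (v + w)).
  move=> Au; have -> : 2 * lam - k.+1%:Z = lam - (k.+1%:Z - lam) by lia.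
  rewrite -[X in powideal _ X](mulVKf two0).
  apply: powidealZ (powideal_nat _ 2) _.
  apply: (psi_orthogonal psi_cond) => c cP; apply: transvection_char_eq.
  by apply/eqP; apply: contrapT => /negP ne; apply: nsep; exists c, u.
have [u0 Au0 wu0] : exists2 u0,
    A u0 & ~ powideal (lam - k.+1%:Z + 1) (beta u0 w).
  apply: contrapT => no_u0; apply: nAw; apply/expansion_pairing => a Aa.
  rewrite (formC bP); apply: powidealN; apply: contrapT => na; apply: no_u0.
  by exists a => //; rewrite (_ : lam - _ + _ = lam - k%:Z) //; lia.
have [vwu0|vwu0] := pselect (powideal (lam - k.+1%:Z + 1) (beta u0 (v + w)));
  last first.
  by apply: nvw; left; exact: pairing_product_vanishing pq Au0 vwu0.
apply: nvw; right.
apply: (@pairing_product_vanishing k.+1 _ (v - w) u0) => [u /pq|//|v_wu0].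
  by rewrite [X in powideal _ X]mulrC.
apply/wu0/(powideal_double charF).
have -> : 2 * beta u0 w = beta u0 (v + w) - beta u0 (v - w).
  by rewrite !(formDr bP) (formNr bP); ring.
exact: powidealB.
Qed.

Lemma separating_transvection k v w :
  ~ (expansion k A v /\ expansion k A w) -> ~ sign_eqmod A v w ->
  exists c u, diag_param k c u /\
    transvection_char c u v != transvection_char c u w.
Proof.
move=> nAvw nvw; have [Aw|nAw] := pselect (expansion k A w); last first.
  exact: separating_transvection_r.
have nwv : ~ sign_eqmod A w v by move=> /(sign_eqmod_sym subA).
have [|c [u [cu ne]]] := separating_transvection_r (k := k) (w := v) _ nwv.
  by move=> Av; exact: nAvw.
by exists c, u; rewrite eq_sym.
Qed.

(** * The lattice model *)

Let psi_half_eqmod (x y : K) :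
  powideal lam (x - y) -> psi (2^-1 * x) = psi (2^-1 * y).
Proof.
move=> xy; apply: (psi_eqmod psi_char psi_cond); rewrite -mulrBr.
exact: (powideal_half charF).
Qed.

Definition quasi_periodic f : Prop :=
  forall a w, A a -> f (a + w) = psi (2^-1 * beta w a) * f w.

Definition has_parity s f : Prop := forall w, f (- w) = (-1) ^+ s * f w.

Definition supp f : set W := [set w | f w <> 0].

Lemma eq0_notin_supp f (D : set W) w : supp f `<=` D -> ~ D w -> f w = 0.
Proof. by move=> fD nDw; apply: contrapT => /fD. Qed.

Lemma suppD (z : R[i]) f h (D : set W) : supp f `<=` D -> supp h `<=` D ->
  supp (fun w => z * f w + h w) `<=` D.
Proof.
move=> fD hD w; apply: contra_notP => nDw.
by rewrite (eq0_notin_supp fD) // (eq0_notin_supp hD) // mulr0 addr0.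
Qed.

Lemma quasi_periodic_val f v w :
  quasi_periodic f -> A (v - w) -> f v = psi (2^-1 * beta w (v - w)) * f w.
Proof. by move=> qf vw; rewrite -qf // subrK. Qed.

Lemma quasi_periodic_neq0 f v w :
  quasi_periodic f -> A (v - w) -> f w <> 0 -> f v <> 0.
Proof.
move=> qf vw /eqP fw; rewrite (quasi_periodic_val qf vw); apply/eqP.
by rewrite mulf_neq0 // psi_neq0.
Qed.

Lemma quasi_periodicD (z : R[i]) f h : quasi_periodic f -> quasi_periodic h ->
  quasi_periodic (fun w => z * f w + h w).
Proof. by move=> qf qh a w Aa; rewrite qf // qh // mulrDr mulrCA. Qed.

Lemma has_parityD s (z : R[i]) f h : has_parity s f -> has_parity s h ->
  has_parity s (fun w => z * f w + h w).
Proof. by move=> pf ph w; rewrite pf ph mulrDr mulrCA. Qed.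

Lemma odd_vanishes f w :
  quasi_periodic f -> has_parity true f -> A w -> f w = 0.
Proof.
move=> qf pf Aw; have f0 : f 0 = 0.
  by have /eqP := pf 0; rewrite oppr0 expr1 mulN1r -addr_eq0 -mulr2n
    mulrn_eq0 => /eqP.
by rewrite (quasi_periodic_val (w := 0) qf) ?subr0 // f0 mulr0.
Qed.

Definition coset_fun w : W -> R[i] := fun v =>
  if `[< A (v - w) >] then psi (2^-1 * beta w (v - w)) else 0.

Definition orbit_fun s w : W -> R[i] := fun v =>
  if `[< A (v - w) >] then coset_fun w v else (-1) ^+ s * coset_fun w (- v).

Lemma coset_fun_id w : coset_fun w w = 1.
Proof.
rewrite /coset_fun subrr asboolT; last exact: (subgroup0 subA).
by rewrite (form0r bP) mulr0 (psi0 psi_cond).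
Qed.

Lemma coset_fun_quasi_periodic w : quasi_periodic (coset_fun w).
Proof.
move=> a v Aa; rewrite /coset_fun -[a + v - w]addrA.
rewrite (asbool_equiv_eq (subgroupDr (v - w) subA Aa)).
case: asboolP => [vw|_]; last by rewrite mulr0.
rewrite -(psiD psi_char) -mulrDr; apply: psi_half_eqmod.
have -> : beta w (a + (v - w)) - (beta v a + beta w (v - w)) = - beta (v - w) a.
  by rewrite !(formDr bP, formDl bP, formNl bP); ring.
by apply: powidealN; exact: form_A.
Qed.

Lemma coset_fun_in_A w v : A w -> A v -> coset_fun w v = 1.
Proof.
move=> Aw Av; have Avw := subgroupB subA Av Aw.
rewrite /coset_fun asboolT // -(psi0 psi_cond) -(mulr0 2^-1).
by apply: psi_half_eqmod; rewrite subr0; exact: form_A.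
Qed.

Lemma orbit_fun_id s w : orbit_fun s w w = 1.
Proof.
by rewrite /orbit_fun subrr asboolT ?coset_fun_id //; exact: (subgroup0 subA).
Qed.

Lemma orbit_fun_id_neq0 s w : orbit_fun s w w <> 0.
Proof. by rewrite orbit_fun_id; exact/eqP/oner_neq0. Qed.

Lemma orbit_fun_neq0 s w : orbit_fun s w <> (fun=> 0).
Proof. by move=> e0; apply: (@orbit_fun_id_neq0 s w); rewrite e0. Qed.

Lemma orbit_fun_quasi_periodic s w : quasi_periodic (orbit_fun s w).
Proof.
move=> a v Aa; rewrite /orbit_fun -[a + v - w]addrA.
rewrite (asbool_equiv_eq (subgroupDr (v - w) subA Aa)).
case: asboolP => _; first exact: coset_fun_quasi_periodic.
rewrite opprD coset_fun_quasi_periodic; last exact: (subgroupN subA).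
by rewrite mulrCA (formNl bP) (formNr bP) opprK.
Qed.

Lemma orbit_fun_supp s w : supp (orbit_fun s w) `<=` sign_eqmod A ^~ w.
Proof.
move=> v; rewrite /supp /= /orbit_fun; case: asboolP => [|_]; first by left.
rewrite /coset_fun; case: asboolP => [vw _|]; last by rewrite mulr0.
by right; apply/(subgroupNE _ subA); rewrite opprD.
Qed.

Lemma orbit_fun_parity s w : (s -> ~ A w) -> has_parity s (orbit_fun s w).
Proof.
move=> sw v; rewrite /orbit_fun opprK.
case: asboolP => ANvw; case: asboolP => Avw //; last 2 first.
- by rewrite signrMK.
- by rewrite /coset_fun !asboolF // !mulr0.
have Aw : A w.
  apply: (omodule_half omodA); apply/(subgroupNE (w + w) subA).
  by have := subgroupD subA ANvw Avw; rewrite addrACA addNr add0r opprD.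
have Av : A v by apply/(subgroup_congr subA Avw).
have /negbTE-> : ~~ s by apply/negP => /sw.
by rewrite expr0 mul1r !coset_fun_in_A //; exact: (subgroupN subA).
Qed.

Lemma orbit_fun_val s f w v : quasi_periodic f -> has_parity s f ->
  sign_eqmod A v w -> f v = f w * orbit_fun s w v.
Proof.
move=> qf pf vw; rewrite /orbit_fun /coset_fun.
case: asboolP => [Avw|nAvw].
  by rewrite [LHS](quasi_periodic_val qf Avw) mulrC.
have ANvw : A (- v - w).
  by case: vw => // /(subgroupN subA); rewrite opprD.
by rewrite asboolT // mulrCA [f w * _]mulrC -quasi_periodic_val // -pf opprK.
Qed.

Lemma orbit_fun_uniq s f w : quasi_periodic f -> has_parity s f ->
  supp f `<=` sign_eqmod A ^~ w -> f = (fun v => f w * orbit_fun s w v).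
Proof.
move=> qf pf fw; apply/funext => v.
have [vw|nvw] := pselect (sign_eqmod A v w); first exact: orbit_fun_val.
by rewrite (eq0_notin_supp fw nvw) (eq0_notin_supp (@orbit_fun_supp s
  w) nvw) mulr0.
Qed.

Lemma orbit_expansion (I : finType) (D : set W) (t : I -> W) s f :
  half_transversal D A t ->
  quasi_periodic f -> has_parity s f -> supp f `<=` D ->
  f = (fun v => \sum_i f (t i) * orbit_fun s (t i) v).
Proof.
move=> [_ injt surjt] qf pf fD; apply/funext => v.
have off i : ~ sign_eqmod A v (t i) -> f (t i) * orbit_fun s (t i) v = 0.
  by move=> nvi; rewrite (eq0_notin_supp (@orbit_fun_supp s _) nvi) mulr0.
have [Dv|nDv] := pselect (D v); last first.
  rewrite (eq0_notin_supp fD nDv) big1 // => i _.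
  have [vi|/off//] := pselect (sign_eqmod A v (t i)).
  by rewrite -orbit_fun_val // (eq0_notin_supp fD nDv).
have [i vi] := surjt v Dv.
rewrite (bigD1 i) //= -orbit_fun_val // big1 ?addr0 // => j ji;
  apply: off => vj.
by case/eqP: ji; apply/injt/(sign_eqmod_trans subA _ vi)/(sign_eqmod_sym subA).
Qed.

Lemma hnorm2_finite f (D : set W) n : has_index D A n -> supp f `<=` D ->
  (hnorm2 A f < +oo)%E.
Proof.
move=> indexD fD; rewrite /hnorm2.
rewrite (esumID D); last by move=> i _; rewrite lee_fin sqr_ge0.
rewrite [X in (_ + X)%E]esum1 ?adde0; last first.
  by move=> w [_ nDw]; rewrite (eq0_notin_supp fD nDw) normr0 expr0n.
have fin := coset_reps_finite setT subA indexD.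
rewrite esum_fset //; last by move=> i _; rewrite lee_fin sqr_ge0.
by rewrite fsbig_finite // sumEFin ltry.
Qed.

Definition restrict (D : set W) f : W -> R[i] :=
  fun w => if `[< D w >] then f w else 0.

Lemma restrict_in (D : set W) f w : D w -> restrict D f w = f w.
Proof. by move=> Dw; rewrite /restrict asboolT. Qed.

Lemma restrict_supp (D : set W) f : supp (restrict D f) `<=` D.
Proof. by move=> w; rewrite /supp /= /restrict; case: asboolP. Qed.

Lemma restrict_id (D : set W) f : supp f `<=` D -> restrict D f = f.
Proof.
move=> fD; apply/funext => w; rewrite /restrict.
by case: asboolP => // nDw; rewrite (eq0_notin_supp fD).
Qed.

Local Notation Mop := (Mop psi beta A).

Definition Mop_term g f w a : R[i] :=
  psi (2^-1 * beta a w) * f ((g^-1)%VF (a + w)).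

Lemma Mop_term_l0 g f a : Mop_term g f 0 a = f ((g^-1)%VF a).
Proof. by rewrite /Mop_term (form0r bP) mulr0 (psi0 psi_cond) mul1r addr0. Qed.

Lemma Mop_term_r0 g f w : Mop_term g f w 0 = f ((g^-1)%VF w).
Proof. by rewrite /Mop_term (form0l bP) mulr0 (psi0 psi_cond) mul1r add0r. Qed.

Section Operator.
Variable g : 'End(W).
Hypothesis gK : KB g.

Let gP : isometry_group beta g. Proof. exact: stabilizer_isometry gK. Qed.
Let Ag : set W := A `&` [set g a | a in A].
Local Notation reps := (coset_reps A Ag).

Let AgP a : Ag a <-> A a /\ A ((g^-1)%VF a).
Proof.
split=> -[Aa].
  by case=> b Ab bE; split=> //; rewrite -bE (isometryK bP gP).
by split=> //; exists ((g^-1)%VF a) => //; exact: (isometryVK bP gP).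
Qed.

Let subAg : subgroup Ag.
Proof.
split; first by apply/AgP; rewrite linear0; split; exact: (subgroup0 subA).
by move=> u v /AgP[Au Agu] /AgP[Av Agv]; apply/AgP; rewrite linearB;
  split; exact: (subgroupB subA).
Qed.

Let sAgA : Ag `<=` A. Proof. by move=> a []. Qed.

Let reps_A a : reps a -> A a.
Proof. exact: (coset_reps_sub subA subAg sAgA). Qed.

Let reps_finite : finite_set reps.
Proof.
have [n [I [s [[_ _ surjs] _]]]] := lattice_has_index latA omodB
  (lattice_open latB).
have [w Aw|m indexAg] := has_index_cover (s := s) (D := A) subAg.
  have [i Bi] := surjs w Aw; exists i; apply/AgP.
  by split; apply: sBA => //; apply/(stabilizer_B _ (stabilizerV bP gK)).
have := coset_reps_finite A subAg indexAg.
by rewrite setIidl // => a; exact: reps_A.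
Qed.

Let card_reps_neq0 : (lattice_index A Ag)%:R != 0 :> R[i].
Proof.
rewrite pnatr_eq0 cardfs_eq0; apply/negP => /eqP reps0.
have : coset_rep Ag 0 \in fset_set reps.
  by rewrite in_fset_set // inE; exists 0 => //; exact: (subgroup0 subA).
by rewrite reps0 inE.
Qed.

Lemma Mop_term_eqmod f w a b : quasi_periodic f -> A a -> A b ->
  A ((g^-1)%VF (b - a)) -> Mop_term g f w b = Mop_term g f w a.
Proof.
move=> qf Aa Ab Agab; rewrite /Mop_term.
have -> : (g^-1)%VF (b + w) = (g^-1)%VF (b - a) + (g^-1)%VF (a + w).
  by rewrite -linearD addrA subrK.
rewrite qf // mulrA -(psiD psi_char) -mulrDr (isometryV bP gP); congr (_ * _).
apply: psi_half_eqmod.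
rewrite !(formDl bP, formDr bP, formNr bP) (form_self bP) (formC bP w b)
  (formC bP w a).
have -> : beta b w + (beta a b - 0 + (- beta b w - - beta a w)) - beta a w =
  beta a b by ring.
exact: form_A.
Qed.

Lemma Mop_term_eqmod_Ag f w a b : quasi_periodic f -> A a -> A b ->
  Ag (b - a) -> Mop_term g f w b = Mop_term g f w a.
Proof. by move=> qf Aa Ab /AgP[_]; exact: Mop_term_eqmod. Qed.

Lemma Mop_reindex (e e' : W -> W) (F : W -> R[i]) :
  (forall a, A a -> A (e a)) -> (forall a, A a -> A (e' a)) -> cancel e' e ->
  (forall a b, Ag (e a - e b) <-> Ag (a - b)) ->
  (forall a b, A a -> A b -> Ag (b - a) -> F b = F a) ->
  \sum_(a \in reps) F a = \sum_(a \in reps) F (e a).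
Proof.
move=> eA e'A eK eAg F_Ag; apply: (sum_coset_reps_reindex subA subAg)
  eK eAg _ => //.
by move=> a b Aa Ab ab; exact: F_Ag.
Qed.

Lemma MopE f w : Mop g f w =
  (lattice_index A Ag)%:R^-1 * \sum_(a \in reps) Mop_term g f w a.
Proof. by []. Qed.

Lemma Mop_quasi_periodic f : quasi_periodic f -> quasi_periodic (Mop g f).
Proof.
move=> qf a0 w Aa0; rewrite !MopE mulrCA; congr (_ * _); rewrite mulr_fsumr.
pose F a := psi (2^-1 * beta w a0) * Mop_term g f w a.
rewrite (Mop_reindex (e := +%R a0) (e' := +%R (- a0)) (F := F)).
- apply: eq_fsbigr => a; rewrite inE => /reps_A Aa.
  rewrite /F /Mop_term mulrA -(psiD psi_char) -mulrDr addrA [a + a0]addrC.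
  congr (_ * _); apply: psi_half_eqmod.
  rewrite (formDr bP) (formDl bP) (formC bP w a0).
  have -> : beta a a0 + beta a w - (- beta a0 w + (beta a0 w + beta a w)) =
    beta a a0 by ring.
  exact: form_A.
- by move=> a; exact: (subgroupD subA).
- by move=> a; apply: (subgroupD subA); exact: (subgroupN subA).
- exact: addNKr.
- by move=> a b; rewrite opprD addrACA subrr add0r.
- by move=> a b Aa Ab ab; congr (_ * _); exact: Mop_term_eqmod_Ag.
Qed.

Lemma Mop_parity s f : quasi_periodic f -> has_parity s f ->
  has_parity s (Mop g f).
Proof.
move=> qf pf w; rewrite !MopE mulrCA; congr (_ * _); rewrite mulr_fsumr.
pose F a := (-1) ^+ s * Mop_term g f w a.
rewrite [RHS](Mop_reindex (e := -%R) (e' := -%R) (F := F)).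
- apply: eq_fsbigr => a _; rewrite /F /Mop_term (formNr bP)
    (formNl bP) mulrCA -pf.
  by rewrite -linearN opprD opprK.
- by move=> a; exact: (subgroupN subA).
- by move=> a; exact: (subgroupN subA).
- exact: opprK.
- by move=> a b; rewrite -opprD subgroupNE.
- by move=> a b Aa Ab ab; congr (_ * _); exact: Mop_term_eqmod_Ag.
Qed.

Lemma Mop_const f w z : (forall a, A a -> Mop_term g f w a = z) ->
  Mop g f w = z.
Proof.
move=> fz; rewrite MopE (eq_fsbigr (fun=> z)) => [|a]; last first.
  by rewrite inE => /reps_A/fz.
rewrite (fsbig_finite _ _ reps_finite) /= big_const_seq count_predT iter_addr_0.
by rewrite -[z *+ _]mulr_natl mulKf ?card_reps_neq0.
Qed.

Lemma Mop_neq0 f w a : quasi_periodic f -> A a -> Mop_term g f w a <> 0 ->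
  (forall b, A b -> Mop_term g f w b <> 0 ->
     Mop_term g f w b = Mop_term g f w a) ->
  Mop g f w <> 0.
Proof.
move=> qf Aa; set z := Mop_term g f w a => z0 only_z.
have termE b : A b -> Mop_term g f w b = z * (Mop_term g f w b != 0)%:R.
  move=> Ab; case: eqP => [->|nb] /=; first by rewrite mulr0.
  by rewrite mulr1; exact: only_z.
rewrite MopE (eq_fsbigr (fun b => z * (Mop_term g f w b != 0)%:R)) => [|b];
  last first.
  by rewrite inE => /reps_A/termE.
rewrite -mulr_fsumr (fsbig_finite _ _ reps_finite) /=; apply/eqP.
rewrite mulf_neq0 ?invr_eq0 ?card_reps_neq0 //; apply: mulf_neq0;
  first exact/eqP.
rewrite -natr_sum pnatr_eq0 -lt0n.
have reps_a : reps (coset_rep Ag a) by exists a.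
rewrite (big_rem (coset_rep Ag a)) ?in_fset_set ?inE //=.
rewrite (Mop_term_eqmod_Ag w qf Aa (reps_A reps_a)); last exact: coset_repP.
by rewrite (introN eqP z0).
Qed.

Lemma Mop_stabilizer_A f w : quasi_periodic f -> stabilizer beta A g ->
  Mop g f w = f ((g^-1)%VF w).
Proof.
move=> qf gA; apply: Mop_const => a Aa.
rewrite (@Mop_term_eqmod f w 0 a) //.
- exact: Mop_term_r0.
- exact: (subgroup0 subA).
- by rewrite subr0; have /(stabilizerP bP)[_ ->] := stabilizerV bP gA.
Qed.

Lemma Mop_restrict k f :
  Mop g (restrict (layer k) f) = restrict (layer k) (Mop g f).
Proof.
apply/funext => w; rewrite {2}/restrict !MopE.
have layer_term a : a \in reps -> layer k ((g^-1)%VF (a + w)) <-> layer k w.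
  rewrite inE => /reps_A Aa; rewrite (stabilizer_layer _ _ (stabilizerV bP gK)).
  exact: layerDA.
pose F a := if `[< layer k w >] then Mop_term g f w a else 0.
rewrite (eq_fsbigr F) /F => [|a].
  by case: asboolP => // _; rewrite fsbig1 // mulr0.
move=> /layer_term a_layer; rewrite /Mop_term /restrict
  (asbool_equiv_eq a_layer).
by case: asboolP; rewrite ?mulr0.
Qed.

Lemma Mop_supp_layer f k : supp f `<=` layer k -> supp (Mop g f) `<=` layer k.
Proof.
by move=> /restrict_id <-; rewrite Mop_restrict; exact: restrict_supp.
Qed.

End Operator.

Lemma Mop_opp f : quasi_periodic f ->
  Mop (- \1)%VF f = (fun w => f (- w)).
Proof.
move=> qf; apply/funext => w; rewrite Mop_stabilizer_A //; last 2 first.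
- exact: (opp_stabilizer bP subB).
- exact: (opp_stabilizer bP subA).
congr f; have oP := opp_isometry bP; apply: (can_inj (isometryK bP oP)).
by rewrite (isometryVK bP oP) !lfunE /= !lfunE /= opprK.
Qed.

(** * Subspaces stable under the stabilizer of [B] *)

Section DiagonalTransvection.
Variables (k : nat) (c : K) (u : W).
Hypothesis cu : diag_param k c u.
Let t := transvection beta c u.

Lemma diag_transvection_A : stabilizer beta A t.
Proof.
have [Au cP] := cu; apply: selfdual_stabilizer => [|a Aa].
  exact: transvection_isometry.
rewrite /t (transvectionE bP); apply: (subgroupD subA) => //.
apply: (omoduleZ omodA) => //; apply: powideal_le (powidealM cP (form_A Au Aa));
  lia.
Qed.

Lemma diag_transvection_B : KB t.
Proof.
have [Au cP] := cu; have Bsu := sABs Au.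
apply: (reflexive_stabilizer bP reflexiveB) => [|v Bv|v Bsv].
- exact: transvection_isometry.
- rewrite /t (transvectionE bP); apply: (subgroupD subB) => //.
  apply: powideal1_Bs => //; apply: powideal_le (powidealM cP (Bsu _ Bv)); lia.
- rewrite /t (transvectionE bP); apply: (subgroupD subBs) => //.
  apply: (omoduleZ omodBs) => //.
  apply: powideal_le (powidealM cP (form_Bs Bsu Bsv)); lia.
Qed.

Lemma Mop_diag_at f v : quasi_periodic f -> expansion k.+1 A v ->
  Mop t f v = transvection_char c u v * f v.
Proof.
move=> qf Av; have [Au cP] := cu.
rewrite (Mop_stabilizer_A diag_transvection_B) //;
  last exact: diag_transvection_A.
have Acu : A (- ((c * beta u v) *: u)).
  apply: (subgroupN subA); apply: (omoduleZ omodA) => //.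
  rewrite (formC bP); have /powidealN/(powidealM cP) :=
    proj1 (expansion_pairing _ _) Av _ Au.
  by apply: powideal_le; lia.
rewrite /t (transvectionV bP) // addrC qf //; congr (psi (_ * _) * _).
by rewrite (formNr bP) (formZr bP) (formC bP v u); ring.
Qed.

Lemma Mop_diag f : quasi_periodic f -> supp f `<=` expansion k.+1 A ->
  Mop t f = (fun v => transvection_char c u v * f v).
Proof.
move=> qf fA; apply/funext => v.
have [Av|nAv] := pselect (expansion k.+1 A v); first exact: Mop_diag_at.
rewrite (eq0_notin_supp fA nAv) mulr0.
rewrite (Mop_stabilizer_A diag_transvection_B) //;
  last exact: diag_transvection_A.
apply: (eq0_notin_supp fA) => /expansionE; rewrite -linearZ.
by have /(stabilizerP bP)[_ ->] := stabilizerV bP diag_transvection_A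
  => /expansionE.
Qed.

End DiagonalTransvection.

Lemma separating_diag v w : ~ sign_eqmod A v w ->
  exists k c u, [/\ expansion k.+1 A v, expansion k.+1 A w, diag_param k c u &
    transvection_char c u v != transvection_char c u w].
Proof.
move=> nvw; pose P k := `[< expansion k A v /\ expansion k A w >].
have exP : exists k, P k.
  have [i vi] := lattice_absorbing v latA.
  have [j wj] := lattice_absorbing w latA.
  exists (maxn i j); apply/asboolP; split.
    by apply: expansion_leq vi => //; exact: leq_maxl.
  by apply: expansion_leq wj => //; exact: leq_maxr.
case: (ex_minnP exP) => -[|k] /asboolP[Av Aw] minP.
  by case: nvw; left; rewrite expansion0 in Av Aw; exact: (subgroupB subA).
have nAvw : ~ (expansion k A v /\ expansion k A w).
  by move=> Avw; have := minP k (asboolT Avw); rewrite ltnn.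
by have [c [u [cu ne]]] := separating_transvection nAvw nvw; exists k, c, u.
Qed.

Lemma eigenvector_supp h w : quasi_periodic h ->
  (forall k c u, diag_param k c u -> expansion k.+1 A w ->
     Mop (transvection beta c u) h =
       (fun x => transvection_char c u w * h x)) ->
  supp h `<=` sign_eqmod A ^~ w.
Proof.
move=> qh eig v /eqP hv; apply: contrapT.
move=> /separating_diag[k [c [u [Av Aw cu]]]];
  have /(congr1 (@^~ v)) := eig k c u cu Aw.
by rewrite (Mop_diag_at cu qh Av) => /(mulIf hv)->; rewrite eqxx.
Qed.

Lemma orbit_fun_expansion k s w :
  expansion k A w -> supp (orbit_fun s w) `<=` expansion k A.
Proof.
by move=> Aw v /orbit_fun_supp vw; exact: expansion_sign_eqmod vw Aw.
Qed.

Lemma orbit_fun_layer k s w : layer k w -> supp (orbit_fun s w) `<=` layer k.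
Proof. by move=> lw v /orbit_fun_supp vw; exact: layer_sign_eqmod vw lw. Qed.

Lemma Mop_diag_orbit_fun k c u s w : (s -> ~ A w) -> diag_param k c u ->
  expansion k.+1 A w ->
  Mop (transvection beta c u) (orbit_fun s w) =
  (fun x => transvection_char c u w * orbit_fun s w x).
Proof.
move=> sw cu Aw; have qw := orbit_fun_quasi_periodic s w.
have tB := diag_transvection_B cu.
rewrite [LHS](orbit_fun_uniq (s := s) (w := w)).
- by rewrite (Mop_diag_at cu qw Aw) orbit_fun_id mulr1.
- exact: Mop_quasi_periodic.
- exact/Mop_parity/orbit_fun_parity.
- rewrite (Mop_diag cu qw); last exact: orbit_fun_expansion.
  by apply: subset_trans (@orbit_fun_supp s w) => x; apply: contra_not => /= ->;
    rewrite mulr0.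
Qed.

Lemma subspaceZ (E : set (W -> R[i])) (z : R[i]) f :
  linear_subspace E -> E f -> E (fun w => z * f w).
Proof.
move=> [E0 ED] Ef; have := ED z f _ Ef E0.
by congr E; apply/funext => w; rewrite addr0.
Qed.

Lemma subspace_sum (E : set (W -> R[i])) (I : finType) (z : I -> R[i])
    (b : I -> W -> R[i]) : linear_subspace E ->
  (forall i, E (b i)) -> E (fun w => \sum_i z i * b i w).
Proof.
move=> [E0 ED] Eb; elim: (index_enum I) => [|i r IHr].
  by move: E0; congr E; apply/funext => w; rewrite big_nil.
have := ED (z i) _ _ (Eb i) IHr.
by congr E; apply/funext => w; rewrite big_cons.
Qed.

Section StableSubspace.
Variable E : set (W -> R[i]).
Hypothesis linE : linear_subspace E.
Hypothesis invE : invariant_under KB Mop E.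

Definition bounded_vector s k f : Prop :=
  [/\ E f, quasi_periodic f, has_parity s f & supp f `<=` expansion k A].

(* Apply a transvection minus its eigenvalue at [v]. *)
Lemma exists_vanishing_at k s f v w : bounded_vector s k.+1 f -> f w <> 0 ->
  ~ (expansion k A v /\ expansion k A w) -> ~ sign_eqmod A v w ->
  exists f', [/\ bounded_vector s k.+1 f', f' w <> 0,
    f' v = 0 & supp f' `<=` supp f].
Proof.
move=> [Ef qf pf fA] fw nAvw nvw; have [E0 ED] := linE.
have [c [u [cu ne]]] := separating_transvection nAvw nvw.
have tB := diag_transvection_B cu; have fE := Mop_diag cu qf fA.
pose f' x := - transvection_char c u v * f x + transvection_char c u x * f x.
have f'E : f' = fun x => - transvection_char c u v * f x +
    Mop (transvection beta c u) f x by rewrite fE.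
have sf' : supp f' `<=` supp f.
  by move=> x; apply: contra_not => fx; rewrite /f' fx !mulr0 addr0.
exists f'; split=> //.
- split; last exact: subset_trans fA.
  + by rewrite f'E; apply: ED => //; exact: invE.
  + by rewrite f'E; apply: quasi_periodicD => //; exact: Mop_quasi_periodic.
  + by rewrite f'E; apply: has_parityD => //; exact: Mop_parity.
- apply/eqP; rewrite /f' -mulrDl mulf_neq0 //; last exact/eqP.
  by rewrite addrC subr_eq0 eq_sym.
- by rewrite /f' mulNr addNr.
Qed.

Lemma exists_vanishing_on_seq k s f w (vs : seq W) :
  bounded_vector s k.+1 f -> f w <> 0 ->
  (forall v, v \in vs ->
     ~ (expansion k A v /\ expansion k A w) /\ ~ sign_eqmod A v w) ->
  exists f', [/\ bounded_vector s k.+1 f', f' w <> 0 &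
    forall v, v \in vs -> f' v = 0].
Proof.
move=> bf fw; elim: vs => [_|v vs IHvs vsP]; first by exists f.
have [|f1 [bf1 f1w f1vs]] := IHvs.
  by move=> x xvs; apply: vsP; rewrite inE xvs orbT.
have [nAvw nvw] := vsP v (mem_head _ _).
have [f2 [bf2 f2w f2v sf2]] := exists_vanishing_at bf1 f1w nAvw nvw.
exists f2; split=> // x; rewrite inE => /orP[/eqP->//|/f1vs f1x].
by apply: contrapT => /sf2.
Qed.

Lemma exists_concentrated k s f w : bounded_vector s k.+1 f -> f w <> 0 ->
  exists f', [/\ bounded_vector s k.+1 f', f' w <> 0 &
    forall x, f' x <> 0 ->
      sign_eqmod A x w \/ expansion k A x /\ expansion k A w].
Proof.
move=> bf fw; have [I [t [[_ _ surjt] _]]] :=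
  has_index_expansion_lattice k.+1 latA.
pose far v := ~ (expansion k A v /\ expansion k A w) /\ ~ sign_eqmod A v w.
pose vs := [seq t i | i <- enum I & `[< far (t i) >]].
have [|f' [bf' f'w f'0]] := exists_vanishing_on_seq (vs := vs) bf fw.
  by move=> v /mapP[j]; rewrite mem_filter => /andP[/asboolP far_j _] ->.
exists f'; split=> // x f'x; have [_ qf' _ f'A] := bf'.
have [i Ai] := surjt x (f'A x f'x).
have near_i : ~ far (t i).
  move=> far_i; apply: (quasi_periodic_neq0 qf' (subgroupBC subA Ai) f'x);
    apply: f'0.
  by apply: map_f; rewrite mem_filter mem_enum andbT; apply/asboolP.
have xi : sign_eqmod A x (t i) by left.
have [[Ati Aw]|nAiw] := pselect (expansion k A (t i) /\ expansion k A w).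
  by right; split=> //; exact: expansion_sign_eqmod xi Ati.
left; apply: contrapT => nxw; apply: near_i; split=> // iw; apply: nxw.
exact: sign_eqmod_trans xi iw.
Qed.

Lemma orbit_fun_in_scaled s f w : E f -> quasi_periodic f -> has_parity s f ->
  supp f `<=` sign_eqmod A ^~ w -> f w <> 0 -> E (orbit_fun s w).
Proof.
move=> Ef qf pf f_orbit /eqP fw; have := subspaceZ (f w)^-1 linE Ef; congr E.
apply/funext => v; have /(congr1 (@^~ v)) /= -> := orbit_fun_uniq qf pf f_orbit.
by rewrite mulKf.
Qed.

Lemma orbit_fun_in_bounded k s f w :
  bounded_vector s k f -> f w <> 0 -> E (orbit_fun s w).
Proof.
elim: k f => [|k IHk] f bf fw.
  have [Ef qf pf fA] := bf; rewrite expansion0 in fA.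
  apply: (orbit_fun_in_scaled Ef) => // v fv.
  by left; apply: (subgroupB subA); exact: fA.
have [f' [bf' f'w f'P]] := exists_concentrated bf fw;
  have [Ef' qf' pf' _] := bf'.
have [Aw|nAw] := pselect (expansion k A w); last first.
  by apply: (orbit_fun_in_scaled Ef') => // v /f'P[//|[_ /nAw]].
apply: (IHk f') => //; split=> // v /f'P[vw|[]//].
exact: expansion_sign_eqmod vw Aw.
Qed.

Lemma orbit_fun_in k s f w : E f -> quasi_periodic f -> has_parity s f ->
  supp f `<=` layer k -> f w <> 0 -> E (orbit_fun s w).
Proof.
move=> Ef qf pf fk; apply: (@orbit_fun_in_bounded k.+1); split=> //.
exact: subset_trans fk (@layer_expansion k).
Qed.

Lemma orbit_fun_spread g k s w w' : KB g -> layer k w -> (s -> ~ A w) ->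
  E (orbit_fun s w) -> Mop g (orbit_fun s w) w' <> 0 -> E (orbit_fun s w').
Proof.
move=> gK lw sw Ew; have qw := orbit_fun_quasi_periodic s w.
apply: (orbit_fun_in (k := k)); first exact: invE.
- exact: Mop_quasi_periodic.
- exact/Mop_parity/orbit_fun_parity.
- exact/Mop_supp_layer/orbit_fun_layer.
Qed.

Lemma orbit_fun_eqmod k s v w : layer k w -> (s -> ~ A w) -> A (v - w) ->
  E (orbit_fun s w) -> E (orbit_fun s v).
Proof.
move=> lw sw vw Ew; have qw := orbit_fun_quasi_periodic s w.
apply: (orbit_fun_in (k := k) Ew) => //.
- exact: orbit_fun_parity.
- exact: orbit_fun_layer.
- exact: quasi_periodic_neq0 qw vw (@orbit_fun_id_neq0 s w).
Qed.

(* The condition on [w] excludes [A (g^-1 b + w + w)] with [A b], except when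
   [A (g^-1 b)] also holds: the terms of [Mop g] at [g w] are equal or zero. *)
Lemma orbit_fun_transport g k s w : KB g -> layer k w -> (s -> ~ A w) ->
  (A w \/ ~ Bs w) -> E (orbit_fun s w) -> E (orbit_fun s (g w)).
Proof.
move=> gK lw sw AnBs Ew; apply: (orbit_fun_spread gK lw sw Ew).
have gP := stabilizer_isometry gK; have qw := orbit_fun_quasi_periodic s w.
apply: (Mop_neq0 gK qw (subgroup0 subA)).
  by rewrite Mop_term_r0 (isometryK bP gP); exact: orbit_fun_id_neq0.
move=> b Ab term_b; apply: (Mop_term_eqmod gK) => //;
  first exact: (subgroup0 subA).
have : supp (orbit_fun s w) ((g^-1)%VF b + w).
  by move=> eb; apply: term_b; rewrite /Mop_term linearD /=
    (isometryK bP gP) eb mulr0.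
rewrite subr0 => /orbit_fun_supp[|]; first by rewrite addrK.
rewrite -addrA; case: AnBs => [Aw|nBsw] bww.
  by apply/(subgroupDr _ subA (subgroupD subA Aw Aw)); rewrite addrC.
have Bsb : Bs ((g^-1)%VF b) by apply/(stabilizer_Bs _ (stabilizerV bP gK));
  exact: sABs.
by case: nBsw; apply: (omodule_half omodBs); apply/(subgroupDr _ subBs Bsb);
  exact: sABs.
Qed.

Lemma orbit_fun_even_to0 w :
  Bs w -> E (orbit_fun false w) -> E (orbit_fun false 0).
Proof.
move=> Bsw Ew; have l0w : layer 0 w by rewrite layer0.
have qw := orbit_fun_quasi_periodic false w.
have pw : has_parity false (orbit_fun false w) by exact: orbit_fun_parity.
have [Aw|nAw] := pselect (A w).
  by apply: (orbit_fun_eqmod l0w _ _ Ew) => //; rewrite sub0r;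
    exact: (subgroupN subA).
have [a Aa wa] := notinA nAw.
have [||g gK gw] := transitive_Bs Bsw _ (sABs Aa) _.
- by move/sBA.
- by move=> Ba; apply: wa; exact: Bsw.
have gP := stabilizer_isometry gK.
have ga : (g^-1)%VF a = w by rewrite -gw (isometryK bP gP).
apply: (orbit_fun_spread gK l0w) => //; apply: (Mop_neq0 gK qw Aa).
  by rewrite Mop_term_l0 ga; exact: orbit_fun_id_neq0.
move=> b Ab; rewrite {1}Mop_term_l0 => /orbit_fun_supp[bw|bw].
  by apply: (Mop_term_eqmod gK) => //; rewrite linearB /= ga.
transitivity (Mop_term g (orbit_fun false w) 0 (- a)).
  apply: (Mop_term_eqmod gK) => //; first exact: (subgroupN subA).
  by rewrite opprK linearD /= ga.
by rewrite !Mop_term_l0 linearN /= pw expr0 mul1r.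
Qed.

Lemma orbit_fun_even_from0 w :
  Bs w -> E (orbit_fun false 0) -> E (orbit_fun false w).
Proof.
move=> Bsw E0; have l0 : layer 0 0 by rewrite layer0; exact: (subgroup0 subBs).
have from0A a : A a -> E (orbit_fun false a).
  by move=> Aa; apply: (orbit_fun_eqmod l0) => //; rewrite subr0.
have [Aw|nAw] := pselect (A w); first exact: from0A.
have [a Aa wa] := notinA nAw.
have [||g gK <-] := transitive_Bs (sABs Aa) _ Bsw _.
- by move=> Ba; apply: wa; exact: Bsw.
- by move/sBA.
apply: (orbit_fun_transport (k := 0) gK) => //; [|by left|exact: from0A].
by rewrite layer0; exact: sABs.
Qed.

Lemma orbit_fun_transitive k s w w' : layer k w -> layer k w' ->
  (s -> ~ A w) -> (s -> ~ A w') -> E (orbit_fun s w) -> E (orbit_fun s w').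
Proof.
move=> lw lw' sw sw' Ew; case: k lw lw' => [|k] lw lw'; last first.
  have [g gK <-] := transitive_layer lw lw'.
  apply: (orbit_fun_transport gK lw) => //; right; exact: layerS_notin_Bs lw.
move: (lw) (lw'); rewrite layer0 => Bsw Bsw'.
case: s sw sw' Ew => sw sw' Ew; last first.
  by apply: orbit_fun_even_from0 => //; exact: orbit_fun_even_to0 Ew.
have [g gK [gA gw]] := transitive_Bs_stabilizing_A Bsw (sw isT) Bsw' (sw' isT).
apply: (orbit_fun_spread gK lw) => //; have gP := stabilizer_isometry gK.
rewrite (Mop_stabilizer_A gK w' (orbit_fun_quasi_periodic true w) gA).
by rewrite -gw (isometryK bP gP); exact: orbit_fun_id_neq0.
Qed.

End StableSubspace.

(** * The spaces of functions of given parity supported in a layer *)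

Local Notation Esub := (Esub psi beta A lam B).
Local Notation Esub1 := (Esub1 psi beta A lam B).
Local Notation Epiece := (Epiece psi beta A lam B).

Definition layer_space k s : set (W -> R[i]) :=
  parity_part s (supported_in psi beta A (layer k)).

Lemma EsubE n : Esub n = supported_in psi beta A (layer n.*2).
Proof.
case: n => [|n]; first by rewrite layer0.
by rewrite /= dilation_setD ?unifXV_neq0 // doubleS /layer -doubleS
  filt_even filt_odd.
Qed.

Lemma Esub1E n : Esub1 n = supported_in psi beta A (layer n.*2.+1).
Proof. by rewrite /layer filt_odd filt_even. Qed.

Lemma filt_has_index k : exists n, has_index (filt k) A n.
Proof.
apply: has_index_subset subA (@filt_expansion k) _.
exact: has_index_expansion_lattice.
Qed.

Lemma layer_has_index k : exists n, has_index (layer k) A n.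
Proof.
by have [n] := filt_has_index k; apply: has_index_subset => //;
  exact: layer_filt.
Qed.

Lemma layer_spaceP k s f : layer_space k s f <->
  [/\ quasi_periodic f, has_parity s f & supp f `<=` layer k].
Proof.
split=> [[[[qf _] fk] pf]//|[qf pf fk]]; have [n nk] := layer_has_index k.
by do 2!split=> //; split=> //; exact: hnorm2_finite nk fk.
Qed.

Lemma orbit_fun_layer_space k s w :
  layer k w -> (s -> ~ A w) -> layer_space k s (orbit_fun s w).
Proof.
move=> lw sw; apply/layer_spaceP; split.
- exact: orbit_fun_quasi_periodic.
- exact: orbit_fun_parity.
- exact: orbit_fun_layer.
Qed.

Lemma layer_space_linear k s : linear_subspace (layer_space k s).
Proof.
split=> [|z f h /layer_spaceP[qf pf fk] /layer_spaceP[qh ph hk]];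
  apply/layer_spaceP; split.
- by move=> a w _; rewrite mulr0.
- by move=> w; rewrite mulr0.
- by move=> w; case.
- exact: quasi_periodicD.
- exact: has_parityD.
- exact: suppD.
Qed.

Lemma layer_space_sub k s : layer_space k s `<=` hilbert_space psi beta A.
Proof. by move=> f [[]]. Qed.

Lemma Esub0_nonzero : nonzero_space (Esub 0).
Proof.
have l0 : layer 0 0 by rewrite layer0; exact: (subgroup0 subBs).
rewrite EsubE; exists (orbit_fun false 0); last exact: orbit_fun_neq0.
by have [] := orbit_fun_layer_space (s := false) l0 _.
Qed.

(** * Dimensions *)

Definition parity_layer k s : set W := if s then layer k `\` A else layer k.

Lemma parity_layerP k s w : parity_layer k s w <-> layer k w /\ (s -> ~ A w).
Proof.
case: s; last by split=> [lw|[]].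
by split=> -[lw nAw]; split=> // ?; exact: nAw.
Qed.

Lemma layer_space_supp k s f : layer_space k s f ->
  supp f `<=` parity_layer k s.
Proof.
move=> /layer_spaceP[qf pf fk] w fw; apply/parity_layerP; split;
  first exact: fk.
by move=> s1 Aw; apply: fw; rewrite s1 in pf; exact: odd_vanishes.
Qed.

Lemma layerS_setDA k : layer k.+1 `\` A = layer k.+1.
Proof.
apply/seteqP; split=> w; first by case.
by move=> lw; split=> // /sABs; exact: layerS_notin_Bs lw.
Qed.

Lemma parity_layerS k s : parity_layer k.+1 s = layer k.+1.
Proof. by case: s => //; exact: layerS_setDA. Qed.

Lemma layer_setDA_half_index k n : has_index (layer k `\` A) A n ->
  exists2 m, has_half_index (layer k `\` A) A m & (m * 2)%N = n.
Proof.
apply: has_half_index_disjoint => //.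
- by move=> u; exact: omodule_half.
- by move=> u [lu nAu]; split; [rewrite layerN|rewrite subgroupNE].
- by move=> u [].
Qed.

Lemma layer0_setDA_half_index n : has_index Bs A n ->
  exists2 m, has_half_index (layer 0 `\` A) A m & (m * 2).+1 = n.
Proof.
rewrite -layer0 => BsA; have sA0 : A `<=` layer 0 by rewrite layer0.
have [|n_gt0] := has_index_setD subA sA0 _ BsA (has_index1 subA).
  by move=> u v uv Av; apply/(subgroup_congr subA uv).
by move=> /layer_setDA_half_index[m mA m2]; exists m;
  rewrite // m2 subn1 prednK.
Qed.

Lemma parity_layer_half_index k s :
  exists m, has_half_index (parity_layer k s) A m.
Proof.
case: k => [|k].
  have [n] := layer_has_index 0; rewrite layer0 =>
    /layer0_setDA_half_index[m mA _].
  case: s; first by exists m.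
  by exists m.+1; apply: has_half_index_adjoin => //;
    rewrite /parity_layer layer0.
have [n] := layer_has_index k.+1; rewrite -layerS_setDA =>
  /layer_setDA_half_index[m].
by rewrite layerS_setDA parity_layerS => mk _; exists m.
Qed.

Lemma has_dim_nonzero (E : set (W -> R[i])) (d : rat) :
  has_dim E d -> nonzero_space E <-> d != 0.
Proof.
move=> [n [-> [b [Eb b_basis]]]]; rewrite pnatr_eq0;
  case: n b Eb b_basis => [|n] b Eb b_basis.
  split=> // -[f /b_basis[c [fE _]] f0]; case: f0; rewrite fE.
  by apply/funext => w; rewrite big_ord0.
split=> // _; exists (b ord0) => // b0.
have [c [_ c_uniq]] := b_basis _ (Eb ord0).
have c0 : c = 0.
  by apply: c_uniq; rewrite b0; apply/funext => w; rewrite big1 // => i _;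
    rewrite mxE mul0r.
have cd : c = delta_mx 0 ord0.
  apply: c_uniq; apply/funext => w; rewrite (bigD1 ord0) //= mxE !eqxx mul1r.
  by rewrite big1 ?addr0 // => i i0; rewrite mxE (negbTE i0) andbF mul0r.
have /rowP/(_ ord0) : delta_mx 0 ord0 = 0 :> 'rV[R[i]]_n.+1 by rewrite -cd.
by rewrite !mxE !eqxx => /eqP; rewrite oner_eq0.
Qed.

Lemma layer_space_has_dim k s m :
  has_half_index (parity_layer k s) A m -> has_dim (layer_space k s) m%:R.
Proof.
move=> [I [t [tP <-]]]; exists #|I|; split=> //; have [kt injt _] := tP.
exists (fun i => orbit_fun s (t (enum_val i))); split=> [i|f kf].
  by have /parity_layerP[lt nAt] := kt (enum_val i);
    exact: orbit_fun_layer_space.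
have /layer_spaceP[qf pf _] := kf; have fk := layer_space_supp kf.
exists (\row_i f (t (enum_val i))); split=> [|c cE].
  rewrite {1}(orbit_expansion tP qf pf fk); apply/funext => w.
  rewrite (reindex (fun i : 'I_#|I| => enum_val i)) /=; last first.
    exact: onW_bij (enum_val_bij I).
  by apply: eq_bigr => i _; rewrite mxE.
apply/rowP => i; rewrite mxE cE (bigD1 i) //= orbit_fun_id mulr1.
rewrite big1 ?addr0 // => j ji.
rewrite (eq0_notin_supp (@orbit_fun_supp s _)) ?mulr0 //.
by move=> /injt/enum_val_inj ij; rewrite ij eqxx in ji.
Qed.

Lemma layerS_has_dim k s n :
  has_index (layer k.+1) A n -> has_dim (layer_space k.+1 s) (1 / 2 * n%:R).
Proof.
rewrite -layerS_setDA => /layer_setDA_half_index[m];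
  rewrite layerS_setDA => mk <-.
rewrite natrM mulrCA mul1r mulVf // mulr1.
by apply: layer_space_has_dim; rewrite parity_layerS.
Qed.

Lemma layer0_odd_has_dim n :
  has_index Bs A n -> has_dim (layer_space 0 true) (1 / 2 * (n%:R - 1)).
Proof.
move=> /layer0_setDA_half_index[m mA <-].
rewrite -[(m * 2).+1%:R]natr1 addrK natrM mulrCA mul1r mulVf // mulr1.
exact: layer_space_has_dim.
Qed.

Lemma layer0_even_has_dim n :
  has_index Bs A n -> has_dim (layer_space 0 false) (1 + 1 / 2 * (n%:R - 1)).
Proof.
move=> /layer0_setDA_half_index[m mA <-].
rewrite -[(m * 2).+1%:R]natr1 addrK natrM [1 / 2 * _]mulrCA mul1r mulVf //
  mulr1 addrC natr1.
by apply/layer_space_has_dim/has_half_index_adjoin => //;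
  rewrite /parity_layer layer0.
Qed.

Section LayerIndices.
Variables (r l : nat).
Hypothesis dimW : \dim {:W} = (2 * r)%N.
Local Notation q := #|residue K|.
Hypotheses (BsA_index : has_index Bs A (q ^ l))
  (AB_index : has_index A B (q ^ l)).
Let qQ : rat := q%:R.

Let qQ_neq0 : qQ != 0.
Proof. by rewrite pnatr_eq0 -lt0n; exact/ltnW/card_residue_gt1. Qed.

Let qQ_double : qQ ^+ (2 * l) = qQ ^+ l ^+ 2.
Proof. by rewrite mulnC exprM. Qed.

Let expansion_index n : has_index (expansion n A) A (q ^ (2 * r * n)).
Proof. by rewrite -dimW; exact: has_index_expansion_lattice. Qed.

Let sub_expansion_subgroup n (L : set W) : omodule L ->
  subgroup (expansion n L).
Proof. by move=> omodL; exact/omodule_subgroup/expansion_omodule. Qed.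

Lemma filt_even_index n : has_index (filt n.*2) A (q ^ (2 * r * n + l)).
Proof.
rewrite filt_even addnC expnD; apply: (has_indexM (M := expansion n A)) => //.
- exact: sub_expansion_subgroup.
- exact: sub_expansion_subgroup.
- exact: sub_expansion.
- exact: expansion_sub.
- exact: has_index_expansion.
Qed.

Lemma filt_odd_index n : exists2 x,
  has_index (filt n.*2.+1) A x & (q ^ l * x)%N = (q ^ (2 * r * n.+1))%N.
Proof.
apply: has_index_lower (expansion_index n.+1) => //.
- exact: sub_expansion_subgroup.
- exact: filtA.
- by rewrite filt_odd; exact: expansion_sub.
- by rewrite filt_odd; exact: has_index_expansion.
Qed.

Lemma layerS_index k m n : has_index (filt k.+1) A m ->
  has_index (filt k) A n ->
  (n <= m)%N /\ has_index (layer k.+1) A (m - n).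
Proof.
apply: has_index_setD => //; first exact: filt_succ.
by move=> u v; exact: filt_translate.
Qed.

Lemma layer_even_index n : exists2 m, has_index (layer n.+1.*2) A m &
  m%:R = qQ ^ ((2 * r * n.+1)%:Z - l%:Z) * (qQ ^+ (2 * l) - 1).
Proof.
have [x oddx xE] := filt_odd_index n.
have [le_x layer_index] := layerS_index (filt_even_index n.+1) oddx.
exists (q ^ (2 * r * n.+1 + l) - x)%N => //.
have xQ : x%:R = qQ ^+ (2 * r * n.+1) / qQ ^+ l.
  by rewrite -natrX -xE natrM natrX mulrC mulKf // expf_neq0.
rewrite natrB // xQ natrX -/qQ exprD expfzDr // -exprnN -exprnP qQ_double.
by move: (qQ ^+ l) (qQ ^+ _) (expf_neq0 l qQ_neq0) => y z y0; field.
Qed.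

Lemma layer_odd_index n : exists2 m, has_index (layer n.*2.+1) A m &
  m%:R = qQ ^+ (2 * r * n + l) * (qQ ^ (2 * (r%:Z - l%:Z)) - 1).
Proof.
have [x oddx xE] := filt_odd_index n.
have [le_x layer_index] := layerS_index oddx (filt_even_index n).
exists (x - q ^ (2 * r * n + l))%N => //.
have xQ : x%:R = qQ ^+ (2 * r * n) * qQ ^+ (2 * r) / qQ ^+ l.
  by rewrite -exprD -mulnSr -natrX -xE natrM natrX mulrC mulKf // expf_neq0.
have -> : 2 * (r%:Z - l%:Z) = (2 * r)%N%:Z + - (2 * l)%N%:Z by lia.
rewrite natrB // xQ natrX -/qQ exprD expfzDr // -exprnN -exprnP qQ_double.
by move: (qQ ^+ l) (qQ ^+ (2 * r * n)) (qQ ^+ (2 * r)) (expf_neq0 l qQ_neq0)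
  => y z t y0; field.
Qed.

Lemma residual_rank_leq : (l <= r)%N.
Proof.
have [x oddx xE] := filt_odd_index 0.
have [le_x _] := layerS_index oddx (filt_even_index 0).
have : (q ^ l * q ^ (2 * r * 0 + l) <= q ^ (2 * r * 1))%N
  by rewrite -xE leq_mul2l le_x orbT.
by rewrite -expnD leq_exp2l ?card_residue_gt1 //; lia.
Qed.

Lemma Esub0_even_has_dim :
  has_dim (parity_part false (Esub 0)) (1 + 1 / 2 * (qQ ^+ l - 1)).
Proof. by rewrite -natrX EsubE; exact: layer0_even_has_dim. Qed.

Lemma Esub0_odd_has_dim :
  has_dim (parity_part true (Esub 0)) (1 / 2 * (qQ ^+ l - 1)).
Proof. by rewrite -natrX EsubE; exact: layer0_odd_has_dim. Qed.

Lemma Esub_has_dim n s : (1 <= n)%N -> has_dim (parity_part s (Esub n))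
  (1 / 2 * qQ ^ ((2 * r * n)%:Z - l%:Z) * (qQ ^+ (2 * l) - 1)).
Proof.
case: n => // n _; have [m mk mE] := layer_even_index n.
by rewrite EsubE -mulrA -mE; exact: layerS_has_dim.
Qed.

Lemma Esub1_has_dim n s : has_dim (parity_part s (Esub1 n))
  (1 / 2 * qQ ^+ (2 * r * n + l) * (qQ ^ (2 * (r%:Z - l%:Z)) - 1)).
Proof.
have [m mk mE] := layer_odd_index n.
by rewrite Esub1E -mulrA -mE; exact: layerS_has_dim.
Qed.

Let half_neq0 : (1 / 2 : rat) != 0. Proof. by []. Qed.

Let qQX_sub1_neq0 k : (qQ ^+ k - 1 != 0) = (0 < k)%N.
Proof.
case: k => [|k]; first by rewrite expr0 subrr eqxx.
by rewrite subr_eq0 gt_eqF // exprn_egt1 // ltr1n card_residue_gt1.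
Qed.

Lemma Esub0_odd_nonzero :
  nonzero_space (parity_part true (Esub 0)) <-> (0 < l)%N.
Proof.
by rewrite (has_dim_nonzero Esub0_odd_has_dim) mulf_eq0 negb_or half_neq0
  qQX_sub1_neq0.
Qed.

Lemma Esub_nonzero n s : (1 <= n)%N ->
  nonzero_space (parity_part s (Esub n)) <-> (0 < l)%N.
Proof.
move=> n1; rewrite (has_dim_nonzero (Esub_has_dim s n1)) !mulf_eq0
  !negb_or half_neq0.
by rewrite (expfz_neq0 _ qQ_neq0) qQX_sub1_neq0 muln_gt0.
Qed.

Lemma Esub1_nonzero n s :
  nonzero_space (parity_part s (Esub1 n)) <-> (l < r)%N.
Proof.
have rlE : 2 * (r%:Z - l%:Z) = (2 * (r - l))%N%:Z by have := residual_rank_leq;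
  lia.
rewrite (has_dim_nonzero (Esub1_has_dim n s)) rlE !mulf_eq0 !negb_or half_neq0.
by rewrite (expf_neq0 _ qQ_neq0) qQX_sub1_neq0 muln_gt0 subn_gt0.
Qed.

End LayerIndices.

(** * Orthogonal decomposition of the lattice model *)

Local Notation hilbert := (hilbert_space psi beta A).

Definition adherent (E : set (W -> R[i])) f : Prop := forall e : R, 0 < e ->
  exists2 h, E h & (hnorm2 A (fun w => (f w - h w)%R) < e%:E)%E.

Lemma Re_norm (z : R[i]) : (complex.Re `|z|)%:C%C = `|z|.
Proof. by rewrite RRe_real // normr_real. Qed.

Lemma norm_lt_eq0 (z : R[i]) : (forall d : R, 0 < d -> `|z| < d%:C%C) -> z = 0.
Proof.
move=> z_small; apply/eqP/negPn/negP; rewrite -normr_gt0 -(Re_norm z) ltcR.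
by move=> /z_small; rewrite Re_norm ltxx.
Qed.

Lemma quasi_periodic_norm f v w :
  quasi_periodic f -> A (v - w) -> `|f v| = `|f w|.
Proof.
by move=> qf vw; rewrite (quasi_periodic_val qf vw) normrM
  (psi_norm psi_char) mul1r.
Qed.

Lemma hnorm2_ge f w :
  quasi_periodic f -> (((complex.Re `|f w|) ^+ 2)%:E <= hnorm2 A f)%E.
Proof.
move=> qf; have Aw := coset_repP w subA; rewrite -(quasi_periodic_norm qf Aw).
apply: esum_ge; exists [set coset_rep A w]; last by rewrite fsbig_set1.
by split; [exact: finite_set1|move=> _ ->; exists w].
Qed.

Lemma norm_lt_of_hnorm2 f (d : R) w : quasi_periodic f -> 0 < d ->
  (hnorm2 A f < (d ^+ 2)%:E)%E -> `|f w| < d%:C%C.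
Proof.
move=> qf d0 f_lt; have := le_lt_trans (hnorm2_ge w qf) f_lt; rewrite lte_fin.
rewrite -Re_norm ltcR ltr_pXn2r // nnegrE ?(ltW d0) //.
by rewrite -lecR Re_norm normr_ge0.
Qed.

Lemma adherent_pointwise (E : set (W -> R[i])) f (d : R) : E `<=` hilbert ->
  hilbert f -> adherent E f -> 0 < d ->
  exists2 h, E h & forall w, `|f w - h w| < d%:C%C.
Proof.
move=> sE [qf _] adhf d0; have [h Eh fh] := adhf _ (exprn_gt0 2 d0).
exists h => // v; have [qh _] := sE _ Eh.
apply: (norm_lt_of_hnorm2 (f := fun w => f w - h w)) => //.
have -> : (fun w => f w - h w) = (fun w => -1 * h w + f w).
  by apply/funext => w; rewrite mulN1r addrC.
exact: quasi_periodicD.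
Qed.

Lemma adherent_relation (E : set (W -> R[i])) f v w (z : R[i]) :
  E `<=` hilbert -> hilbert f -> adherent E f ->
  (forall h, E h -> h v = z * h w) -> f v = z * f w.
Proof.
move=> sE Hf adhf Evw; apply/eqP; rewrite -subr_eq0; apply/eqP.
apply: norm_lt_eq0 => d d0; set n := complex.Re `|z|.
have n1 : 0 < 1 + n by rewrite ltr_wpDr // -lecR Re_norm normr_ge0.
have [h Eh fh] := adherent_pointwise sE Hf adhf (divr_gt0 d0 n1).
have -> : f v - z * f w = (f v - h v) - z * (f w - h w).
  by rewrite (Evw h Eh); ring.
apply: le_lt_trans (ler_normB _ _) _; rewrite normrM.
have -> : d%:C%C = (d / (1 + n))%:C%C + `|z| * (d / (1 + n))%:C%C.
  rewrite -Re_norm -rmorphM -rmorphD -/n; congr (_%:C%C).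
  by field; rewrite gt_eqF.
by apply: ltr_leD; rewrite ?fh // ler_wpM2l ?normr_ge0 // ltW ?fh.
Qed.

Lemma adherent_vanishes (E : set (W -> R[i])) f w : E `<=` hilbert ->
  hilbert f -> adherent E f -> (forall h, E h -> h w = 0) -> f w = 0.
Proof.
move=> sE Hf adhf Ew; rewrite -(mul0r (f w)).
by apply: adherent_relation sE Hf adhf _ => h Eh; rewrite Ew // mul0r.
Qed.

Lemma layer_space_closed k s : closed_subspace psi beta A (layer_space k s).
Proof.
split; [exact: layer_space_linear|exact: layer_space_sub|].
move=> f Hf adhf; have [qf _] := Hf; have sH := @layer_space_sub k s.
apply/layer_spaceP; split=> // w.
  by apply: (adherent_relation sH Hf adhf) => h /layer_spaceP[_ ph _];
    exact: ph.
apply: contra_notP => nlw; apply: (adherent_vanishes sH Hf adhf).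
by move=> h /layer_spaceP[_ _ hk]; exact: eq0_notin_supp hk nlw.
Qed.

Lemma hdot_eq0 f h : (forall w, f w * (h w)^*%C = 0) -> hdot A f h = 0.
Proof.
move=> fh0.
have rsum0 (D : set W) (G : W -> R) : (forall w, G w = 0) -> rsum D G = 0.
  by move=> G0; rewrite /rsum !esum1 ?subrr // => w _; rewrite G0 ?oppr0 maxxx.
by rewrite /hdot !rsum0 // => w; rewrite fh0.
Qed.

Lemma rsum_odd (G : W -> R) : (forall w, G (- w) = - G w) ->
  (forall v w, A (v - w) -> G v = G w) -> rsum (coset_reps setT A) G = 0.
Proof.
move=> GN GA; have N_bij : set_bij (coset_reps setT A) (coset_reps setT A)
    (fun w => coset_rep A (- w)).
  apply: (coset_reps_bij (e' := -%R)) => //; first exact: opprK.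
  by move=> v w; rewrite -opprD subgroupNE.
rewrite /rsum (reindex_esum _ _ _ _ N_bij).
rewrite (eq_esum (b := fun w => (Num.max (- G w) 0)%:E)) ?subrr // => w _.
by rewrite (GA _ (- w)) ?GN //; exact: coset_repP.
Qed.

Lemma layer_space_orthogonal j k s s' f h : (j, s) <> (k, s') ->
  layer_space j s f -> layer_space k s' h -> hdot A f h = 0.
Proof.
move=> ne /layer_spaceP[qf pf fj] /layer_spaceP[qh ph hk].
have [jk|jk] := eqVneq j k; last first.
  apply: hdot_eq0 => w; have [->|/eqP fw] := eqVneq (f w) 0;
    first by rewrite mul0r.
  have [->|/eqP hw] := eqVneq (h w) 0; first by rewrite conjc0 mulr0.
  by case/eqP: jk; exact: layer_inj (fj _ fw) (hk _ hw).
have ss : s (+) s'.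
  by rewrite jk in ne; case: s s' ne {pf ph} => [] [] ne //; case: ne.
pose F w := f w * (h w)^*%C.
have FN w : F (- w) = - F w.
  rewrite /F pf ph rmorphM rmorphXn rmorphN rmorph1 mulrACA -exprD.
  by rewrite -signr_odd oddD !oddb ss mulN1r.
have FA v w : A (v - w) -> F v = F w.
  move=> vw; rewrite /F (quasi_periodic_val qf vw) (quasi_periodic_val qh vw).
  by rewrite rmorphM mulrACA -sqr_normc (psi_norm psi_char) expr1n mul1r.
have -> : hdot A f h =
    Complex (rsum (coset_reps setT A) (fun w => complex.Re (F w)))
            (rsum (coset_reps setT A) (fun w => complex.Im (F w))) by [].
by rewrite !rsum_odd // => [w|v w /FA->|w|v w /FA->] //; rewrite FN;
  case: (F w).
Qed.

Definition parity_proj s f : W -> R[i] := fun w =>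
  2^-1 * (f w + (-1) ^+ s * f (- w)).

Lemma parity_proj_parity s f : has_parity s (parity_proj s f).
Proof.
by move=> w; rewrite /parity_proj opprK; case: s; rewrite ?expr0 ?expr1; ring.
Qed.

Lemma parity_proj_quasi_periodic s f : quasi_periodic f ->
  quasi_periodic (parity_proj s f).
Proof.
move=> qf a w Aa; rewrite /parity_proj opprD qf // qf;
  last exact: (subgroupN subA).
by rewrite (formNl bP) (formNr bP) opprK; ring.
Qed.

Lemma parity_projD f w : parity_proj false f w + parity_proj true f w = f w.
Proof. by rewrite /parity_proj expr0 expr1; field. Qed.

Lemma restrict_layer_space k s f :
  quasi_periodic f -> layer_space k s (restrict (layer k) (parity_proj s f)).
Proof.
move=> qf; apply/layer_spaceP; split; last exact: restrict_supp.
- move=> a w Aa; rewrite /restrict (asbool_equiv_eq (layerDA k w Aa));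
    case: asboolP => _; last by rewrite mulr0.
  exact: parity_proj_quasi_periodic.
- move=> w; rewrite /restrict (asbool_equiv_eq (layerN k w));
    case: asboolP => _; last by rewrite mulr0.
  exact: parity_proj_parity.
Qed.

Definition piece_of k s : piece :=
  if odd k then Piece1 k./2 s else Piece k./2 s.

Definition piece_layer (i : piece) : nat :=
  match i with Piece n _ => n.*2 | Piece1 n _ => n.*2.+1 end.

Definition piece_odd (i : piece) : bool :=
  match i with Piece _ s => s | Piece1 _ s => s end.

Lemma piece_layerK k s : piece_layer (piece_of k s) = k.
Proof. by have := odd_double_half k; rewrite /piece_of; case: (odd k). Qed.

Lemma piece_oddK k s : piece_odd (piece_of k s) = s.
Proof. by rewrite /piece_of; case: (odd k). Qed.

Lemma piece_ofK i : piece_of (piece_layer i) (piece_odd i) = i.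
Proof.
by case: i => n s; rewrite /piece_of /= odd_double ?uphalf_double ?doubleK.
Qed.

Lemma EpieceE i :
  Epiece i = layer_space (piece_layer i) (piece_odd i).
Proof. by case: i => n s; rewrite /= ?EsubE ?Esub1E. Qed.

Definition piece_proj f i : W -> R[i] :=
  restrict (layer (piece_layer i)) (parity_proj (piece_odd i) f).

Definition pieces_upto n : seq piece :=
  [seq piece_of k s | k <- iota 0 n.+1, s <- [:: false; true]].

Lemma filt_layers n w : filt n w <-> exists2 k, (k < n.+1)%N & layer k w.
Proof.
split=> [fw|[k kn lw]]; last by apply: filt_leq (layer_filt lw); rewrite -ltnS.
by have [k lw] := layer_exists w; exists k => //; exact: layer_leq lw fw.
Qed.

Lemma sum_piece_proj f n w :
  \sum_(i <- pieces_upto n) piece_proj f i w = restrict (filt n) f w.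
Proof.
rewrite /pieces_upto big_allpairs_dep.
rewrite (eq_bigr (fun k => restrict (layer k) f w)) => [|k _]; last first.
  rewrite !big_cons big_nil /= addr0 /piece_proj !piece_layerK
    !piece_oddK /restrict.
  by case: asboolP => _; rewrite ?addr0 ?parity_projD.
have off j : ~ layer j w -> restrict (layer j) f w = 0.
  exact: eq0_notin_supp (@restrict_supp _ _).
rewrite [RHS]/restrict (asbool_equiv_eq (filt_layers n w)).
case: asboolP => [[k kn lk]|no_k].
  rewrite (bigD1_seq k) ?iota_uniq ?mem_iota //= restrict_in // big1
    ?addr0 // => j jk.
  by apply: off => lj; case/eqP: jk; exact: layer_inj lj lk.
rewrite big1_seq // => k /andP[_]; rewrite mem_iota add0n => kn.
by apply: off => lk; apply: no_k; exists k.
Qed.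

Lemma finite_set_filt (X : set W) : finite_set X -> exists n, X `<=` filt n.
Proof.
case/finite_seqP => F ->; elim: F => [|w F [n Fn]]; first by exists 0%N.
have [j jw] := filt_exists w; exists (maxn j n) => v /=.
rewrite inE => /orP[/eqP->|vF]; first by apply: filt_leq jw; exact: leq_maxl.
by apply: filt_leq (Fn v vF); exact: leq_maxr.
Qed.

Lemma hnorm2_restrictC (D : set W) f :
  hnorm2 A (fun w => (f w - restrict D f w)%R) =
  (\esum_(w in coset_reps setT A `&` ~` D) ((complex.Re `|f w|) ^+ 2)%:E)%E.
Proof.
rewrite /hnorm2 (esumID D); last by move=> w _; rewrite lee_fin sqr_ge0.
rewrite esum1 ?add0e => [|w [_ Dw]]; last first.
  by rewrite restrict_in // subrr normr0 expr0n.
by apply: eq_esum => w [_ nDw]; rewrite /restrict asboolF // subr0.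
Qed.

Lemma hnorm2_tail f (e : R) : (hnorm2 A f < +oo)%E -> 0 < e -> exists n,
  (hnorm2 A (fun w => (f w - restrict (filt n) f w)%R) < e%:E)%E.
Proof.
move=> fin e0; pose F w : \bar R := ((complex.Re `|f w|) ^+ 2)%:E.
have F0 w : (0 <= F w)%E by rewrite lee_fin sqr_ge0.
have norm_fin : hnorm2 A f \is a fin_num
  by rewrite ge0_fin_numE // esum_ge0 // => w _; exact: F0.
have [_ [X [finX sX] <-] X_lt] := ub_ereal_sup_adherent e0 norm_fin.
have [n Xn] := finite_set_filt finX; exists n; rewrite hnorm2_restrictC.
set tail := (\esum_(w in _) _)%E; set part := (\sum_(w \in X) _)%E in X_lt.
have norm_ge : (part + tail <= hnorm2 A f)%E.
  rewrite /hnorm2 [leRHS](esumID (filt n)); last by move=> w _; exact: F0.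
  apply: leeD2r; apply: esum_ge; exists X => //.
  by split=> // w Xw; split; [exact: sX|exact: Xn].
have part0 : (0 <= part)%E by apply: fsume_ge0 => w _; exact: F0.
have tail0 : (0 <= tail)%E by apply: esum_ge0 => w _; exact: F0.
have part_fin : part \is a fin_num.
  by rewrite ge0_fin_numE //; apply: le_lt_trans fin; apply: le_trans norm_ge;
    exact: leeDl.
have tail_fin : tail \is a fin_num.
  by rewrite ge0_fin_numE //; apply: le_lt_trans fin; apply: le_trans norm_ge;
    exact: leeDr.
move: X_lt; rewrite -/(hnorm2 A f) lteBlDr // => X_lt.
by have := le_lt_trans norm_ge X_lt; rewrite lteD2lE.
Qed.

Lemma hilbert_sum_pieces : hilbert_sum psi beta A Epiece.
Proof.
split=> [i|i j ij f h|f [qf fin] e e0].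
- by rewrite EpieceE; exact: layer_space_closed.
- rewrite !EpieceE; apply: layer_space_orthogonal => -[layer_ij odd_ij].
  by apply: ij; rewrite -(piece_ofK i) layer_ij odd_ij piece_ofK.
have [n tail_lt] := hnorm2_tail fin e0.
exists (pieces_upto n), (piece_proj f); split=> [i|].
  by rewrite EpieceE; exact: restrict_layer_space.
by under eq_fun do rewrite sum_piece_proj.
Qed.

(** * Irreducibility and multiplicity one *)

Local Notation closed_subspace := (closed_subspace psi beta A).

Lemma neq0_point f : f <> (fun=> 0) -> exists w, f w <> 0.
Proof.
move=> f0; apply: contrapT => no_w; apply: f0; apply/funext => w.
by apply: contrapT => fw; apply: no_w; exists w.
Qed.

Lemma layer_space_point k s f w :
  layer_space k s f -> f w <> 0 -> layer k w /\ (s -> ~ A w).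
Proof. by move=> /layer_space_supp kf /kf/parity_layerP. Qed.

Lemma layer_space_invariant_Mop k s : invariant_under KB Mop (layer_space k s).
Proof.
move=> g f gK /layer_spaceP[qf pf fk]; apply/layer_spaceP; split.
- exact: Mop_quasi_periodic.
- exact: Mop_parity.
- exact: Mop_supp_layer.
Qed.

Lemma parity_proj_in (E : set (W -> R[i])) s f : linear_subspace E ->
  invariant_under KB Mop E -> quasi_periodic f -> E f -> E (parity_proj s f).
Proof.
move=> linE invE qf Ef; have [_ ED] := linE.
have EN : E (fun x => f (- x)).
  by rewrite -(Mop_opp qf); apply: invE => //; exact: opp_stabilizer.
have := subspaceZ 2^-1 linE (ED ((-1) ^+ s) _ _ EN Ef).
by congr E; apply/funext => x; rewrite addrC.
Qed.

Lemma orbit_fun_generates (E : set (W -> R[i])) k s w : linear_subspace E ->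
  invariant_under KB Mop E -> layer k w -> (s -> ~ A w) -> E (orbit_fun s w) ->
  layer_space k s `<=` E.
Proof.
move=> linE invE lw sw Ew h kh; have /layer_spaceP[qh ph _] := kh.
have [m [I [t [tP _]]]] := parity_layer_half_index k s.
rewrite (orbit_expansion tP qh ph (layer_space_supp kh)).
apply: subspace_sum => // i; have [kt _ _] := tP.
have /parity_layerP[lt st] := kt i.
exact: orbit_fun_transitive linE invE k s w _ lw lt sw st Ew.
Qed.

Section RestrictionToLayer.
Variables (E : set (W -> R[i])) (k : nat).

Definition vanishing_on_layer : set (W -> R[i]) :=
  [set h | E h /\ forall x, layer k x -> h x = 0].

Lemma vanishing_on_layer_closed :
  closed_subspace E -> closed_subspace vanishing_on_layer.
Proof.
move=> [[E0 ED] sE clE]; have sH : vanishing_on_layer `<=` hilbert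
  by move=> f [/sE].
split=> // [|f Hf adhf].
  split=> [|z f h [Ef f0] [Eh h0]]; first by split.
  by split=> [|x lx]; [exact: ED|rewrite f0 // h0 // mulr0 addr0].
split; first by apply: clE => // e /adhf[h [Eh _] fh]; exists h.
move=> x lx; apply: (adherent_vanishes sH Hf adhf) => h [_]; exact.
Qed.

Lemma vanishing_on_layer_invariant :
  invariant_under KB Mop E -> invariant_under KB Mop vanishing_on_layer.
Proof.
move=> invE g h gK [Eh h0]; split; first exact: invE.
move=> x lx; rewrite -(restrict_in _ lx) -Mop_restrict //.
apply: Mop_const => // a _; rewrite /Mop_term /restrict.
by case: asboolP => [/h0->|_]; rewrite mulr0.
Qed.

Hypotheses (linE : linear_subspace E) (invE : invariant_under KB Mop E).

Let restrictions : set (W -> R[i]) := [set restrict (layer k) h | h in E].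

Let restrictions_linear : linear_subspace restrictions.
Proof.
have [E0 ED] := linE; split=> [|z _ _ [h Eh <-] [h' Eh' <-]].
  by exists (fun=> 0) => //; apply/funext => x; rewrite /restrict if_same.
exists (fun x => z * h x + h' x); first exact: ED.
by apply/funext => x; rewrite /restrict; case: asboolP => // _;
  rewrite mulr0 addr0.
Qed.

Let restrictions_invariant : invariant_under KB Mop restrictions.
Proof.
move=> g _ gK [h Eh <-]; exists (Mop g h); first exact: invE.
by rewrite Mop_restrict.
Qed.

Lemma orbit_fun_restriction s f w : E f -> quasi_periodic f ->
  layer k w -> parity_proj s f w <> 0 ->
  exists2 h, E h & restrict (layer k) h = orbit_fun s w.
Proof.
move=> Ef qf lw fw.
have /layer_spaceP[qr pr rk] := restrict_layer_space k s qf.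
apply: (orbit_fun_in restrictions_linear restrictions_invariant _ qr pr rk).
  by exists (parity_proj s f) => //; exact: parity_proj_in.
by rewrite restrict_in.
Qed.

Hypothesis restriction_inj : forall h, vanishing_on_layer h -> h = (fun=> 0).

(* [h] is an eigenvector of the diagonal transvections, because its restriction
   to the layer is one. *)
Lemma orbit_fun_of_restriction s h w : E h -> quasi_periodic h ->
  layer k w -> (s -> ~ A w) -> restrict (layer k) h = orbit_fun s w ->
  h = orbit_fun s w.
Proof.
move=> Eh qh lw sw hE; have [_ ED] := linE.
rewrite -hE restrict_id //.
suff h_orbit : supp h `<=` sign_eqmod A ^~ w.
  by move=> v /h_orbit vw; exact: layer_sign_eqmod vw lw.
apply: (eigenvector_supp qh) => j c u cu Aw.
have tB := diag_transvection_B cu; set t := transvection beta c u in tB *.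
pose h' x := - transvection_char c u w * h x + Mop t h x.
have h'0 : h' = (fun=> 0).
  apply: restriction_inj; split=> [|y ly]; first by apply: ED => //;
    exact: invE.
  rewrite /h' -(restrict_in (Mop t h) ly) -Mop_restrict // hE.
  by rewrite (Mop_diag_orbit_fun sw cu Aw) -hE restrict_in // mulNr addNr.
apply/funext => x; apply/eqP; rewrite -subr_eq0 addrC -mulNr; apply/eqP.
exact: (congr1 (@^~ x) h'0).
Qed.

End RestrictionToLayer.

Section Representation.
Variables (S : 'End(W) -> (W -> R[i]) -> (W -> R[i]))
  (scalar : 'End(W) -> R[i]).
Hypothesis SE : forall g f, KB g -> S g f = (fun w => scalar g * Mop g f w).
Hypothesis scalar_neq0 : forall g, KB g -> scalar g != 0.

Lemma invariant_Mop (E : set (W -> R[i])) : linear_subspace E ->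
  invariant_under KB S E <-> invariant_under KB Mop E.
Proof.
move=> linE; split=> invE g f gK Ef; last first.
  by rewrite SE //; apply: subspaceZ => //; exact: invE.
have := subspaceZ (scalar g)^-1 linE (invE g f gK Ef).
by congr E; apply/funext => w; rewrite SE // mulKf ?scalar_neq0.
Qed.

Lemma layer_space_invariant k s : invariant_under KB S (layer_space k s).
Proof.
by apply/(invariant_Mop (layer_space_linear k s));
  exact: layer_space_invariant_Mop.
Qed.

Lemma layer_space_irreducible k s : nonzero_space (layer_space k s) ->
  irreducible_rep psi beta A KB S (layer_space k s).
Proof.
move=> nz; split=> // F [linF sF clF] sFk /(invariant_Mop linF) invF.
have [[f Ff /neq0_point[w fw]]|] := pselect (nonzero_space F); last by left.
right; apply/seteqP; split=> //.
have /layer_spaceP[qf pf fk] := sFk _ Ff.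
have [lw sw] := layer_space_point (sFk _ Ff) fw.
apply: (orbit_fun_generates linF invF lw sw).
exact: (orbit_fun_in linF invF Ff qf pf fk fw).
Qed.

Section Intertwiner.
Variables (E : set (W -> R[i])) (T : (W -> R[i]) -> (W -> R[i])).
Hypothesis linE : linear_subspace E.
Hypothesis linT : forall (z : R[i]) f h, E f -> E h ->
  T (fun w => z * f w + h w) = (fun w => z * T f w + T h w).
Hypothesis TS : forall g f, KB g -> E f -> T (S g f) = S g (T f).

Lemma intertwiner0 : T (fun=> 0) = (fun=> 0).
Proof.
have [E0 _] := linE; have := linT 1 E0 E0.
under [X in T X]eq_fun do rewrite mulr0 addr0.
move=> T0; apply/funext => x; have /= := congr1 (@^~ x) T0.
by rewrite mul1r => /eqP; rewrite -subr_eq0 opprD addrA subrr sub0r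
  oppr_eq0 => /eqP.
Qed.

Lemma intertwinerZ (z : R[i]) f :
  E f -> T (fun w => z * f w) = (fun w => z * T f w).
Proof.
move=> Ef; have [E0 _] := linE; have := linT z Ef E0; rewrite intertwiner0.
under [X in T X]eq_fun do rewrite addr0.
by move=> ->; apply/funext => x; rewrite addr0.
Qed.

Lemma intertwiner_eigenvector g (z : R[i]) f : KB g -> E f ->
  Mop g f = (fun w => z * f w) -> Mop g (T f) = (fun w => z * T f w).
Proof.
move=> gK Ef gf; have := TS gK Ef; rewrite !SE // gf.
under [X in T X]eq_fun do rewrite mulrA.
rewrite intertwinerZ // => TSf; apply/funext => x;
  have /= := congr1 (@^~ x) TSf.
by rewrite -mulrA => /(mulfI (scalar_neq0 gK)).
Qed.

End Intertwiner.

Lemma layer_space_inequivalent j k s s' : nonzero_space (layer_space j s) ->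
  equivalent_reps KB S (layer_space j s) (layer_space k s') -> (j, s) = (k, s').
Proof.
move=> [f jf /neq0_point[w fw]] [T [[Tfun Tinj _] linT TS]].
have [lw sw] := layer_space_point jf fw; have linj := layer_space_linear j s.
have je := orbit_fun_layer_space lw sw; set e := orbit_fun s w in je.
have T_eig g z := @intertwiner_eigenvector _ T linj linT TS g z e ^~ je.
have kTe : layer_space k s' (T e) by exact: Tfun.
have /layer_spaceP[qTe pTe Tek] := kTe; have /layer_spaceP[qe pe _] := je.
have [v Tev] : exists v, T e v <> 0.
  apply: neq0_point => Te0; have [E0 _] := linj.
  have e0 : e = (fun=> 0) by apply: Tinj; rewrite ?inE // Te0
    (intertwiner0 linj linT).
  exact: orbit_fun_neq0 e0.
have vw : sign_eqmod A v w.
  apply: (eigenvector_supp qTe) Tev => n c u cu Aw.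
  apply: T_eig (diag_transvection_B cu) _.
  exact: Mop_diag_orbit_fun sw cu Aw.
congr (_, _); first exact: layer_inj (layer_sign_eqmod vw lw) (Tek _ Tev).
have := T_eig _ ((-1) ^+ s) (opp_stabilizer bP subB).
rewrite !Mop_opp // => /(_ (funext pe)) /(congr1 (@^~ v)) /=.
by rewrite pTe => /(mulIf (introN eqP Tev)) /(@signr_inj R[i]).
Qed.

Lemma irreducible_restriction_inj (E : set (W -> R[i])) k f w :
  closed_subspace E ->
  invariant_under KB S E -> irreducible_rep psi beta A KB S E ->
  E f -> layer k w -> f w <> 0 ->
  forall h, vanishing_on_layer E k h -> h = (fun=> 0).
Proof.
move=> clE invE [_ irrE] Ef lw fw h vh; apply: contrapT => h0.
have [linE _ _] := clE; have clV := vanishing_on_layer_closed k clE.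
have [||nV|VE] := irrE _ clV; first by move=> ? [].
- have [linV _ _] := clV; apply/(invariant_Mop linV).
  exact/vanishing_on_layer_invariant/(invariant_Mop linE).
- by apply: nV; exists h.
- by apply: fw; move: Ef; rewrite -VE => -[_]; apply.
Qed.

Lemma irreducible_is_layer_space (E : set (W -> R[i])) : closed_subspace E ->
  invariant_under KB S E -> irreducible_rep psi beta A KB S E ->
  exists k s, E = layer_space k s.
Proof.
move=> clE invSE irrE; have [linE sE _] := clE.
have invE : invariant_under KB Mop E by exact/(invariant_Mop linE).
have [[f Ef /neq0_point[w fw]] minE] := irrE; have [qf _] := sE _ Ef.
have [k lw] := layer_exists w.
have [s psw] : exists s, parity_proj s f w <> 0.
  apply: contrapT => no_s; apply: fw; rewrite -parity_projD.
  have p0 s : parity_proj s f w = 0.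
    by apply: contrapT => psw; apply: no_s; exists s.
  by rewrite !p0 addr0.
exists k, s.
have [_ sw] : layer k w /\ (s -> ~ A w).
  by apply: (layer_space_point (restrict_layer_space k s qf));
    rewrite restrict_in.
have [h Eh hE] := orbit_fun_restriction linE invE Ef qf lw psw.
have [qh _] := sE _ Eh.
have inj_k := irreducible_restriction_inj clE invSE irrE Ef lw fw.
have Ee : E (orbit_fun s w).
  by rewrite -(orbit_fun_of_restriction linE invE inj_k Eh qh lw sw hE).
have [|||nz|//] := minE (layer_space k s).
- exact: layer_space_closed.
- exact: orbit_fun_generates linE invE lw sw Ee.
- exact: layer_space_invariant.
case: nz; exists (orbit_fun s w); first exact: orbit_fun_layer_space.
exact: orbit_fun_neq0.
Qed.

Lemma proportional_multiplicity_free : multiplicity_free psi beta A KB S.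
Proof.
move=> E F clE invE irrE clF invF irrF EF.
have [k [s Ek]] := irreducible_is_layer_space clE invE irrE.
have [k' [s' Fk]] := irreducible_is_layer_space clF invF irrF.
case: irrE => nz _; rewrite Ek Fk in nz EF *.
by case: (layer_space_inequivalent nz EF) => -> ->.
Qed.

End Representation.

(** * The restriction of the Weil representation to the stabilizer of [B] *)

Section WeilRepresentation.
Variables (bstar : quotientSpace Bs B) (l : nat) (x : {vspace bstar}).
Variable theta : 'End(bstar) -> residue K.
Hypothesis theta_neq0 : forall g : 'End(bstar),
  isometry_group (qform lam beta (Q := bstar)) g -> theta g != 0.
Local Notation S := (weil_op psi A l x theta).

Definition weil_scalar g : R[i] :=
  let gbar := qmorph bstar g in
  let j := jdefect l x gbar in
  (omega psi lam (theta gbar))^-1 * omega psi lam 1 ^ (1 - j%:Z) *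
    sqrtC #|residue K|%:R ^+ j.

Lemma weil_opE g f : KB g -> S g f = (fun w => weil_scalar g * Mop g f w).
Proof. by []. Qed.

Lemma weil_scalar_neq0 g : KB g -> weil_scalar g != 0.
Proof.
move=> gK; have q0 : (#|residue K|%:R : R[i]) != 0.
  by rewrite pnatr_eq0 -lt0n; exact/ltnW/card_residue_gt1.
have omega0 := omega_neq0 psi_char psi_cond charF.
have theta_g := theta_neq0 (qmorph_isometry bP unifBs gK).
by rewrite !mulf_neq0 ?invr_eq0 ?expfz_neq0 ?expf_neq0 ?sqrtC_eq0
  ?omega0 ?oner_neq0.
Qed.

Lemma Epiece_invariant i : invariant_under KB S (Epiece i).
Proof.
by rewrite EpieceE; exact: layer_space_invariant weil_opE weil_scalar_neq0 _ _.
Qed.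

Lemma Epiece_irreducible i :
  nonzero_space (Epiece i) -> irreducible_rep psi beta A KB S (Epiece i).
Proof.
by rewrite EpieceE; exact: layer_space_irreducible weil_opE
  weil_scalar_neq0 _ _.
Qed.

Lemma Epiece_inequivalent i j : i <> j -> nonzero_space (Epiece i) ->
  ~ equivalent_reps KB S (Epiece i) (Epiece j).
Proof.
rewrite !EpieceE => ij nz eqv; apply: ij; rewrite -(piece_ofK i) -(piece_ofK j).
by case: (layer_space_inequivalent weil_opE weil_scalar_neq0 nz eqv) => -> ->.
Qed.

Lemma weil_multiplicity_free : multiplicity_free psi beta A KB S.
Proof. exact: proportional_multiplicity_free weil_opE weil_scalar_neq0. Qed.

End WeilRepresentation.

End GoodLattice.

Lemma skew_symmetric_symplectic (F : fieldType) (V : vectType F)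
    (b : {skew_symmetric V}) :
  2 != 0 :> F -> is_psymplectic b -> symplectic_form b.
Proof.
move=> two0 [nondeg _ _]; have bC u v : b u v = - b v u.
  by rewrite hermitian_subproof expr1 mulN1r.
apply: skew_symplectic_form => // [u v w|c u v|u u0].
- exact: linearDl.
- exact: linearZl_LR.
- apply/eqP; rewrite -memv0 -(eqP nondeg); apply/mem_orthovP => v _.
  by rewrite ?u0 // bC u0 oppr0.
Qed.

Theorem mainTheorem7 (R : realType) (K : localField)
  (charK : [pchar K] =i pred0) (charF : 2%N \notin [pchar (residue K)])
  (psi : K -> R[i]) (lam : int)
  (psi_char : unitary_character psi) (psi_cond : conductor psi lam)
  (r : nat) (r_gt0 : (0 < r)%N)
  (W : vectType K) (dimW : \dim {:W} = (2 * r)%N)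
  (beta : {skew_symmetric W}) (betaP : is_psymplectic beta)
  (B A : set W) (goodB : good_lattice lam beta B)
  (selfdualA : selfdual_lattice lam beta A)
  (sBA : B `<=` A) (sAB : A `<=` dual_lattice lam beta B)
  (bstar : quotientSpace (dual_lattice lam beta B) B)
  (l : nat) (dim_bstar : \dim {:bstar} = (2 * l)%N)
  (x : {vspace bstar}) (xE : [set y | y \in x] = [set qproj bstar a | a in A])
  (eps phi : l.-tuple bstar) (eps_x : basis_of x eps)
  (eps_phi : symplectic_basis (qform lam beta (Q:=bstar)) eps phi)
  (theta : 'End(bstar) -> residue K)
  (thetaP : is_theta (qform lam beta (Q:=bstar)) x eps phi theta) :
  let q : rat := #|residue K|%:R in
  let KB := stabilizer beta B in
  let S := weil_op psi A l x theta in
  let E := Esub psi beta A lam B in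
  let E1 := Esub1 psi beta A lam B in
  let Ei := Epiece psi beta A lam B in
  let even := false in
  let odd := true in
  [/\ (* (i) *)
      [/\ nonzero_space (E 0%N),
          nonzero_space (parity_part odd (E 0%N)) <-> (0 < l)%N,
          forall n s, (1 <= n)%N ->
            nonzero_space (parity_part s (E n)) <-> (0 < l)%N &
          forall n s, nonzero_space (parity_part s (E1 n)) <-> (l < r)%N],
      (* (ii) *)
      [/\ forall i, nonzero_space (Ei i) ->
            invariant_under KB S (Ei i) /\
            irreducible_rep psi beta A KB S (Ei i),
          forall i j, i <> j -> nonzero_space (Ei i) -> nonzero_space (Ei j) ->
            ~ equivalent_reps KB S (Ei i) (Ei j),
          multiplicity_free psi beta A KB S &
          hilbert_sum psi beta A Ei] &
      (* (iii) *)
      [/\ has_dim (parity_part even (E 0%N)) (1 + 1 / 2 * (q ^+ l - 1)),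
          has_dim (parity_part odd (E 0%N)) (1 / 2 * (q ^+ l - 1)),
          forall n s, (1 <= n)%N ->
            has_dim (parity_part s (E n))
              (1 / 2 * q ^ ((2 * r * n)%:Z - l%:Z) * (q ^+ (2 * l) - 1)) &
          forall n s,
            has_dim (parity_part s (E1 n))
              (1 / 2 * q ^+ (2 * r * n + l) * (q ^ (2 * (r%:Z - l%:Z)) - 1))]].
Proof.
move=> q KB S E E1 Ei even odd.
have bP := skew_symmetric_symplectic (two_neq0 charF) betaP.
have [latB unifBs sBBs] := goodB; have [latA _] := selfdualA.
have omodA := lattice_omodule latA.
have reflexiveB := good_lattice_reflexive bP sBBs unifBs eps_phi.
have dimx : \dim x = l by exact: size_basis eps_x.
have AB := Lagrangian_index bP dimx omodA sBA sAB xE.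
have BsA := dual_Lagrangian_index bP dim_bstar dimx omodA sBA sAB xE
  (omodule_subgroup (lattice_omodule latB)).
have [theta_neq0 _ _ _] := thetaP.
split; split.
- exact: Esub0_nonzero.
- exact: Esub0_odd_nonzero.
- exact: (Esub_nonzero
    charF bP goodB selfdualA sBA sAB psi_char psi_cond dimW BsA AB).
- exact: (Esub1_nonzero
    charF bP goodB selfdualA sBA sAB psi_char psi_cond dimW BsA AB).
- by move=> i nz; split; [exact: Epiece_invariant|exact: Epiece_irreducible].
- by move=> i j ij nz _; exact: Epiece_inequivalent.
- exact: weil_multiplicity_free.
- exact: hilbert_sum_pieces.
- exact: Esub0_even_has_dim.
- exact: Esub0_odd_has_dim.
- exact: (Esub_has_dim
    charF bP goodB selfdualA sBA sAB psi_char psi_cond dimW BsA AB).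
- exact: (Esub1_has_dim
    charF bP goodB selfdualA sBA sAB psi_char psi_cond dimW BsA AB).
Qed.
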